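(* Let $(J,K_1,K_2)$ be a triple with $J$ a compact subspace of $\mathbb{R}^N$ and $K_1$ and $K_2$ closed subspaces of $J$ whose union is $J$ and such that each of $J\setminus K_1$ and $J\setminus K_2$ is uncountable. Then there exists a topological embedding $\pi$ of $J$ into $\mathbb{C}^{N+4}$ such that $\pi(J)$ has nontrivial rational hull, but each of $\pi(K_1)$ and $\pi(K_2)$ is polynomially convex and $P(\pi(K_j))=C(\pi(K_j))$ for $j=1,2$.
   Context: For a compact set $X\subset\mathbb{C}^M$, the polynomial hull is $\widehat X=\{z\in\mathbb{C}^M:|p(z)|\le\max_{x\in X}|p(x)|\text{ for all polynomials }p\}$ and the rational hull is $h_r(X)=\{z\in\mathbb{C}^M:p(z)\in p(X)\text{ for all polynomials }p\}$, where polynomials are in the complex coordinates. $X$ is polynomially convex if $\widehat X=X$; the rational hull of $X$ is nontrivial if $h_r(X)\setminus X\neq\emptyset$. $C(X)$ is the algebra of continuous complex-valued functions on $X$, and $P(X)$ is the uniform closure in $C(X)$ of the polynomials in the complex coordinate functions $z_1,\ldots,z_M$. *)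

(* Defs.v *)
From HB Require Import structures.
From mathcomp Require Import all_boot all_order all_algebra.
From mathcomp Require Import all_classical all_reals all_analysis.
From mathcomp Require Import complex.
From mathcomp Require mpoly.

Set Implicit Arguments.
Unset Strict Implicit.
Unset Printing Implicit Defensive.

Import Order.TTheory GRing.Theory Num.Theory.
Import numFieldNormedType.Exports.

Local Open Scope classical_set_scope.
Local Open Scope ring_scope.

(* The library topologizes every abstract numClosedFieldType through its norm;
   this instance makes that topology available on R[i]. *)
HB.instance Definition _ (R : realType) := PseudoPointedMetric.copy R[i] R[i]^o.

Definition embedding_on (T U : topologicalType) (A : set T) (f : T -> U) : Prop :=
  {within A, continuous f} /\
  exists g : U -> T, {in A, cancel f g} /\ {within f @` A, continuous g}.

Section Hulls.
Variables (R : realType) (M : nat).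
Local Notation C := R[i].
Local Notation normc := ComplexField.Normc.normc.

Definition peval (p : mpoly.mpoly M C) (z : 'rV[C]_M) : C :=
  mpoly.meval (fun i => z ord0 i) p.

(* The supremum is the maximum for nonempty compact X, which is the only
   intended use: [sup] is 0 on unbounded sets. For X = set0 the polynomial 1
   makes the hull empty. *)
Definition polynomial_hull (X : set 'rV[C]_M) : set 'rV[C]_M :=
  [set z | forall p,
    normc (peval p z) <= sup [set normc (peval p x) | x in X]].

Definition rational_hull (X : set 'rV[C]_M) : set 'rV[C]_M :=
  [set z | forall p, (peval p @` X) (peval p z)].

Definition polynomially_convex (X : set 'rV[C]_M) : Prop :=
  polynomial_hull X = X.

Definition nontrivial_rational_hull (X : set 'rV[C]_M) : Prop :=
  rational_hull X `\` X !=set0.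

(* Functions on X are represented by total functions whose values outside X are
   irrelevant: neither [within X, continuous] nor the topology of
   [{uniform` X -> C}] sees them, so both sets below are saturated for equality
   on X, and they are equal iff the corresponding sets of functions on X are. *)
Definition cont_algebra (X : set 'rV[C]_M) : set {uniform` X -> C} :=
  [set f : 'rV[C]_M -> C | {within X, continuous f}].

Definition poly_algebra (X : set 'rV[C]_M) : set {uniform` X -> C} :=
  closure (range peval : set {uniform` X -> C}) `&` @cont_algebra X.

End Hulls.

Arguments cont_algebra {R M} X _.
Arguments poly_algebra {R M} X _.

(* Main.v *)
Require Import Defs.
From mathcomp Require Import all_boot all_order all_algebra.
From mathcomp Require Import all_classical all_reals all_analysis.
From mathcomp Require Import complex.
From mathcomp Require Import ring lra zify.
From mathcomp Require mpoly.
Import Order.TTheory GRing.Theory Num.Theory.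
Import numFieldNormedType.Exports.
Local Open Scope classical_set_scope.
Local Open Scope ring_scope.

Set Implicit Arguments.
Unset Strict Implicit.
Unset Printing Implicit Defensive.

(** The embedding is built from two Cantor sets [C1] inside [J \ K2] and [C2] inside
    [J \ K1]; such sets exist because these relatively open parts of a compact set are
    uncountable.  With [d] the distance to [C1 `|` C2], the map
      [x |-> (d x * x, d x, g1 x, g2 x, g3 x)]
    is injective off [C1 `|` C2], where its first [N + 1] coordinates vanish; everything
    happens in the three functions [g1, g2, g3], which are prescribed on [C1 `|` C2] and
    extended by Tietze's theorem.

    Let [E] be the Cantor square in the complex plane whose four similar pieces have
    ratio 1/3, carrying its uniform measure, and let [h] be the Cauchy transform of that
    measure.  A piece of level [n] has mass [4^-n] and diameter about [3^-n], so [h] is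
    bounded and continuous up to [E]: this uses 4/3 > 1.  Put a copy of [E] at distance
    100 from itself and consider [F z = (h z, z * h z, h (z - 100))], which is
    holomorphic off the two squares and has the value [(0, 1, 0)] at infinity.  The sets
    [C1] and [C2] are sent to the boundary values of [F] on the two squares.

    Rational hull.  If a polynomial [p] vanishes at [F infinity], then [p o F] has a zero
    at infinity and, were it zero-free on the totally disconnected set [E `|` (E + 100)],
    it would have a logarithm there, against the argument principle.  The proof works
    with the finite stages [F_n], rational with [2 * 4^n] poles: [p o F_n] has fewer
    finite zeros than poles, so near some pole there are fewer zeros than the order of
    the pole allows, and by Jensen's formula [p o F_n] then oscillates by a fixed factor on
    an annulus around that pole ([few_roots_oscillation], [proper_rat_oscillation]).
    The image of the annulus shrinks to a point of the Cantor set
    ([potential_near_step]), so [p] takes arbitrarily small values there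
    ([curve_hull]).  Jensen's formula is used in the finite form
    [prod (r w - a) = +- (a^M - r^M)] over the [M]-th roots of unity [w].

    Density on [K1] and [K2].  On the first square the third coordinate [h (z - 100)] is
    injective and nearly affine, and Newton's iteration recovers [z] itself as a uniform
    limit of polynomials ([ua_cauchy_inverse]).  Since [E] is a product of linear Cantor
    sets, vertical strips separate its pieces; the sign of the real part of a
    function avoiding a strip belongs to the algebra ([ua_sign], by Heron's iteration),
    so the digits of the real part of [z], hence the real part and the conjugate of [z],
    are limits of polynomials ([ua_Re_cantor_point]), and the Stone-Weierstrass theorem
    gives every continuous function on [C1].  As [K1] meets [C1 `|` C2] in [C1] only, the
    real coordinates [d x * x] and [d x] separate the other points of [K1], and
    density propagates from [C1] to [K1] ([algebra_localization]).  Density in turn implies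
    polynomial convexity ([polynomially_convex_full]).  The first coordinate plays the
    same role on the second square. *)

(** * Moduli of complex numbers and geometric convergence *)

(** The norm [`|z|] of [R[i]] takes its values in [R[i]]; real moduli keep all estimates
    in the ordered field [R]. *)
Notation normc := ComplexField.Normc.normc.
Notation toC z := (real_complex _ z).

Section Modulus.
Variable R : realType.
Implicit Types x y z : R[i].

Lemma normc_norm z : `|z| = toC (normc z).
Proof. by case: z => a b; rewrite normc_def. Qed.

Lemma normcD z y : normc (z + y) <= normc z + normc y.
Proof. by rewrite -lecR rmorphD /= -!normc_norm ler_normD. Qed.

Lemma normcN z : normc (- z) = normc z.
Proof. by apply: complexI; rewrite -!normc_norm normrN. Qed.

Lemma normcBC z y : normc (z - y) = normc (y - z).
Proof. by rewrite -opprB normcN. Qed.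

Lemma normcM z y : normc (z * y) = normc z * normc y.
Proof. exact: ComplexField.Normc.normcM. Qed.

Lemma normcV z : normc z^-1 = (normc z)^-1.
Proof. exact: ComplexField.Normc.normcV. Qed.

Lemma normc0 : normc (0 : R[i]) = 0.
Proof. exact: ComplexField.Normc.normc0. Qed.

Lemma normc1 : normc (1 : R[i]) = 1.
Proof. exact: ComplexField.Normc.normc1. Qed.

Lemma normc_ge0 z : 0 <= normc z.
Proof. by rewrite -lecR -normc_norm normr_ge0. Qed.

Lemma normc_eq0 z : (normc z == 0) = (z == 0).
Proof.
apply/eqP/eqP => [|->]; last exact: normc0.
exact: ComplexField.Normc.eq0_normc.
Qed.

Lemma normc_gt0 z : (0 < normc z) = (z != 0).
Proof. by rewrite lt_def normc_eq0 normc_ge0 andbT. Qed.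

Lemma normcX z n : normc (z ^+ n) = normc z ^+ n.
Proof. by elim: n => [|n IH]; rewrite ?normc1 // !exprS normcM IH. Qed.

Lemma normcR (r : R) : normc (toC r) = `|r|.
Proof. by rewrite /= expr0n /= addr0 sqrtr_sqr. Qed.

Lemma normc_nat n : normc (n%:R : R[i]) = n%:R.
Proof. by rewrite -(rmorph_nat (real_complex R)) normcR ger0_norm. Qed.

Lemma normc_triangle y x z : normc (x - z) <= normc (x - y) + normc (y - z).
Proof. by apply: le_trans (normcD _ _); rewrite addrA subrK. Qed.

Lemma normc_le_dist x y : normc x <= normc y + normc (x - y).
Proof. by apply: le_trans (normcD _ _); rewrite addrC subrK. Qed.

Lemma normc_sum (I : Type) (s : seq I) (P : pred I) (F : I -> R[i]) :
  normc (\sum_(i <- s | P i) F i) <= \sum_(i <- s | P i) normc (F i).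
Proof.
apply: (@big_ind2 _ _ (fun (x : R[i]) (y : R) => normc x <= y)) => [|x u y v hx hy|//].
  by rewrite normc0.
exact: le_trans (normcD _ _) (lerD hx hy).
Qed.

Lemma normc_prod (I : Type) (s : seq I) (F : I -> R[i]) :
  normc (\prod_(i <- s) F i) = \prod_(i <- s) normc (F i).
Proof.
elim: s => [|i s IH]; first by rewrite !big_nil normc1.
by rewrite !big_cons normcM IH.
Qed.

Lemma normcE z : normc z = Num.sqrt (complex.Re z ^+ 2 + complex.Im z ^+ 2).
Proof. by case: z. Qed.

Lemma Re_le_normc z : `|complex.Re z| <= normc z.
Proof.
rewrite normcE -(sqrtr_sqr (complex.Re z)) ler_sqrt ?lerDl ?sqr_ge0 //.
by rewrite addr_ge0 ?sqr_ge0.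
Qed.

Lemma Im_le_normc z : `|complex.Im z| <= normc z.
Proof.
rewrite normcE -(sqrtr_sqr (complex.Im z)) ler_sqrt ?lerDr ?sqr_ge0 //.
by rewrite addr_ge0 ?sqr_ge0.
Qed.

Lemma normc_le_ReIm z : normc z <= `|complex.Re z| + `|complex.Im z|.
Proof.
rewrite normcE -[leRHS]ger0_norm ?addr_ge0 // -sqrtr_sqr ler_sqrt ?sqr_ge0 //.
rewrite sqrrD !real_normK ?num_real //.
by rewrite lerD2r lerDl mulrn_wge0 // mulr_ge0.
Qed.

Lemma ReD z y : complex.Re (z + y) = complex.Re z + complex.Re y.
Proof. by case: z y => [? ?] [? ?]. Qed.
Lemma ReN z : complex.Re (- z) = - complex.Re z.
Proof. by case: z. Qed.
Lemma ImD z y : complex.Im (z + y) = complex.Im z + complex.Im y.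
Proof. by case: z y => [? ?] [? ?]. Qed.
Lemma ImN z : complex.Im (- z) = - complex.Im z.
Proof. by case: z. Qed.
Lemma ReMr z (r : R) : complex.Re (toC r * z) = r * complex.Re z.
Proof. by case: z => a b /=; rewrite mul0r subr0. Qed.
Lemma ImMr z (r : R) : complex.Im (toC r * z) = r * complex.Im z.
Proof. by case: z => a b /=; rewrite mul0r addr0. Qed.

(** The limit is the supremum of the lower bounds [u n - D * q ^ n]. *)
Lemma geometric_cauchy (u : nat -> R) (q B : R) : 0 <= q < 1 ->
  (forall n, `|u n.+1 - u n| <= B * q ^+ n) ->
  exists l, forall n, `|u n - l| <= B / (1 - q) * q ^+ n.
Proof.
move=> /andP[q0 q1] hu.
have B0 : 0 <= B by have := hu 0%N; rewrite expr0 mulr1; apply: le_trans.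
have q1' : 0 < 1 - q by rewrite subr_gt0.
set D := B / (1 - q).
have D0 : 0 <= D by rewrite divr_ge0 // ltW.
have DE : B = D - D * q by rewrite /D; field; rewrite gt_eqF.
have key n k : `|u (n + k)%N - u n| <= D * q ^+ n - D * q ^+ (n + k).
  elim: k => [|k IH]; first by rewrite addn0 !subrr normr0.
  rewrite addnS; apply: le_trans (ler_distD (u (n + k)%N) _ _) _.
  apply: le_trans (lerD (hu _) IH) _.
  by rewrite {1}DE exprS; lra.
have lb n k : (n <= k)%N -> `|u k - u n| <= D * q ^+ n.
  move=> nk; rewrite -(subnKC nk); apply: le_trans (key _ _) _.
  by rewrite gerBl mulr_ge0 // exprn_ge0.
pose S := range (fun n => u n - D * q ^+ n).
have cmp n k : u n - D * q ^+ n <= u k + D * q ^+ k.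
  case: (leqP n k) => [nk|/ltnW kn].
    have := lb _ _ nk; rewrite ler_norml => /andP[h _].
    have : 0 <= D * q ^+ k by rewrite mulr_ge0 // exprn_ge0.
    by move: h; set a := D * _; set b := D * _; lra.
  have := lb _ _ kn; rewrite ler_norml => /andP[_ h].
  have : 0 <= D * q ^+ n by rewrite mulr_ge0 // exprn_ge0.
  by move: h; set a := D * _; set b := D * _; lra.
have S0 : S !=set0 by exists (u 0%N - D * q ^+ 0); exists 0%N.
have hub k : ubound S (u k + D * q ^+ k) by move=> _ [n _ <-]; exact: cmp.
exists (sup S) => n; rewrite ler_norml.
have h1 : sup S <= u n + D * q ^+ n by apply: ge_sup.
have h2 : u n - D * q ^+ n <= sup S.
  by apply: ub_le_sup; [exists (u 0%N + D * q ^+ 0); exact: hub | exists n].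
by move: h1 h2; set b := D * _; lra.
Qed.

Lemma geometric_cauchyC (u : nat -> R[i]) (q B : R) : 0 <= q < 1 ->
  (forall n, normc (u n.+1 - u n) <= B * q ^+ n) ->
  exists l, forall n, normc (u n - l) <= 2 * (B / (1 - q)) * q ^+ n.
Proof.
move=> hq hu.
have [|a ha] := @geometric_cauchy (fun n => complex.Re (u n)) q B hq.
  move=> n; rewrite -ReN -ReD; exact: le_trans (Re_le_normc _) (hu n).
have [|b hb] := @geometric_cauchy (fun n => complex.Im (u n)) q B hq.
  move=> n; rewrite -ImN -ImD; exact: le_trans (Im_le_normc _) (hu n).
exists (Complex a b) => n; apply: le_trans (normc_le_ReIm _) _.
rewrite ReD ReN ImD ImN /= -mulrA mulr2n mulrDl mul1r.
exact: lerD (ha n) (hb n).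
Qed.
End Modulus.

(** * Jensen's formula through roots of unity *)

Section Jensen.
Variable R : realType.
Local Notation C := R[i].
Implicit Types (r s t : R) (a b p z w : C).

Lemma exp_gap s t (M : nat) : 0 <= s -> s < t -> (0 < M)%N ->
  t ^+ M * (1 - s / t) <= t ^+ M - s ^+ M.
Proof.
case: M => // M s0 st _; have t0 : 0 < t by apply: le_lt_trans st.
have h : s ^+ M <= t ^+ M by rewrite lerXn2r // ?nnegrE ltW.
have -> : t ^+ M.+1 * (1 - s / t) = t ^+ M.+1 - t ^+ M * s.
  by rewrite !exprS; field; rewrite gt_eqF.
by rewrite lerD2l lerN2 [s ^+ _]exprSr ler_wpM2r.
Qed.

Lemma normcX_sub_le a s (M : nat) : 0 <= s ->
  normc (a ^+ M - toC s ^+ M) <= normc a ^+ M + s ^+ M.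
Proof.
by move=> s0; rewrite -[leRHS](_ : normc (a ^+ M) + normc (- toC s ^+ M) = _)
  ?normcD // normcN !normcX normcR ger0_norm.
Qed.

Lemma normcX_sub_ge a s (M : nat) : 0 <= s ->
  `|normc a ^+ M - s ^+ M| <= normc (a ^+ M - toC s ^+ M).
Proof.
move=> s0; have e : normc (toC s ^+ M) = s ^+ M by rewrite normcX normcR ger0_norm.
have h1 := normc_le_dist (a ^+ M) (toC s ^+ M).
have h2 := normc_le_dist (toC s ^+ M) (a ^+ M).
move: h1 h2; rewrite normcX e [normc (toC s ^+ M - _)]normcBC.
by rewrite ler_norml; set x := normc (_ - _); lra.
Qed.

(** Passing from the circle of radius [r] to the one of radius [2 r], the
    geometric mean of [|z - a|] doubles when [a] is inside and is unchanged when
    [a] is outside: the product over the [M]-th roots of unity is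
    [|a ^ M - r ^ M|]. *)
Lemma jensen_inside r a : 0 < r -> normc a < r ->
  exists2 K : R, 0 < K & forall M, (0 < M)%N ->
  normc (a ^+ M - toC (2 * r) ^+ M) <= K * 2 ^+ M * normc (a ^+ M - toC r ^+ M).
Proof.
move=> r0 ar; set q := 1 - normc a / r.
have q0 : 0 < q by rewrite subr_gt0 ltr_pdivrMr // mul1r.
exists (2 / q) => [|M M0]; first by rewrite divr_gt0.
have r2 : 0 <= 2 * r by rewrite mulr_ge0 // ltW.
apply: le_trans (normcX_sub_le _ _ r2) _.
have h1 : normc a ^+ M <= (2 * r) ^+ M.
  rewrite lerXn2r // ?nnegrE ?normc_ge0 //; lra.
have h2 : r ^+ M * q <= normc (a ^+ M - toC r ^+ M).
  apply: le_trans (exp_gap (normc_ge0 a) ar M0) _.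
  apply: le_trans (normcX_sub_ge a M (ltW r0)).
  by rewrite -normrN opprB ler_norm.
have -> : 2 / q * 2 ^+ M * normc (a ^+ M - toC r ^+ M) =
  2 * 2 ^+ M * (normc (a ^+ M - toC r ^+ M) / q) by field; rewrite gt_eqF.
apply: (@le_trans _ _ (2 * (2 * r) ^+ M)); first by lra.
rewrite exprMn [leLHS]mulrA ler_wpM2l ?mulr_ge0 ?exprn_ge0 //.
by rewrite ler_pdivlMr.
Qed.

Lemma jensen_outside s t a : 0 <= t -> 0 <= s -> t < normc a -> s < normc a ->
  exists2 K : R, 0 < K & forall M, (0 < M)%N ->
  normc (a ^+ M - toC s ^+ M) <= K * normc (a ^+ M - toC t ^+ M).
Proof.
move=> t0 s0 ta sa; set q := 1 - t / normc a.
have a0 : 0 < normc a by apply: le_lt_trans ta.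
have q0 : 0 < q by rewrite subr_gt0 ltr_pdivrMr // mul1r.
exists (2 / q) => [|M M0]; first by rewrite divr_gt0.
apply: le_trans (normcX_sub_le _ _ s0) _.
have h1 : s ^+ M <= normc a ^+ M by rewrite lerXn2r // ?nnegrE ltW.
have h2 : normc a ^+ M * q <= normc (a ^+ M - toC t ^+ M).
  apply: le_trans (exp_gap t0 ta M0) _.
  apply: le_trans (normcX_sub_ge a M t0).
  by rewrite ler_norm.
have -> : 2 / q * normc (a ^+ M - toC t ^+ M) =
  2 * (normc (a ^+ M - toC t ^+ M) / q) by field; rewrite gt_eqF.
move: h2; rewrite -ler_pdivlMr // => h2.
by apply: le_trans (_ : 2 * normc a ^+ M <= _); [lra | rewrite ler_wpM2l].
Qed.

(** The constants do not depend on [M]: they are harmless after taking [M]-th roots. *)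
Lemma prod_le_const (bs : seq C) (f g : nat -> C -> R) :
  (forall M b, 0 <= f M b) ->
  (forall b, b \in bs ->
     exists2 K : R, 0 < K & forall M, (0 < M)%N -> f M b <= K * g M b) ->
  exists2 K : R, 0 < K & forall M, (0 < M)%N ->
    \prod_(b <- bs) f M b <= K * \prod_(b <- bs) g M b.
Proof.
move=> f0; elim: bs => [|b bs IH] hbs.
  by exists 1 => [|M M0]; [exact: ltr01 | rewrite !big_nil mul1r].
have [|K K0 hK] := IH; first by move=> x xb; apply: hbs; rewrite inE xb orbT.
have [K' K'0 hK'] := hbs b (mem_head _ _).
exists (K' * K) => [|M M0]; first exact: mulr_gt0.
rewrite !big_cons mulrACA; apply: ler_pM (hK' M M0) (hK M M0) => //.
by apply: prodr_ge0 => *; exact: f0.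
Qed.

Lemma prod_expr_count (T : Type) (P : pred T) (bs : seq T) (x : R) (M : nat) :
  \prod_(b <- bs) x ^+ (M * P b) = x ^+ (M * count P bs).
Proof.
elim: bs => [|b bs IH]; first by rewrite big_nil muln0.
by rewrite big_cons IH mulnDr exprD.
Qed.

Lemma jensen_roots r p (bs : seq C) : 0 < r ->
  (forall b, b \in bs -> normc (b - p) < r \/ 2 * r < normc (b - p)) ->
  exists2 K : R, 0 < K & forall M, (0 < M)%N ->
  \prod_(b <- bs) normc ((b - p) ^+ M - toC (2 * r) ^+ M) <=
  K * (2 ^+ (M * count (fun b => normc (b - p)%R <= 2 * r) bs) *
  \prod_(b <- bs) normc ((b - p) ^+ M - toC r ^+ M)).
Proof.
move=> r0 hbs.
pose f (M : nat) b := normc ((b - p) ^+ M - toC (2 * r) ^+ M).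
pose e (M : nat) b : R := 2 ^+ (M * (normc (b - p)%R <= 2 * r)%R).
pose g (M : nat) b := normc ((b - p) ^+ M - toC r ^+ M).
have [|b bb|K K0 hK] := @prod_le_const bs f (fun M b => e M b * g M b).
- by move=> *; exact: normc_ge0.
- have [hb|hb] := hbs b bb.
    have [K K0 hK] := jensen_inside r0 hb; exists K => [//|M /hK].
    rewrite /e mulrA (_ : normc (b - p)%R <= 2 * r = true) ?muln1 //.
    by apply/idP; lra.
  have r2 : 0 <= 2 * r by lra.
  have rb : r < normc (b - p)%R by lra.
  have [K K0 hK] := jensen_outside (ltW r0) r2 rb hb.
  exists K => [//|M /hK]; rewrite /e (_ : normc (b - p)%R <= 2 * r = false).
    by rewrite muln0 expr0 mul1r.
  by apply/negbTE; rewrite -ltNge.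
- exists K => [//|M M0]; rewrite -prod_expr_count -big_split; exact: hK.
Qed.

Lemma jensen_poles r p (bs : seq C) : 0 < r ->
  (forall b, b \in bs -> b = p \/ 2 * r < normc (b - p)) ->
  exists2 K : R, 0 < K & forall M, (0 < M)%N ->
  2 ^+ (M * count (pred1 p) bs) * \prod_(b <- bs) normc ((b - p) ^+ M - toC r ^+ M) <=
  K * \prod_(b <- bs) normc ((b - p) ^+ M - toC (2 * r) ^+ M).
Proof.
move=> r0 hbs.
pose f (M : nat) b := normc ((b - p) ^+ M - toC (2 * r) ^+ M).
pose e (M : nat) b : R := 2 ^+ (M * pred1 p b).
pose g (M : nat) b := normc ((b - p) ^+ M - toC r ^+ M).
have [M b|b bb|K K0 hK] := @prod_le_const bs (fun M b => e M b * g M b) f.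
- by rewrite mulr_ge0 ?normc_ge0 ?exprn_ge0.
- have [->|hb] := hbs b bb.
    exists 1 => [|M M0]; first exact: ltr01.
    rewrite /e /f /g /= eqxx muln1 subrr (expr0n C) eqn0Ngt M0 !sub0r !normcN.
    by rewrite mul1r !normcX !normcR !ger0_norm ?exprMn //; lra.
  have r2 : 0 <= 2 * r by lra.
  have rb : r < normc (b - p)%R by lra.
  have [K K0 hK] := jensen_outside r2 (ltW r0) hb rb.
  exists K => [//|M /hK].
  rewrite /e /= -subr_eq0 -normc_eq0 (_ : normc (b - p)%R == 0 = false).
    by rewrite muln0 expr0 mul1r.
  by apply/negbTE; rewrite gt_eqF // (lt_trans r0).
- exists K => [//|M M0]; rewrite -prod_expr_count -big_split; exact: hK.
Qed.

Lemma ler_exp2 (k l : nat) : (k <= l)%N -> (2 : R) ^+ k <= 2 ^+ l.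
Proof. by move=> kl; apply: ler_weXn2l kl; rewrite ler1n. Qed.

Lemma exp_unbounded (B : R) : exists M : nat, B < (6 / 5) ^+ M.
Proof.
have bern M : 1 + M%:R / 5 <= (6 / 5 : R) ^+ M.
  elim: M => [|M IH]; first by rewrite mul0r addr0 expr0.
  rewrite exprS -natr1; have h : 0 <= M%:R :> R by [].
  by move: IH; set x := _ ^+ M; set y := M%:R in h *; lra.
exists (Num.truncn (5 * `|B|)).+1; apply: lt_le_trans (bern _).
have := Num.Theory.truncnS_gt (5 * `|B|); have := ler_norm B.
by set y := _.+1%:R; lra.
Qed.

(** The product over the roots is the value of [X ^ M - 1] at [a / s]. *)
Lemma unity_roots (M : nat) : (0 < M)%N -> exists ws : seq C,
  [/\ size ws = M, forall w, w \in ws -> normc w = 1 &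
      forall a s, 0 < s -> \prod_(w <- ws) (a - toC s * w) = a ^+ M - toC s ^+ M].
Proof.
move=> M0; have := @closed_field_poly_normal C ('X^M - 1).
rewrite (monicP _) ?monicXnsubC // => -[ws]; rewrite scale1r => E.
exists ws; split.
- by have := size_prod_XsubC ws id; rewrite -E size_XnsubC // => -[].
- move=> w; rewrite -root_prod_XsubC -E /root !hornerE subr_eq0 => /eqP h.
  have /eqP := congr1 (@normc R) h; rewrite normcX normc1.
  by rewrite pexpr_eq1 ?normc_ge0 // => /eqP.
- move=> a s s0; have s1 : toC s != 0 by rewrite -normc_gt0 normcR gtr0_norm.
  have := congr1 (fun q : {poly C} => toC s ^+ M * q.[a / toC s]) E.
  rewrite !hornerE horner_prod mulrBr -exprMn mulrC divfK // mulr1 => ->.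
  have -> : toC s ^+ M = toC s ^+ size ws.
    by congr (_ ^+ _); have := size_prod_XsubC ws id; rewrite -E size_XnsubC // => -[].
  elim: ws {E} => [|w ws IH]; first by rewrite !big_nil mulr1.
  rewrite !big_cons -?IH ?IH exprS.
  have -> : a - toC s * w = toC s * (a / toC s - w) by rewrite mulrBr [_ * (a / _)]mulrC divfK.
  by rewrite hornerXsubC mulrACA.
Qed.


Lemma normc_prod_circle (bs : seq C) p s (ws : seq C) (M : nat) :
  (forall a, \prod_(w <- ws) (a - toC s * w) = a ^+ M - toC s ^+ M) ->
  \prod_(w <- ws) normc (\prod_(b <- bs) ('X - b%:P)).[p + toC s * w] =
  \prod_(b <- bs) normc ((b - p) ^+ M - toC s ^+ M).
Proof.
move=> hw; under eq_bigr => w _ do rewrite horner_prod normc_prod.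
rewrite exchange_big /=; apply: eq_bigr => b _.
rewrite -hw normc_prod; apply: eq_bigr => w _.
by rewrite !hornerE normcBC opprD addrA.
Qed.

Lemma prodr_const_size (T : Type) (x : R) (u : seq T) :
  \prod_(i <- u) x = x ^+ size u.
Proof. by elim: u => [|i u IH]; rewrite ?big_nil // big_cons IH exprS. Qed.

(** The comparison of the two circles in terms of numbers only: between them the mean
    modulus of the numerator grows by at most [2 ^ k], with [k < d] roots inside, and that
    of the denominator by at least [2 ^ d]; the values on both circles being between
    [3/4 gam] and [5/4 gam], powers of [6/5] would stay bounded. *)
Lemma circle_means (K1 K2 gam c V1 V2 U1 U2 : R) (M d k n : nat) :
  0 < K1 -> 0 < K2 -> 0 < gam -> 0 < c -> 0 < V1 -> 0 < V2 -> 0 <= U1 ->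
  (k < d)%N -> (0 < n)%N ->
  (3 / 4 * gam) ^+ M * V2 ^+ d <= c ^+ M * U2 ->
  c ^+ M * U1 <= (5 / 4 * gam) ^+ M * V1 ^+ d ->
  U2 <= K1 * (2 ^+ (M * k) * U1) ->
  2 ^+ (M * n) * V1 <= K2 * V2 ->
  (6 / 5) ^+ M <= K1 * K2 ^+ d.
Proof.
move=> K10 K20 gam0 c0 V10 V20 U10 kd n0 m1 m2 h1 h2.
have h2' : 2 ^+ M * V1 <= K2 * V2.
  by apply: le_trans h2; rewrite ler_pM2r //; apply: ler_exp2; rewrite leq_pmulr.
have h1' : 2 ^+ M * U2 <= K1 * (2 ^+ (M * d) * U1).
  have := ler_wpM2l (exprn_ge0 M (ler0n R 2)) h1 => /le_trans; apply.
  rewrite mulrCA ler_pM2l // mulrA ler_wpM2r // -exprD; apply: ler_exp2.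
  by rewrite -mulnS leq_mul2l kd orbT.
have h3 : (2 ^+ M * V1) ^+ d <= (K2 * V2) ^+ d.
  by rewrite lerXn2r // nnegrE mulr_ge0 ?exprn_ge0 // ltW.
rewrite !exprMn -exprM in h3.
have W0 : 0 < V2 ^+ d by rewrite exprn_gt0.
have gM : 0 < gam ^+ M by rewrite exprn_gt0.
have cM : 0 < c ^+ M by rewrite exprn_gt0.
have A1 : 2 ^+ M * (3 / 4 * gam) ^+ M * V2 ^+ d <=
          K1 * K2 ^+ d * ((5 / 4 * gam) ^+ M * V2 ^+ d).
  rewrite -mulrA; apply: le_trans (ler_wpM2l (exprn_ge0 M (ler0n R 2)) m1) _.
  rewrite mulrCA; apply: le_trans (ler_wpM2l (ltW cM) h1') _.
  have -> : c ^+ M * (K1 * (2 ^+ (M * d) * U1)) =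
    K1 * 2 ^+ (M * d) * (c ^+ M * U1) by ring.
  have k0 : 0 <= K1 * 2 ^+ (M * d) by rewrite mulr_ge0 ?exprn_ge0 // ltW.
  apply: le_trans (ler_wpM2l k0 m2) _.
  have -> : K1 * 2 ^+ (M * d) * ((5 / 4 * gam) ^+ M * V1 ^+ d) =
    K1 * (5 / 4 * gam) ^+ M * (2 ^+ (M * d) * V1 ^+ d) by ring.
  have k1 : 0 <= K1 * (5 / 4 * gam) ^+ M.
    by rewrite mulr_ge0 ?exprn_ge0 // ?(ltW K10) // mulr_ge0 ?(ltW gam0) //; lra.
  apply: le_trans (ler_wpM2l k1 h3) _.
  by rewrite le_eqVlt; apply/orP; left; apply/eqP; ring.
move: A1; rewrite mulrA ler_pM2r // -exprMn.
have -> : 2 * (3 / 4 * gam) = (6 / 5) * (5 / 4 * gam) by field.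
by rewrite exprMn ler_pM2r // exprn_gt0 // mulr_gt0 //; lra.
Qed.

(** A quotient [P / D ^ d] that is nearly constant on an annulus [r <= |z-p| <= 2 r]
    cannot have fewer zeros than poles in the disc: by Jensen its mean modulus
    would at least halve from the inner circle to the outer one. *)
Lemma few_roots_oscillation (rs ps : seq C) (c p : C) (d : nat) (r : R) (G : C -> C) (g0 : C) :
  0 < r -> p \in ps ->
  (forall a, a \in ps -> a = p \/ 2 * r < normc (a - p)) ->
  (count (fun b => (normc (b - p) <= 2 * r)%R) rs < d)%N ->
  g0 != 0 ->
  (forall z, r <= normc (z - p) <= 2 * r ->
    G z * (\prod_(a <- ps) ('X - a%:P)).[z] ^+ d =
    c * (\prod_(b <- rs) ('X - b%:P)).[z]) ->
  exists2 z, r <= normc (z - p) <= 2 * r & normc g0 / 4 < normc (G z - g0).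
Proof.
move=> r0 pps hps hcount g00 hG; apply: contrapT => hn.
have near z : r <= normc (z - p) <= 2 * r -> normc (G z - g0) <= normc g0 / 4.
  by move=> hz; rewrite leNgt; apply/negP => h; apply: hn; exists z.
set gam := normc g0 in near *.
have gam0 : 0 < gam by rewrite normc_gt0.
have lo z : r <= normc (z - p) <= 2 * r -> 3 / 4 * gam <= normc (G z).
  move=> /near h; have := normc_le_dist g0 (G z); rewrite normcBC -/gam; lra.
have hi z : r <= normc (z - p) <= 2 * r -> normc (G z) <= 5 / 4 * gam.
  move=> /near h; have := normc_le_dist (G z) g0; rewrite -/gam; lra.
pose D := \prod_(a <- ps) ('X - a%:P); pose P := \prod_(b <- rs) ('X - b%:P).
have Dnz z : r <= normc (z - p) <= 2 * r -> D.[z] != 0.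
  move=> /andP[h1 h2]; rewrite -/(root D z) root_prod_XsubC; apply/negP => zin.
  have [h|] := hps z zin; last by lra.
  by move: h1; rewrite h subrr normc0; lra.
have cPnz z : r <= normc (z - p) <= 2 * r -> c * P.[z] != 0.
  move=> hz; rewrite -hG // mulf_neq0 ?expf_neq0 ?Dnz //.
  by rewrite -normc_gt0; have := lo z hz; lra.
have c0 : 0 < normc c.
  have := cPnz (p + toC r); rewrite addrC addKr normcR gtr0_norm //.
  rewrite mulf_eq0 negb_or normc_gt0 => h; have /h/andP[] // : r <= r <= 2 * r by lra.
have hrs b : b \in rs -> normc (b - p) < r \/ 2 * r < normc (b - p).
  move=> ars; case: (ltP (normc (b - p)) r) => [|h1]; [by left|right].
  rewrite ltNge; apply/negP => h2; have := cPnz b; rewrite h1 h2 => /(_ isT).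
  by rewrite mulf_eq0 negb_or -/(root P b) root_prod_XsubC ars andbF.
have [K1 K10 hK1] := jensen_roots r0 hrs.
have [K2 K20 hK2] := jensen_poles r0 hps.
pose U s M := \prod_(b <- rs) normc ((b - p) ^+ M - toC s ^+ M).
pose V s M := \prod_(b <- ps) normc ((b - p) ^+ M - toC s ^+ M).
(* The pole at the centre is what makes the denominator grow. *)
have cp1 : leq 1 (count (pred1 p) ps).
  by rewrite -has_count; apply/hasP; exists p; rewrite //= eqxx.
have mean M s (ws : seq C) : size ws = M -> (forall w, w \in ws -> normc w = 1) ->
    (forall a, \prod_(w <- ws) (a - toC s * w) = a ^+ M - toC s ^+ M) ->
    r <= s <= 2 * r ->
    [/\ (3 / 4 * gam) ^+ M * V s M ^+ d <= normc c ^+ M * U s M,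
        normc c ^+ M * U s M <= (5 / 4 * gam) ^+ M * V s M ^+ d &
        0 < V s M].
  move=> szw hw1 hw hs; have s0 : 0 < s by lra.
  have onc w : w \in ws -> r <= normc (p + toC s * w - p) <= 2 * r.
    by move=> /hw1 h; rewrite addrC addKr normcM h normcR mulr1 gtr0_norm.
  have E : \prod_(w <- ws) normc (G (p + toC s * w)) * V s M ^+ d = normc c ^+ M * U s M.
    rewrite /V /U -!(normc_prod_circle _ _ hw) -prodrXl -[in RHS]szw -prodr_const_size.
    rewrite -!big_split /= big_seq [in RHS]big_seq; apply: eq_bigr => w win.
    by rewrite -normcX -!normcM hG // onc.
  have V0 : 0 < V s M.
    rewrite /V -(normc_prod_circle _ _ hw) big_seq prodr_gt0 // => w win.
    by rewrite normc_gt0; apply: Dnz; exact: onc.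
  split => //.
    rewrite -E ler_wpM2r ?exprn_ge0 ?(ltW V0) // -[in leLHS]szw -prodr_const_size.
    rewrite big_seq [leRHS]big_seq; apply: ler_prod => w win; rewrite lo ?onc // andbT.
    by rewrite mulr_ge0 //; lra.
  rewrite -E ler_wpM2r ?exprn_ge0 ?(ltW V0) // -[in leRHS]szw -prodr_const_size.
  rewrite big_seq [leRHS]big_seq; apply: ler_prod => w win.
  by rewrite hi ?onc // normc_ge0.
have main M : (0 < M)%N -> (6 / 5) ^+ M <= K1 * K2 ^+ d.
  move=> M0; have [ws [szw hw1 hw]] := unity_roots M0.
  have r2 : 0 < 2 * r by lra.
  have [| _ m2 V1] := mean M r ws szw hw1 (fun a => hw a r r0); first by lra.
  have [|m1 _ V2] := mean M (2 * r) ws szw hw1 (fun a => hw a _ r2); first by lra.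
  have U0 : 0 <= U r M by apply: prodr_ge0 => *; exact: normc_ge0.
  exact: (circle_means K10 K20 gam0 c0 V1 V2 U0 hcount cp1 m1 m2 (hK1 M M0) (hK2 M M0)).
have [[|M]] := exp_unbounded (K1 * K2 ^+ d).
  by have := main 1%N isT; rewrite expr0 expr1; lra.
by rewrite ltNge main.
Qed.
End Jensen.

(** * Rational functions with prescribed poles *)

Section Polynomials.
Variables (R : realType) (M : nat).
Local Notation C := R[i].
Implicit Types (p q : mpoly.mpoly M C) (z : 'rV[C]_M).

Lemma peval_const (c : C) : exists p, forall z, peval p z = c.
Proof. by eexists => z; exact: mpoly.mevalC. Qed.

Lemma peval_coord (i : 'I_M) : exists p, forall z, peval p z = z ord0 i.
Proof. by eexists => z; exact: mpoly.mevalXU. Qed.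

Lemma peval_add p q : exists s, forall z, peval s z = peval p z + peval q z.
Proof. by eexists => z; exact: mpoly.mevalD. Qed.

Lemma peval_mul p q : exists s, forall z, peval s z = peval p z * peval q z.
Proof. by eexists => z; exact: mpoly.mevalM. Qed.

(** Polynomials are handled as functions generated by constants and coordinates. *)
Lemma peval_ind (Q : ('rV[C]_M -> C) -> Prop) :
  (forall c, Q (fun=> c)) -> (forall i, Q (fun z => z ord0 i)) ->
  (forall f g, Q f -> Q g -> Q (fun z => f z + g z)) ->
  (forall f g, Q f -> Q g -> Q (fun z => f z * g z)) ->
  forall p, Q (peval p).
Proof.
move=> Qc Qx QD QM; apply: mpoly.mpolyind => [|c m p _ _ IH].
  by have := Qc 0; congr Q; apply/funext => z; rewrite /peval mpoly.meval0.
set q := (X in Q (peval X)).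
have -> : peval q = fun z => c * \prod_(i < M) (z ord0 i) ^+ (mpoly.fun_of_multinom m i) + peval p z.
  by apply/funext => z; rewrite /peval /q mpoly.mevalD mpoly.mevalZ mpoly.mevalX.
apply: (QD) => //; apply: (QM) => //.
elim: (index_enum _) => [|i s IHs].
  by have := Qc 1; congr Q; apply/funext => z; rewrite big_nil.
under eq_fun do rewrite big_cons.
apply: (QM) => //; elim: (mpoly.fun_of_multinom m i) => [|k IHk].
  by under eq_fun do rewrite expr0.
by under eq_fun do rewrite exprS; exact: (QM).
Qed.

End Polynomials.

(** Rational functions with poles in [ps] and value [c] at infinity.  The exponent [d]
    is only a common bound for the orders of the poles, which makes the class visibly
    stable under sums. *)
Definition proper_rat (R : realType) (ps : seq R[i]) (G : R[i] -> R[i]) (c : R[i]) :=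
  exists (d : nat) (P : {poly R[i]}), [/\ (size P <= (d * size ps).+1)%N,
    P`_(d * size ps) = c &
    forall z, z \notin ps -> G z * (\prod_(a <- ps) ('X - a%:P)).[z] ^+ d = P.[z]].

Section ProperRational.
Variable R : realType.
Local Notation C := R[i].
Variable ps : seq C.
Local Notation D := (\prod_(a <- ps) ('X - a%:P)).

Lemma coefM_top (p q : {poly C}) (m n : nat) :
  (size p <= m.+1)%N -> (size q <= n.+1)%N ->
  (size (p * q)%R <= (m + n).+1)%N /\ (p * q)`_(m + n) = p`_m * q`_n.
Proof.
move=> hp hq; split.
  by apply: leq_trans (size_polyMleq _ _) _; rewrite -ltnS -addnS -addSn; lia.
have hm : (m < (m + n).+1)%N by rewrite ltnS leq_addr.
rewrite coefM (bigD1 (Ordinal hm)) //= addKn big1 ?addr0 // => j.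
rewrite -val_eqE /= => jm; case: (ltngtP j m) => [jlt|jgt|jE].
- rewrite [q`_ _]nth_default ?mulr0 //; apply: leq_trans hq _; lia.
- rewrite nth_default ?mul0r //; exact: leq_trans hp _.
- by rewrite jE eqxx in jm.
Qed.

Lemma denomX k : size (D ^+ k) = (k * size ps).+1 /\ (D ^+ k)`_(k * size ps) = 1.
Proof.
have mD : D ^+ k \is monic by rewrite monic_exp ?monic_prod_XsubC.
have szD : size (D ^+ k) = (k * size ps).+1.
  have := size_exp D k; rewrite size_prod_XsubC /= mulnC => <-.
  by rewrite prednK // size_poly_gt0 monic_neq0.
by split => //; have := monicP mD; rewrite lead_coefE szD.
Qed.

Lemma proper_rat_const c : proper_rat ps (fun=> c) c.
Proof.
exists 0%N, c%:P; split=> [||z _]; rewrite ?mul0n ?coefC ?eqxx //.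
  by rewrite size_polyC; case: (c != 0).
by rewrite expr0 mulr1 hornerC.
Qed.

(** Both fractions are brought to the same denominator by padding. *)
Lemma proper_ratD G H c e : proper_rat ps G c -> proper_rat ps H e ->
  proper_rat ps (fun z => G z + H z) (c + e).
Proof.
move=> [d [P [szP cP hP]]] [k [Q [szQ cQ hQ]]].
have [szk ck] := denomX k; have [szd cd] := denomX d.
have [s1 t1] := coefM_top szP (eq_leq szk).
have [s2 t2] := coefM_top (eq_leq szd) szQ.
exists (d + k)%N, (P * D ^+ k + D ^+ d * Q); split.
- by rewrite mulnDl; apply: leq_trans (size_polyD _ _) _; rewrite geq_max s1 s2.
- by rewrite mulnDl coefD t1 t2 ck cd mulr1 mul1r cP cQ.
- move=> z hz; rewrite exprD hornerD !hornerM !horner_exp -hP // -hQ //; ring.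
Qed.

Lemma proper_ratM G H c e : proper_rat ps G c -> proper_rat ps H e ->
  proper_rat ps (fun z => G z * H z) (c * e).
Proof.
move=> [d [P [szP cP hP]]] [k [Q [szQ cQ hQ]]].
have [s1 t1] := coefM_top szP szQ.
exists (d + k)%N, (P * Q); split; rewrite ?mulnDl //.
  by rewrite t1 cP cQ.
by move=> z hz; rewrite exprD hornerM -hP // -hQ //; ring.
Qed.

Lemma proper_rat_pole a : a \in ps -> proper_rat ps (fun z => (z - a)^-1) 0.
Proof.
move=> aps; exists 1%N, (\prod_(b <- rem a ps) ('X - b%:P)).
have sz : size ps = (size (rem a ps)).+1.
  by rewrite size_rem // prednK //; case: ps aps.
split.
- by rewrite size_prod_XsubC mul1n sz.
- by rewrite mul1n nth_default // size_prod_XsubC sz.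
- move=> z hz; rewrite expr1 (perm_big _ (perm_to_rem aps)) big_cons hornerM.
  rewrite hornerXsubC mulrA mulVf ?mul1r // subr_eq0.
  by apply: contraNneq hz => ->.
Qed.

End ProperRational.

Lemma proper_rat_peval (R : realType) (M : nat) (ps : seq R[i])
    (F : R[i] -> 'rV[R[i]]_M) (w : 'rV[R[i]]_M) (p : mpoly.mpoly M R[i]) :
  (forall i, proper_rat ps (fun z => F z ord0 i) (w ord0 i)) ->
  proper_rat ps (fun z => peval p (F z)) (peval p w).
Proof.
move=> hF; move: p.
apply: (@peval_ind _ _ (fun f => proper_rat ps (fun z => f (F z)) (f w))) => [c|i|f g hf hg|f g hf hg].
- exact: proper_rat_const.
- exact: hF.
- exact: proper_ratD.
- exact: proper_ratM.
Qed.

(** A rational function vanishing at infinity has fewer finite zeros than poles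
    counted with the common order [d]; so one of the disjoint discs around the
    poles contains fewer than [d] zeros, and the function oscillates there. *)
Lemma proper_rat_oscillation (R : realType) (ps : seq R[i]) (G : R[i] -> R[i]) (r : R) :
  proper_rat ps G 0 -> 0 < r -> (0 < size ps)%N -> uniq ps ->
  (forall a b, a \in ps -> b \in ps -> a = b \/ 4 * r < normc (a - b)) ->
  exists2 p, p \in ps & forall g0, g0 != 0 ->
    exists2 z, r <= normc (z - p) <= 2 * r & normc g0 / 4 < normc (G z - g0).
Proof.
move=> [d [P [szP cP hP]]] r0 ps0 ups sep.
have sep2 p a : p \in ps -> a \in ps -> a = p \/ 2 * r < normc (a - p).
  by move=> pin ain; have [->|h] := sep a p ain pin; [left|right; lra].
have offp p z : p \in ps -> r <= normc (z - p) <= 2 * r -> z \notin ps.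
  move=> pin /andP[h1 h2]; apply/negP => zin; have [h|] := sep2 p z pin zin; last by lra.
  by move: h1; rewrite h subrr normc0; lra.
have [P0|P0] := eqVneq P 0.
  case: ps ps0 ups sep sep2 hP offp {szP cP} => // p ps _ _ _ _ hP offp.
  exists p; rewrite ?mem_head // => g0 g00.
  have rz : r <= normc (p + toC r - p) <= 2 * r.
    by rewrite addrC addKr normcR gtr0_norm //; lra.
  exists (p + toC r) => //; have := hP _ (offp _ _ (mem_head _ _) rz).
  rewrite P0 horner0 => /eqP; rewrite mulf_eq0 expf_eq0 => /orP[/eqP ->|].
    by rewrite sub0r normcN; move: g00; rewrite -normc_gt0; lra.
  rewrite -/(root _ _) root_prod_XsubC => /andP[_ /negPn].
  by rewrite (negbTE (offp _ _ (mem_head _ _) rz)).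
have [rs E] := closed_field_poly_normal P.
have lc0 : lead_coef P != 0 by rewrite lead_coef_eq0.
have szr : size P = (size rs).+1 by rewrite E size_scale // size_prod_XsubC.
have szr' : (size rs < d * size ps)%N.
  rewrite ltn_neqAle -ltnS -szr szP andbT; apply/negP => /eqP h.
  by move: lc0; rewrite lead_coefE szr /= h cP eqxx.
pose cnt p := count (fun b => (normc (b - p) <= 2 * r)%R) rs.
(* Pigeonhole: the discs are disjoint and there are fewer than [d * size ps] roots. *)
have [p pin hp] : exists2 p, p \in ps & (cnt p < d)%N.
  apply: contrapT => hn.
  have h p : p \in ps -> (d <= cnt p)%N.
    by move=> pin; rewrite leqNgt; apply/negP => hp; apply: hn; exists p.
  move: szr'; rewrite ltnNge => /negP; apply.
  have -> : (d * size ps = \sum_(p <- ps) d)%N.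
    by rewrite big_const_seq count_predT iter_addn_0 mulnC.
  apply: (@leq_trans (\sum_(p <- ps) cnt p)).
    by rewrite big_seq [leqRHS]big_seq; apply: leq_sum => p /h.
  rewrite /cnt; under eq_bigr do rewrite -sum1_count big_mkcond /=.
  rewrite exchange_big -sum1_size; apply: leq_sum => b _ /=.
  rewrite -big_mkcond sum1_count -size_filter.
  set f := [seq _ <- _ | _]; have : uniq f by exact: filter_uniq.
  have hin z : z \in f -> z \in ps /\ normc (b - z) <= 2 * r.
    by rewrite mem_filter => /andP[].
  case: f hin => [|x [|y s]] // hin /= /andP[].
  have [xin hx] := hin x (mem_head _ _).
  have [|yin hy] := hin y; first by rewrite !inE eqxx orbT.
  have [->|h2] := sep x y xin yin; first by rewrite mem_head.
  by have := normc_triangle b x y; rewrite normcBC in hx; lra.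
exists p => // g0 g00.
apply: (@few_roots_oscillation R rs ps (lead_coef P) p d r G g0) => //.
- by move=> a; exact: sep2.
- move=> z hz; rewrite hP ?(offp p) //.
  by rewrite {1}E hornerZ.
Qed.

(** * Potentials of the finite stages of a Cantor square *)

Notation digit := (bool * bool)%type.

Section CantorSquare.
Variable R : realType.
Local Notation C := R[i].
Implicit Types (i j k : digit) (u v : seq digit) (z w : C) (a b : nat -> digit).

Definition sgnb (b : bool) : R := if b then 1 else -1.
Definition corner i : C := Complex (sgnb i.1) (sgnb i.2).
(** A word is read from the largest scale to the smallest, so that dropping its first
    letter [i] is the similarity [z |-> 3 z - corner i]. *)
Definition center v : C := foldr (fun i x => (corner i + x) / 3%:R) 0 v.

Fixpoint words n : seq (seq digit) :=
  if n is m.+1 then [seq i :: v | i <- index_enum digit, v <- words m] else [:: [::]].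

Definition mean n (F : seq digit -> C) : C := 4%:R^-1 ^+ n * \sum_(v <- words n) F v.

Definition potential n z := mean n (fun v => (z - center v)^-1).

Lemma size_words n v : v \in words n -> size v = n.
Proof.
elim: n v => [|n IH] v; first by rewrite inE => /eqP ->.
by move=> /allpairsP[[i u] /= [_ /IH <- ->]].
Qed.

Lemma words_mem v : v \in words (size v).
Proof.
elim: v => [|i v IH]; first by rewrite inE.
by apply/allpairsP; exists (i, v); rewrite mem_index_enum.
Qed.

Lemma uniq_words n : uniq (words n).
Proof.
elim: n => [//|n IH]; rewrite allpairs_uniq ?index_enum_uniq //.
by move=> [i u] [j v] _ _ [-> ->].
Qed.

Lemma meanS n F :
  mean n.+1 F = 4%:R^-1 * \sum_(i : digit) mean n (fun v => F (i :: v)).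
Proof.
rewrite /mean exprS -mulrA -mulr_sumr; congr (_ * (_ * _)).
by rewrite big_allpairs_dep.
Qed.

Lemma card_digit : #|{: digit}| = 4%N.
Proof. by rewrite card_prod card_bool. Qed.

Lemma normc_sum_digit (F : digit -> C) (B : R) : (forall i, normc (F i) <= B) ->
  normc (4%:R^-1 * \sum_i F i) <= B.
Proof.
move=> hF; rewrite normcM normcV normc_nat ler_pdivrMl //.
apply: le_trans (normc_sum _ _ _) _;
apply: le_trans (ler_sum _ (fun i _ => hF i)) _.
by rewrite sumr_const card_digit mulr_natl.
Qed.

Lemma normc_sum_digit1 (F : digit -> C) j (B B' : R) :
  normc (F j) <= B -> (forall i, i != j -> normc (F i) <= B') ->
  normc (4%:R^-1 * \sum_i F i) <= (B + B' *+ 3) / 4.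
Proof.
move=> hj hF; rewrite normcM normcV normc_nat mulrC ler_wpM2r ?invr_ge0 //.
rewrite (bigD1 j) //=; apply: le_trans (normcD _ _) _; apply: lerD => //.
apply: le_trans (normc_sum _ _ _) _; apply: le_trans (ler_sum _ hF) _.
by rewrite (eq_bigl (fun i => i \in predC1 j)) // sumr_const cardC1 card_digit.
Qed.

Lemma mean_le n F (B : R) : (forall v, normc (F v) <= B) -> normc (mean n F) <= B.
Proof.
elim: n F => [|n IH] F hF; first by rewrite /mean /= big_seq1 mul1r.
by rewrite meanS; apply: normc_sum_digit => i; apply: IH.
Qed.

Lemma potential0 z : potential 0 z = z^-1.
Proof. by rewrite /potential /mean /= big_seq1 subr0 mul1r. Qed.

Lemma meanB n F G : mean n F - mean n G = mean n (fun v => F v - G v).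
Proof. by rewrite /mean -mulrBr -sumrB. Qed.

Lemma meanZ n c F : c * mean n F = mean n (fun v => c * F v).
Proof. by rewrite /mean mulrCA mulr_sumr. Qed.

Lemma mean_const n c : mean n (fun=> c) = c.
Proof.
elim: n => [|n IH]; first by rewrite /mean /= big_seq1 mul1r.
by rewrite meanS IH sumr_const card_digit -[c *+ _]mulr_natl mulrA mulVf ?mul1r // pnatr_eq0.
Qed.

Lemma mean_affine n c x F : c + x * mean n F = mean n (fun v => c + x * F v).
Proof.
by rewrite meanZ -[c in LHS](mean_const n) /mean -mulrDr -big_split.
Qed.

(** Self-similarity of the measure. *)
Lemma potentialS n z :
  potential n.+1 z = 3%:R * (4%:R^-1 * \sum_i potential n (3%:R * z - corner i)).
Proof.
rewrite /potential meanS [RHS]mulrCA [in RHS]mulr_sumr; congr (_ * _); apply: eq_bigr => i _.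
rewrite meanZ; congr mean; apply/funext => v /=.
have e3 : (3%:R : C) != 0 by rewrite pnatr_eq0.
have -> : z - (corner i + center v) / 3%:R =
          (3%:R * z - corner i - center v) / 3%:R by field.
by rewrite invf_div.
Qed.

Definition far (r : R) z := r <= `|complex.Re z| \/ r <= `|complex.Im z|.
Definition box z := `|complex.Re z| <= 1 / 2 /\ `|complex.Im z| <= 1 / 2.

Lemma sgnb_norm (b : bool) : `|sgnb b| = 1.
Proof. by case: b; rewrite /sgnb ?normrN normr1. Qed.

Lemma Re3 z : complex.Re (z / 3%:R) = complex.Re z / 3.
Proof. by rewrite -(rmorph_nat (real_complex R)) -fmorphV mulrC ReMr mulrC. Qed.
Lemma Im3 z : complex.Im (z / 3%:R) = complex.Im z / 3.
Proof. by rewrite -(rmorph_nat (real_complex R)) -fmorphV mulrC ImMr mulrC. Qed.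
Lemma Re3l z : complex.Re (3%:R * z) = 3 * complex.Re z.
Proof. by rewrite -(rmorph_nat (real_complex R)) ReMr. Qed.
Lemma Im3l z : complex.Im (3%:R * z) = 3 * complex.Im z.
Proof. by rewrite -(rmorph_nat (real_complex R)) ImMr. Qed.

Lemma child_bound (s x t : R) : `|s| = 1 -> `|x| <= (1 - t) / 2 ->
  `|(s + x) / 3| <= (1 - t / 3) / 2.
Proof.
move=> s1 hx; rewrite normrM [`|3^-1|]ger0_norm ?invr_ge0 //.
have := ler_normD s x; rewrite s1; lra.
Qed.

Lemma center_box v : `|complex.Re (center v)| <= (1 - 3^-1 ^+ size v) / 2 /\
  `|complex.Im (center v)| <= (1 - 3^-1 ^+ size v) / 2.
Proof.
elim: v => [|i v [IHr IHi]] /=; first by rewrite normr0 expr0; lra.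
rewrite Re3 Im3 ReD ImD exprS [3^-1 * _]mulrC /=.
by split; apply: child_bound; rewrite ?sgnb_norm.
Qed.

Lemma far_center r w v : far (r + 1 / 2) w -> r <= normc (w - center v).
Proof.
have [hr hi] := center_box v.
have h0 : 0 <= 3^-1 ^+ size v :> R by rewrite exprn_ge0 // invr_ge0.
move=> [h|h].
  apply: le_trans (Re_le_normc _); rewrite ReD ReN.
  have := lerB_dist (complex.Re w) (complex.Re (center v)); lra.
apply: le_trans (Im_le_normc _); rewrite ImD ImN.
have := lerB_dist (complex.Im w) (complex.Im (center v)); lra.
Qed.

Lemma normc_corner i : normc (corner i) <= 2.
Proof. by apply: le_trans (normc_le_ReIm _) _; rewrite /= !sgnb_norm. Qed.

Lemma far_child r w i : far (r + 1 / 2) w -> far (3 * r + 1 / 2) (3%:R * w - corner i).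
Proof.
move=> [h|h]; [left|right].
  rewrite ReD ReN Re3l; have := lerB_dist (3 * complex.Re w) (sgnb i.1).
  by rewrite normrM (ger0_norm (ler0n R 3)) sgnb_norm /=; lra.
rewrite ImD ImN Im3l; have := lerB_dist (3 * complex.Im w) (sgnb i.2).
by rewrite normrM (ger0_norm (ler0n R 3)) sgnb_norm /=; lra.
Qed.

Lemma invB_le (x y : C) (r s B : R) : 0 < r -> 0 < s -> r <= normc x -> s <= normc y ->
  normc (x - y) <= B -> normc (x^-1 - y^-1) <= B / (r * s).
Proof.
move=> r0 s0 hx hy hB.
have x0 : x != 0 by rewrite -normc_gt0; lra.
have y0 : y != 0 by rewrite -normc_gt0; lra.
have -> : x^-1 - y^-1 = (y - x) / (x * y) by field; rewrite x0 y0.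
rewrite normcM normcV normcM normcBC; apply: ler_pM => //; rewrite ?normc_ge0 //.
  by rewrite invr_ge0 mulr_ge0 ?normc_ge0.
rewrite lef_pV2 ?posrE ?mulr_gt0 //; try lra.
by apply: ler_pM => //; lra.
Qed.

Lemma potential_lip n w z : far (3 / 2) w -> far (3 / 2) z ->
  normc (potential n w - potential n z) <= normc (w - z).
Proof.
have -> : 3 / 2 = 1 + 1 / 2 :> R by lra.
move=> hw hz; rewrite meanB; apply: mean_le => v.
rewrite -[leRHS]divr1 -[X in _ / X](mulr1 1); apply: invB_le => //; try exact: far_center.
by rewrite opprB addrA subrK.
Qed.

(** Refining every cell moves its mass by the size of the cell; the weight
    [1 / r ^ 2] makes the estimate reproduce itself under [z |-> 3 z - corner i]. *)
Lemma potential_far_step n r w : 1 <= r -> far (r + 1 / 2) w ->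
  normc (potential n.+1 w - potential n w) <= 3^-1 ^+ n / (r * r).
Proof.
elim: n r w => [|n IH] r w r1 hw.
  have -> : potential 0 w = 4%:R^-1 * \sum_(i : digit) (3%:R / (3%:R * w)).
    rewrite sumr_const card_digit -[X in _ = _ * X]mulr_natl mulKf ?pnatr_eq0 //.
    by rewrite invfM mulVKf ?pnatr_eq0 // /potential /mean /= big_seq1 subr0 mul1r.
  rewrite potentialS mulrCA -mulrBr mulr_sumr -sumrB; apply: normc_sum_digit => i.
  rewrite /potential /mean /= big_seq1 subr0 mul1r -mulrBr normcM normc_nat expr0.
  have h1 := far_center [::] (far_child i hw).
  have h2 := far_center [::] hw; rewrite !subr0 in h1 h2.
  have h3 : 3 * r <= normc (3%:R * w) by rewrite normcM normc_nat; lra.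
  have r3 : 0 < 3 * r by lra.
  have h4 : normc (3%:R * w - corner i - 3%:R * w) <= 2.
    by rewrite addrC addKr normcN normc_corner.
  have := invB_le r3 r3 h1 h3 h4 => h; have {}h := ler_wpM2l (ler0n R 3) h.
  apply: le_trans h _; rewrite ler_pdivlMr ?mulr_gt0 //; try lra.
  have -> : 3 * (2 / (3 * r * (3 * r))) * (r * r) = 2 / 3 by field; lra.
  lra.
rewrite !potentialS -mulrBr -mulrBr -sumrB normcM normc_nat.
have h i : normc (potential n.+1 (3%:R * w - corner i) - potential n (3%:R * w - corner i))
    <= 3^-1 ^+ n / ((3 * r) * (3 * r)).
  by apply: IH; [lra | exact: far_child].
have := ler_wpM2l (ler0n R 3) (normc_sum_digit h) => /le_trans; apply.
rewrite exprS le_eqVlt; apply/orP; left; apply/eqP; field; lra.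
Qed.

Lemma potential_far_step1 n w : far (3 / 2) w ->
  normc (potential n.+1 w - potential n w) <= 3^-1 ^+ n.
Proof.
have -> : 3 / 2 = 1 + 1 / 2 :> R by lra.
by move=> /(potential_far_step n (lexx 1)); rewrite mulr1 divr1.
Qed.

(** The images of these annuli shrink to points; the ratio 2 of the radii is the one of
    Jensen's argument, and the outer discs of one level are disjoint. *)
Definition ann u z :=
  3^-1 ^+ size u / 4 <= normc (z - center u) <= 2 * (3^-1 ^+ size u / 4).

Lemma ann_child i u z : ann (i :: u) z -> ann u (3%:R * z - corner i).
Proof.
rewrite /ann /= exprS.
have e3 : (3%:R : C) != 0 by rewrite pnatr_eq0.
have -> : 3%:R * z - corner i - center u = 3%:R * (z - (corner i + center u) / 3%:R).
  by field.
by rewrite normcM normc_nat; set x := normc _; lra.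
Qed.

Lemma ann_box u z : ann u z -> box z.
Proof.
move=> /andP[_ h]; have [hr hi] := center_box u.
have k1 := Re_le_normc (z - center u); have k2 := Im_le_normc (z - center u).
rewrite ReD ReN in k1; rewrite ImD ImN in k2.
split.
  have := ler_normD (complex.Re z - complex.Re (center u)) (complex.Re (center u)).
  by rewrite subrK; lra.
have := ler_normD (complex.Im z - complex.Im (center u)) (complex.Im (center u)).
by rewrite subrK; lra.
Qed.

Lemma box_sibling z i j : j != i -> box (3%:R * z - corner i) ->
  far (3 / 2) (3%:R * z - corner j).
Proof.
move=> ji [hr hi].
have hs (s t : bool) (x : R) : s != t -> `|x - sgnb s| <= 1 / 2 -> 3 / 2 <= `|x - sgnb t|.
  case: s t => [] [] // _; rewrite /sgnb opprK ler_norml => /andP[h1 h2].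
    by rewrite ger0_norm; lra.
  by rewrite ler0_norm; lra.
rewrite ReD ReN /= in hr; rewrite ImD ImN /= in hi.
have [e1|e1] := eqVneq i.1 j.1; last by left; rewrite ReD ReN /=; exact: hs e1 hr.
right; rewrite ImD ImN /=; apply: hs hi.
by apply: contraNneq ji => e2; move: e1 e2; case: (i) (j) => ? ? [? ?] /= -> ->.
Qed.

Lemma center_rcons u i : center (rcons u i) = center u + 3%:R^-1 ^+ (size u).+1 * corner i.
Proof.
elim: u => [|j u IH] /=; first by rewrite add0r addr0 mulrC.
rewrite IH [in RHS]exprS; set x := _ ^+ _.
by field; rewrite ?pnatr_eq0.
Qed.

Lemma ann_dist u i z w : ann u z -> ann (rcons u i) w ->
  normc (w - z) <= 2 * 3^-1 ^+ size u.
Proof.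
move=> /andP[_ hz] /andP[_ hw]; rewrite size_rcons exprS center_rcons in hw.
have h := normc_corner i; rewrite normcBC in hz.
set c := corner i in hw h; set x := center u in hz hw.
have -> : w - z = (w - (x + 3%:R^-1 ^+ (size u).+1 * c)) + (x - z) +
   3%:R^-1 ^+ (size u).+1 * c by ring.
apply: le_trans (normcD _ _) _; have := normcD (w - (x + 3%:R^-1 ^+ (size u).+1 * c)) (x - z).
rewrite [normc (_ * c)]normcM normcX normcV normc_nat [(3^-1 : R) ^+ _.+1]exprS.
have t0 : 0 <= (3^-1 : R) ^+ size u by rewrite exprn_ge0 // invr_ge0.
have := ler_wpM2l t0 h.
move: hz hw t0; set t := (3^-1 : R) ^+ size u; set n1 := normc (_ + (x - z)).
set n2 := normc (x - z); set n3 := normc (w - _); set n4 := normc c.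
have -> : 3^-1 * t * n4 = 3^-1 * (t * n4) by rewrite mulrA.
by set y := t * n4; lra.
Qed.

(** The mass of a cell shrinks by 4 when its size shrinks by 3, so passing to the
    next level changes the potential near a pole by [O ((3/4) ^ n)]; the rate
    [4/5] leaves room to absorb the contribution of the siblings. *)
Lemma potential_near_step n u i z w : size u = n -> ann u z -> ann (rcons u i) w ->
  normc (potential n.+1 w - potential n z) <= 140 * (4 / 5) ^+ n.
Proof.
have inv4 y : ann [::] y -> normc (potential 0 y) <= 4.
  move=> /andP[h _]; rewrite potential0 normcV; move: h; rewrite /= subr0 expr0 => h.
  by rewrite -[4]invrK lef_pV2 ?posrE ?invr_gt0 //; lra.
elim: n u z w => [|n IH] [|j u] z w //.
  move=> _ hz /ann_child hw; apply: le_trans (normcD _ _) _.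
  rewrite normcN potentialS normcM normc_nat.
  have hfar j : j != i -> normc (potential 0 (3%:R * w - corner j)) <= 1.
    move=> ji; rewrite potential0 normcV invf_le1 ?normc_gt0.
      rewrite -[_ - corner j]subr0; apply: (far_center [::]).
      have -> : 1 + 1 / 2 = 3 / 2 :> R by lra.
      exact: box_sibling ji (ann_box hw).
    have : 1 <= normc (3%:R * w - corner j - center [::]).
      apply: far_center; have -> : 1 + 1 / 2 = 3 / 2 :> R by lra.
      exact: box_sibling ji (ann_box hw).
    by rewrite subr0 -normc_gt0; lra.
  have := normc_sum_digit1 (inv4 _ hw) hfar; have := inv4 _ hz.
  by rewrite expr0; lra.
move=> [szu] hz hw; rewrite !potentialS -!mulrBr -sumrB normcM normc_nat.
have hw' : ann (rcons u i) (3%:R * w - corner j) by exact: ann_child.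
have hz' := ann_child hz.
have hj := IH _ _ _ szu hz' hw'.
have hd := ann_dist hz' hw'; rewrite {}szu in hd.
have hk k : k != j -> normc (potential n.+1 (3%:R * w - corner k) -
    potential n (3%:R * z - corner k)) <= 3 * 3^-1 ^+ n.
  move=> kj; have fw := box_sibling kj (ann_box hw').
  have fz := box_sibling kj (ann_box hz').
  apply: le_trans (normc_triangle (potential n (3%:R * w - corner k)) _ _) _.
  have h1 := potential_far_step1 n fw; have h2 := potential_lip n fw fz.
  move: hd h1 h2; have -> : 3%:R * w - corner k - (3%:R * z - corner k) =
    3%:R * w - corner j - (3%:R * z - corner j) by ring.
  by set x := normc _; set y := normc _; set t := normc _; lra.
have ht : (3^-1 : R) ^+ n <= (4 / 5) ^+ n by rewrite lerXn2r ?nnegrE; lra.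
have := @normc_sum_digit1 (fun k => potential n.+1 (3%:R * w - corner k) -
  potential n (3%:R * z - corner k)) j _ _ hj hk; rewrite exprS.
have q0 : 0 <= (4 / 5 : R) ^+ n by rewrite exprn_ge0.
by move: ht q0; set t := 3^-1 ^+ n; set q := (4 / 5) ^+ n; lra.
Qed.

End CantorSquare.

(** * Limits: points, Cauchy transform and boundary values of the Cantor square *)

Section GeometricLimits.
Variable R : realType.

Lemma expr_lt_eps (q e : R) : 0 <= q < 1 -> 0 < e -> exists n : nat, q ^+ n < e.
Proof.
move=> /andP[q0 q1] e0.
have /cvgrPdist_lt /(_ e e0) [n _ hn] : GRing.exp q @ \oo --> (0 : R).
  by apply: cvg_expr; rewrite ger0_norm.
exists n; have := hn n (leqnn n).
by rewrite sub0r normrN ger0_norm // exprn_ge0.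
Qed.

Lemma le_geometric (x y A q : R) : 0 <= q < 1 ->
  (forall n : nat, x <= y + A * q ^+ n) -> x <= y.
Proof.
move=> hq h; rewrite leNgt; apply/negP => yx.
have B0 : 0 < `|A| + 1 by rewrite ltr_pwDr.
have [|n hn] := expr_lt_eps hq (_ : 0 < (x - y) / (`|A| + 1)).
  by rewrite divr_gt0 // subr_gt0.
have := h n; rewrite ltr_pdivlMr // in hn.
have q0 : 0 <= q ^+ n by rewrite exprn_ge0 //; case/andP: hq.
have := ler_wpM2r q0 (ler_norm A); move: hn; rewrite mulrDr mulr1 [_ * `|A|]mulrC.
by set t := _ * _; set s := _ * _; lra.
Qed.

Lemma geometric_limit_unique (u : nat -> R[i]) l l' (A B q : R) : 0 <= q < 1 ->
  (forall n, normc (u n - l) <= A * q ^+ n) ->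
  (forall n, normc (u n - l') <= B * q ^+ n) -> l = l'.
Proof.
move=> hq h1 h2; apply/eqP; rewrite -subr_eq0 -normc_eq0 eq_le normc_ge0 andbT.
apply: (le_geometric (A := A + B) hq) => n; rewrite add0r mulrDl.
apply: le_trans (normc_triangle (u n) _ _) _.
by apply: lerD => //; rewrite normcBC.
Qed.

Lemma geometric_limit_le (u : nat -> R[i]) l (A B q : R) : 0 <= q < 1 ->
  (forall n, normc (u n - l) <= A * q ^+ n) ->
  (forall n, normc (u n) <= B) -> normc l <= B.
Proof.
move=> hq h1 h2; apply: (le_geometric (A := A) hq) => n.
by apply: le_trans (normc_le_dist l (u n)) _; rewrite normcBC; apply: lerD.
Qed.

End GeometricLimits.

Section CantorLimits.
Variable R : realType.
Local Notation C := R[i].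
Implicit Types (i j k : digit) (u v : seq digit) (z w : C) (a b : nat -> digit).
Local Notation center := (@center R).
Local Notation corner := (@corner R).
Local Notation potential := (@potential R).

Lemma third_rate : 0 <= (3^-1 : R) < 1.
Proof. by apply/andP; split; lra. Qed.

Lemma cantor_point_ex a : exists l, forall n, normc (center (mkseq a n) - l) <= 2 * 3^-1 ^+ n.
Proof.
have [|l hl] := @geometric_cauchyC R (fun n => center (mkseq a n)) 3^-1 (2 / 3) third_rate.
  move=> n; rewrite mkseqS center_rcons addrC addKr size_mkseq normcM normcX normcV normc_nat.
  have h0 : 0 <= (3^-1 : R) ^+ n by rewrite exprn_ge0 // invr_ge0.
  have h := ler_wpM2l h0 (normc_corner R (a n)).
  rewrite exprS -mulrA; move: h; set x := _ * _; set t := _ ^+ _; lra.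
exists l => n; apply: le_trans (hl n) _; rewrite ler_wpM2r ?exprn_ge0 ?invr_ge0 //.
have -> : 1 - 3^-1 = 2 / 3 :> R by lra.
by rewrite ?invf_div; lra.
Qed.

Definition cantor_point a : C := sval (cid (cantor_point_ex a)).

Lemma cantor_point_prefix a n : normc (center (mkseq a n) - cantor_point a) <= 2 * 3^-1 ^+ n.
Proof. exact: (svalP (cid (cantor_point_ex a))). Qed.

Definition shift (m : nat) a := fun n => a (m + n)%N.

Lemma mkseq_cons a n : mkseq a n.+1 = a 0%N :: mkseq (shift 1 a) n.
Proof. by rewrite /mkseq /= (iotaDl 1 0) -map_comp. Qed.

Lemma cantor_point_rec a : cantor_point a = (corner (a 0%N) + cantor_point (shift 1 a)) / 3%:R.
Proof.
apply: (@geometric_limit_unique R (fun n => center (mkseq a n.+1)) _ _ (2 / 3) (2 / 3) 3^-1).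
- exact: third_rate.
- by move=> n; have := cantor_point_prefix a n.+1; rewrite exprS; lra.
- move=> n; rewrite mkseq_cons /=; have := cantor_point_prefix (shift 1 a) n.
  have -> : forall x y z : C, (x + y) / 3%:R - (x + z) / 3%:R = (y - z) / 3%:R.
    by move=> x y z; rewrite -mulrBl opprD addrACA subrr add0r.
  by rewrite normcM normcV normc_nat; set x := normc _; lra.
Qed.

Lemma cantor_point_box a : box (cantor_point a).
Proof.
have [hr hi] : (forall n, `|complex.Re (center (mkseq a n))| <= 1 / 2) /\
               (forall n, `|complex.Im (center (mkseq a n))| <= 1 / 2).
  have t n : 0 <= (3^-1 : R) ^+ n by rewrite exprn_ge0 // invr_ge0.
  split=> n; have [h1 h2] := center_box R (mkseq a n);
  move: h1 h2; rewrite size_mkseq; have := t n; set x := _ ^+ n; lra.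
split; apply: (le_geometric (A := 2) third_rate) => n.
  have := cantor_point_prefix a n; have := Re_le_normc (center (mkseq a n) - cantor_point a).
  rewrite ReD ReN distrC; have := lerB_dist (complex.Re (cantor_point a)) (complex.Re (center (mkseq a n))).
  by have := hr n; set x := normc _; set t := _ ^+ n; lra.
have := cantor_point_prefix a n; have := Im_le_normc (center (mkseq a n) - cantor_point a).
rewrite ImD ImN distrC; have := lerB_dist (complex.Im (cantor_point a)) (complex.Im (center (mkseq a n))).
by have := hi n; set x := normc _; set t := _ ^+ n; lra.
Qed.

Lemma cantor_point_le1 a : normc (cantor_point a) <= 1.
Proof. by have [h1 h2] := cantor_point_box a; have := normc_le_ReIm (cantor_point a); lra. Qed.

Lemma sgnb_child (s : bool) (x : R) : `|x| <= 1 / 2 -> 1 / 6 <= sgnb R s * ((sgnb R s + x) / 3).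
Proof. by rewrite ler_norml => /andP[h1 h2]; case: s; rewrite /sgnb; lra. Qed.

Lemma cantor_point_sgn_Re a : 1 / 6 <= sgnb R (a 0%N).1 * complex.Re (cantor_point a).
Proof. by rewrite cantor_point_rec Re3 ReD /=; apply: sgnb_child; have [] := cantor_point_box (shift 1 a). Qed.

Lemma cantor_point_sgn_Im a : 1 / 6 <= sgnb R (a 0%N).2 * complex.Im (cantor_point a).
Proof. by rewrite cantor_point_rec Im3 ImD /=; apply: sgnb_child; have [] := cantor_point_box (shift 1 a). Qed.

Lemma cantor_point_split n a :
  cantor_point a = center (mkseq a n) + 3%:R^-1 ^+ n * cantor_point (shift n a).
Proof.
elim: n a => [|n IH] a; first by rewrite add0r expr0 mul1r.
rewrite cantor_point_rec mkseq_cons /= (IH (shift 1 a)) exprS.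
have -> : shift n (shift 1 a) = shift n.+1 a by apply/funext => k; rewrite /shift addnA.
by set x := _ ^+ n; field; rewrite ?pnatr_eq0.
Qed.

Lemma sgnb_inj (s t : bool) (x : R) : 1 / 6 <= sgnb R s * x -> 1 / 6 <= sgnb R t * x -> s = t.
Proof. by case: s t => [] []; rewrite /sgnb // => h1 h2; exfalso; lra. Qed.

(** The first digit is the pair of signs of the real and imaginary parts, which stay
    away from [0]; the other digits follow by self-similarity. *)
Lemma cantor_point_inj a b : cantor_point a = cantor_point b -> a = b.
Proof.
have head a' b' : cantor_point a' = cantor_point b' -> a' 0%N = b' 0%N /\ cantor_point (shift 1 a') = cantor_point (shift 1 b').
  move=> e; have hr := cantor_point_sgn_Re a'; have hi := cantor_point_sgn_Im a'.
  have e0 : a' 0%N = b' 0%N.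
    rewrite e in hr hi; have := sgnb_inj hr (cantor_point_sgn_Re b'); have := sgnb_inj hi (cantor_point_sgn_Im b').
    by case: (a' _) (b' _) => [? ?] [? ?] /= -> ->.
  split => //; move: e; rewrite cantor_point_rec (cantor_point_rec b') e0.
  have n3 : (3%:R : C)^-1 != 0 by rewrite invr_eq0 pnatr_eq0.
  by move=> /(mulIf n3) /addrI.
have all_shift n : cantor_point a = cantor_point b -> cantor_point (shift n a) = cantor_point (shift n b).
  elim: n => [//|n IH] /IH /head[_].
  have e c : shift 1 (shift n c) = shift n.+1 c.
    by apply/funext => k; rewrite /shift addnA addn1.
  by rewrite !e.
move=> e; apply/funext => n; have [h _] := head _ _ (all_shift n e).
by rewrite /shift addn0 in h.
Qed.

Lemma potential_lim_ex w : far (3 / 2) w ->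
  exists l, forall n, normc (potential n w - l) <= 3 * 3^-1 ^+ n.
Proof.
move=> hw; have [|l hl] := @geometric_cauchyC R (fun n => potential n w) 3^-1 1 third_rate.
  by move=> n; rewrite mul1r; exact: potential_far_step1.
exists l => n; apply: le_trans (hl n) _; rewrite ler_wpM2r ?exprn_ge0 ?invr_ge0 //.
have -> : 1 - 3^-1 = 2 / 3 :> R by lra.
by rewrite ?invf_div; lra.
Qed.

(** The Cauchy transform of the uniform measure of the Cantor square, off the square;
    the value is arbitrary where the limit is not known to exist. *)
Definition cauchy_transform w : C :=
  xget 0 [set l | forall n, normc (potential n w - l) <= 3 * 3^-1 ^+ n].

Lemma cauchy_lim w n : far (3 / 2) w -> normc (potential n w - cauchy_transform w) <= 3 * 3^-1 ^+ n.
Proof.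
move=> /potential_lim_ex h.
exact: (@xgetPex _ 0 [set l | forall n, normc (potential n w - l) <= 3 * 3^-1 ^+ n] h n).
Qed.

Lemma far_normc (r : R) w : 2 * r <= normc w -> far r w.
Proof.
move=> h; have := normc_le_ReIm w; have [h1|h1] := leP r `|complex.Re w|; first by left.
by right; lra.
Qed.

Lemma center_le1 v : normc (center v) <= 1.
Proof.
have [h1 h2] := center_box R v; apply: le_trans (normc_le_ReIm _) _.
have : 0 <= (3^-1 : R) ^+ size v by rewrite exprn_ge0 // invr_ge0.
by lra.
Qed.

Lemma dist_translate (T x : C) : normc T = 100 -> normc x <= 3 -> 97 <= normc (x - T).
Proof. by move=> hT hx; have := normc_le_dist T x; rewrite normcBC; lra. Qed.

Lemma far_translate (T x : C) : normc T = 100 -> normc x <= 2 -> far (3 / 2) (x - T).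
Proof.
move=> hT hx; apply: far_normc; have h3 : normc x <= 3 by lra.
by have := dist_translate hT h3; lra.
Qed.

(** At distance 100 the potential is nearly [-1 / T - u / T ^ 2], whose first order
    part is cancelled by [u |-> u + T ^ 2 * potential n (u - T)]. *)
Lemma potential_contract (T u v : C) n : normc T = 100 -> normc u <= 2 -> normc v <= 2 ->
  normc (u - v + T ^+ 2 * (potential n (u - T) - potential n (v - T))) <= normc (u - v) / 2.
Proof.
move=> hT hu hv; rewrite meanB mean_affine; apply: mean_le => c.
set x := u - center c; set y := v - center c.
have hc := center_le1 c.
have hx : normc x <= 3 by have := normcD u (- center c); rewrite normcN -/x; lra.
have hy : normc y <= 3 by have := normcD v (- center c); rewrite normcN -/y; lra.
have dx := dist_translate hT hx; have dy := dist_translate hT hy.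
have x0 : x - T != 0 by rewrite -normc_gt0; lra.
have y0 : y - T != 0 by rewrite -normc_gt0; lra.
have e1 : u - T - center c = x - T by rewrite /x addrAC.
have e2 : v - T - center c = y - T by rewrite /y addrAC.
have e3 : u - v = x - y by rewrite /x /y opprB addrA subrK.
have -> : u - v + T ^+ 2 * ((u - T - center c)^-1 - (v - T - center c)^-1) =
   (u - v) * ((x * y - T * (x + y)) / ((x - T) * (y - T))).
  by rewrite e1 e2 e3; field; rewrite x0 y0.
rewrite normcM ler_wpM2l ?normc_ge0 // normcM normcV normcM.
have d0 : 97 * 97 <= normc (x - T) * normc (y - T) by apply: ler_pM; lra.
rewrite ler_pdivrMr; last by apply: lt_le_trans d0; lra.
have h1 : normc (x * y) <= 3 * 3 by rewrite normcM; apply: ler_pM; rewrite ?normc_ge0.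
have h2 : normc (T * (x + y)) <= 100 * 6.
  rewrite normcM hT; have := normcD x y; lra.
have := normcD (x * y) (- (T * (x + y))); rewrite normcN; move: d0 h1 h2.
by set p := _ * normc (y - T); lra.
Qed.

Lemma cauchy_contract (T u v : C) : normc T = 100 -> normc u <= 2 -> normc v <= 2 ->
  normc (u - v + T ^+ 2 * (cauchy_transform (u - T) - cauchy_transform (v - T))) <= normc (u - v) / 2.
Proof.
move=> hT hu hv; apply: (le_geometric (A := 100 * 100 * 6) third_rate) => n.
have hn := potential_contract n hT hu hv.
have h1 := cauchy_lim n (far_translate hT hu); have h2 := cauchy_lim n (far_translate hT hv).
apply: le_trans (normc_le_dist _ (u - v + T ^+ 2 * (potential n (u - T) - potential n (v - T)))) _.
apply: lerD => //.
set p := _ - potential n (v - T); set q := _ - cauchy_transform (v - T).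
have -> : u - v + T ^+ 2 * q - (u - v + T ^+ 2 * p) = T ^+ 2 * (q - p) by ring.
rewrite normcM normcX hT.
have : normc (q - p) <= 6 * 3^-1 ^+ n.
  have -> : q - p = (potential n (v - T) - cauchy_transform (v - T)) -
    (potential n (u - T) - cauchy_transform (u - T)) by rewrite /p /q; ring.
  by apply: le_trans (normcD _ _) _; rewrite normcN; lra.
set t := normc _; set s := _ ^+ n; lra.
Qed.

Lemma cauchy_inj (T u v : C) : normc T = 100 -> normc u <= 2 -> normc v <= 2 ->
  cauchy_transform (u - T) = cauchy_transform (v - T) -> u = v.
Proof.
move=> hT hu hv e; have := cauchy_contract hT hu hv.
rewrite e subrr mulr0 addr0 => h; apply/eqP.
by rewrite -subr_eq0 -normc_eq0; apply/eqP; have := normc_ge0 (u - v); lra.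
Qed.

Lemma cauchy_lip (T u v : C) : normc T = 100 -> normc u <= 2 -> normc v <= 2 ->
  normc (cauchy_transform (u - T) - cauchy_transform (v - T)) <= normc (u - v).
Proof.
move=> hT hu hv; apply: (le_geometric (A := 6) third_rate) => n.
have fu := far_translate hT hu; have fv := far_translate hT hv.
have h0 := potential_lip n fu fv.
have h1 := cauchy_lim n fu; have h2 := cauchy_lim n fv.
have e : u - T - (v - T) = u - v by ring.
rewrite e in h0.
have -> : cauchy_transform (u - T) - cauchy_transform (v - T) = (potential n (u - T) - potential n (v - T)) -
    ((potential n (u - T) - cauchy_transform (u - T)) - (potential n (v - T) - cauchy_transform (v - T))) by ring.
apply: le_trans (normcD _ _) _; rewrite normcN.
apply: le_trans (lerD h0 (normcD _ _)) _; rewrite normcN.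
by move: h1 h2; set s := _ ^+ n; lra.
Qed.

Lemma cauchy_neq0 (T u : C) : normc T = 100 -> normc u <= 2 -> cauchy_transform (u - T) != 0.
Proof.
move=> hT hu; apply/eqP => e.
have fu := far_translate hT hu.
suff : normc (0 * T + 1) <= 1 / 2.
  by rewrite mul0r add0r normc1; lra.
rewrite -{1}e; apply: (le_geometric (A := 3 * 100) third_rate) => n.
have h1 := cauchy_lim n fu.
have h2 : normc (potential n (u - T) * T + 1) <= 1 / 2.
  rewrite mulrC addrC mean_affine; apply: mean_le => c.
  have hc := center_le1 c; set x := u - center c.
  have hx : normc x <= 3 by have := normcD u (- center c); rewrite normcN -/x; lra.
  have dx := dist_translate hT hx.
  have x0 : x - T != 0 by rewrite -normc_gt0; lra.
  have -> : u - T - center c = x - T by rewrite /x addrAC.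
  have -> : 1 + T * (x - T)^-1 = x / (x - T) by field.
  rewrite normcM normcV ler_pdivrMr; lra.
have -> : cauchy_transform (u - T) * T + 1 = (potential n (u - T) * T + 1) -
   (potential n (u - T) - cauchy_transform (u - T)) * T by ring.
apply: le_trans (normcD _ _) _; rewrite normcN [normc (_ * T)]normcM hT.
by move: h1 h2; set s := _ ^+ n; lra.
Qed.

(** The boundary values on the Cantor square are reached along one point of each
    annulus around the poles [center (mkseq a n)]. *)
Definition annpt a n : C := center (mkseq a n) + toC (3^-1 ^+ n / 4).

Lemma annpt_ann a n : ann (mkseq a n) (annpt a n).
Proof.
rewrite /ann size_mkseq addrC addKr normcR.
have h : 0 <= (3^-1 : R) ^+ n / 4 by rewrite divr_ge0 ?exprn_ge0 // invr_ge0.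
by rewrite ger0_norm //; lra.
Qed.

Lemma boundary_ex a : exists l, forall n,
  normc (potential n (annpt a n) - l) <= 10 * 140 * (4 / 5) ^+ n.
Proof.
have q : 0 <= (4 / 5 : R) < 1 by apply/andP; split; lra.
have [|l hl] := @geometric_cauchyC R (fun n => potential n (annpt a n)) (4 / 5) 140 q.
  move=> n; apply: (@potential_near_step R n _ (a n)) (size_mkseq a n) (annpt_ann a n) _.
  by rewrite -mkseqS; exact: annpt_ann.
exists l => n; apply: le_trans (hl n) _; rewrite ler_wpM2r ?exprn_ge0 //.
have -> : 1 - 4 / 5 = 1 / 5 :> R by lra.
by rewrite ?invf_div; lra.
Qed.

Definition boundary_value a : C := sval (cid (boundary_ex a)).

Lemma boundary_near a n z : ann (mkseq a n) z ->
  normc (potential n z - boundary_value a) <= 20 * 100 * (4 / 5) ^+ n.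
Proof.
move=> hz; have h1 := svalP (cid (boundary_ex a)) n.+1; rewrite -/(boundary_value a) in h1.
have h2 : normc (potential n.+1 (annpt a n.+1) - potential n z) <= 140 * (4 / 5) ^+ n.
  apply: (@potential_near_step R n _ (a n)) (size_mkseq a n) hz _.
  by rewrite -mkseqS; exact: annpt_ann.
apply: le_trans (normc_triangle (potential n.+1 (annpt a n.+1)) _ _) _.
rewrite [normc (potential n z - _)]normcBC; rewrite exprS in h1; have : 0 <= (4 / 5 : R) ^+ n by rewrite exprn_ge0.
by move: h1 h2; set s := (4 / 5) ^+ n; lra.
Qed.

Lemma ann_cantor_point a n z : ann (mkseq a n) z -> normc (z - cantor_point a) <= 3 * (4 / 5) ^+ n.
Proof.
move=> /andP[_]; rewrite size_mkseq => hz; have h := cantor_point_prefix a n.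
apply: le_trans (normc_triangle (center (mkseq a n)) _ _) _.
have : (3^-1 : R) ^+ n <= (4 / 5) ^+ n by rewrite lerXn2r ?nnegrE; lra.
have : 0 <= (3^-1 : R) ^+ n by rewrite exprn_ge0 // invr_ge0.
by move: hz h; set s := 3^-1 ^+ n; set t := (4 / 5) ^+ n; lra.
Qed.

End CantorLimits.

(** * Uniformly closed algebras of functions *)

Section UniformAlgebras.
Variables (R : realType) (T : topologicalType).
Local Notation C := R[i].
Implicit Types (K : set T) (A : set (T -> C)) (f g : T -> C).

(** Continuity on a subset is used in this form for functions that are total; it is
    related to the subspace topology by [within_continuousP]. *)
Definition cont_at_points K f := forall x, K x -> forall e : R, 0 < e ->
  \forall y \near x, K y -> normc (f y - f x) < e.

Record subalgebra K A : Prop := Subalgebra {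
  sub_const : forall c, A (fun=> c);
  sub_add : forall f g, A f -> A g -> A (fun x => f x + g x);
  sub_mul : forall f g, A f -> A g -> A (fun x => f x * g x);
  sub_bdd : forall f, A f -> exists B : R, forall x, K x -> normc (f x) <= B;
  sub_cont : forall f, A f -> cont_at_points K f }.

Definition uniform_closure K A : set (T -> C) :=
  [set f | forall e : R, 0 < e ->
    exists2 g, A g & forall x, K x -> normc (f x - g x) <= e].

Record uniform_algebra K A : Prop := UniformAlgebra {
  ua_sub : subalgebra K A;
  ua_closed : uniform_closure K A `<=` A }.

Lemma uniform_closure_sub K A : A `<=` uniform_closure K A.
Proof. by move=> f Af e e0; exists f => // x _; rewrite subrr normc0 ltW. Qed.

Lemma uniform_closure_bdd K A f : subalgebra K A -> uniform_closure K A f ->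
  exists2 B : R, 0 <= B & forall x, K x -> normc (f x) <= B.
Proof.
move=> sA /(_ 1 ltr01)[g Ag hg]; have [B hB] := sub_bdd sA Ag.
exists (`|B| + 1) => [|x Kx]; first by rewrite addr_ge0.
apply: le_trans (normc_le_dist _ (g x)) _; apply: lerD; last exact: hg.
exact: le_trans (hB x Kx) (ler_norm _).
Qed.

Lemma uniform_closure_algebra K A : subalgebra K A ->
  uniform_algebra K (uniform_closure K A).
Proof.
move=> sA; split; first split.
- by move=> c; apply: uniform_closure_sub; exact: sub_const sA c.
- move=> f g hf hg e e0; have e2 : 0 < e / 2 by rewrite divr_gt0.
  have [f' Af' hf'] := hf _ e2; have [g' Ag' hg'] := hg _ e2.
  exists (fun x => f' x + g' x); first exact: sub_add sA _ _ Af' Ag'.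
  move=> x Kx; rewrite opprD addrACA; apply: le_trans (normcD _ _) _.
  by rewrite [e in leRHS]splitr; apply: lerD; [exact: hf' | exact: hg'].
- move=> f g hf hg e e0.
  have [Bf Bf0 hBf] := uniform_closure_bdd sA hf.
  have [g0 Ag0 hg0] : exists2 g', A g' & forall x, K x -> normc (g x - g' x) <= e / 2 / (Bf + 1).
    by apply: hg; rewrite !divr_gt0 // ltr_wpDl.
  have [Bg hBg] := sub_bdd sA Ag0.
  have Bg1 : 0 < `|Bg| + 1 by rewrite ltr_pwDr.
  have [f0 Af0 hf0] : exists2 f', A f' & forall x, K x -> normc (f x - f' x) <= e / 2 / (`|Bg| + 1).
    by apply: hf; rewrite !divr_gt0.
  exists (fun x => f0 x * g0 x); first exact: sub_mul sA _ _ Af0 Ag0.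
  move=> x Kx; have -> : f x * g x - f0 x * g0 x = f x * (g x - g0 x) + (f x - f0 x) * g0 x.
    by ring.
  apply: le_trans (normcD _ _) _; rewrite !normcM [e in leRHS]splitr; apply: lerD.
    have Bf1 : 0 < Bf + 1 by rewrite ltr_wpDl.
    have h : normc (f x) * normc (g x - g0 x) <= (Bf + 1) * (e / 2 / (Bf + 1)).
      apply: ler_pM; rewrite ?normc_ge0 ?hg0 //.
      by apply: le_trans (hBf x Kx) _; rewrite lerDl.
    by rewrite [leRHS]mulrC divfK ?gt_eqF // in h.
  have h : normc (f x - f0 x) * normc (g0 x) <= e / 2 / (`|Bg| + 1) * (`|Bg| + 1).
    apply: ler_pM; rewrite ?normc_ge0 ?hf0 //.
    by apply: le_trans (hBg x Kx) _; apply: le_trans (ler_norm _) _; rewrite lerDl.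
  by rewrite divfK ?gt_eqF // in h.
- by move=> f /(uniform_closure_bdd sA)[B _ hB]; exists B.
- move=> f hf x Kx e e0; have e3 : 0 < e / 3 by rewrite divr_gt0.
  have [g Ag hg] := hf _ e3; have := sub_cont sA Ag Kx e3.
  apply: filterS => y hy Ky; have h1 := hg x Kx; have h2 := hg y Ky; have h3 := hy Ky.
  have -> : f y - f x = (f y - g y) + (g y - g x) - (f x - g x) by ring.
  apply: le_lt_trans (normcD _ _) _; rewrite normcN.
  by have := normcD (f y - g y) (g y - g x); lra.
- move=> f hf e e0; have e2 : 0 < e / 2 by rewrite divr_gt0.
  have [g hg hfg] := hf _ e2; have [h Ah hgh] := hg _ e2; exists h => // x Kx.
  apply: le_trans (normc_triangle (g x) _ _) _.
  by rewrite [e in leRHS]splitr; apply: lerD; [exact: hfg | exact: hgh].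
Qed.

Section Fixed.
Variables (K : set T) (A : set (T -> C)).
Hypothesis ua : uniform_algebra K A.
Let sA := ua_sub ua.

Lemma ua_eq f g : A f -> (forall x, K x -> f x = g x) -> A g.
Proof.
move=> Af h; apply: (ua_closed ua) => e e0; exists f => // x Kx.
by rewrite h // subrr normc0 ltW.
Qed.

Lemma ua_scale c f : A f -> A (fun x => c * f x).
Proof. by apply: (sub_mul sA); exact: sub_const sA c. Qed.

Lemma ua_opp f : A f -> A (fun x => - f x).
Proof. by move=> /(ua_scale (-1)) h; apply: (ua_eq h) => x _; rewrite mulN1r. Qed.

Lemma ua_sub_fun f g : A f -> A g -> A (fun x => f x - g x).
Proof. by move=> Af /ua_opp; exact: (sub_add sA Af). Qed.

Lemma ua_exp f n : A f -> A (fun x => f x ^+ n).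
Proof.
move=> Af; elim: n => [|n IH].
  by apply: (ua_eq (sub_const sA 1)) => x _; rewrite expr0.
by apply: (ua_eq (sub_mul sA Af IH)) => x _; rewrite exprS.
Qed.

Lemma ua_bigsum (I : Type) (s : seq I) (F : I -> T -> C) :
  (forall i, A (F i)) -> A (fun x => \sum_(i <- s) F i x).
Proof.
move=> hF; elim: s => [|i s IH].
  by apply: (ua_eq (sub_const sA 0)) => x _; rewrite big_nil.
by apply: (ua_eq (sub_add sA (hF i) IH)) => x _; rewrite big_cons.
Qed.

Lemma ua_geometric f (F : nat -> T -> C) (B q : R) : 0 <= q < 1 ->
  (forall n, A (F n)) ->
  (forall n x, K x -> normc (f x - F n x) <= B * q ^+ n) -> A f.
Proof.
move=> hq hF h; apply: (ua_closed ua) => e e0.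
have B1 : 0 < `|B| + 1 by rewrite ltr_pwDr.
have [n hn] := expr_lt_eps hq (divr_gt0 e0 B1).
exists (F n) => // x Kx; apply: le_trans (h n x Kx) _.
have q0 : 0 <= q ^+ n by rewrite exprn_ge0 //; case/andP: hq.
rewrite ltr_pdivlMr // in hn; have := ler_wpM2r q0 (ler_norm B).
by move: hn q0; set t := q ^+ n; lra.
Qed.

(** The geometric series of [1 - f] converges uniformly. *)
Lemma ua_inv_near1 f (q : R) : 0 <= q < 1 -> A f ->
  (forall x, K x -> normc (1 - f x) <= q) -> A (fun x => (f x)^-1).
Proof.
move=> hq Af h; have /andP[q0 q1] := hq.
pose F n x := \sum_(k <- iota 0 n) (1 - f x) ^+ k.
apply: (@ua_geometric _ F (1 - q)^-1 q hq).
  by move=> n; apply: ua_bigsum => k; apply: ua_exp; apply: ua_sub_fun => //; exact: sub_const sA 1.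
move=> n x Kx; have hx := h x Kx.
have f1 : 1 - q <= normc (f x).
  by have := normc_le_dist 1 (f x); rewrite normc1; lra.
have f0 : f x != 0 by rewrite -normc_gt0; lra.
have E : f x * F n x = 1 - (1 - f x) ^+ n.
  rewrite /F; elim: n => [|n IH]; first by rewrite big_nil expr0 mulr0 subrr.
  by rewrite -addn1 iotaD big_cat big_seq1 mulrDr IH add0n addn1 exprS /=; ring.
have -> : (f x)^-1 - F n x = (1 - f x) ^+ n / f x.
  by rewrite -[F n x](mulKf f0) E; field.
rewrite normcM normcX normcV mulrC; apply: ler_pM; rewrite ?invr_ge0 ?normc_ge0 //.
- by rewrite exprn_ge0 // normc_ge0.
- by rewrite lef_pV2 ?posrE ?normc_gt0 //; lra.
- by rewrite lerXn2r // nnegrE normc_ge0.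
Qed.

Lemma ua_inv_near c f (q : R) : 0 <= q < 1 -> A f ->
  (forall x, K x -> normc (1 - c * f x) <= q) -> A (fun x => (f x)^-1).
Proof.
move=> hq Af h; have := ua_inv_near1 hq (ua_scale c Af) h => /(ua_scale c) hc.
apply: (ua_eq hc) => x Kx; have := h x Kx; have [->|c0] := eqVneq c 0.
  by rewrite mul0r subr0 normc1 => h1; case/andP: hq => _; rewrite ltNge h1.
by rewrite invfM mulVKf.
Qed.

(** The inverses of [f - i s] are produced in succession from large [s] down to [0]; the
    strip bounds all of them by [1 / eta], so that steps of length [eta / 2] are
    possible. *)
Lemma ua_inv_strip f (eta : R) : 0 < eta -> A f ->
  (forall x, K x -> eta <= `|complex.Re (f x)|) -> A (fun x => (f x)^-1).
Proof.
move=> eta0 Af h; pose I s : C := Complex 0 s.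
have Re_shift s z : complex.Re (z - I s) = complex.Re z by rewrite ReD ReN /= subr0.
have AI s : A (fun x => f x - I s) by apply: ua_sub_fun => //; exact: sub_const sA _.
have nI s : normc (I s) = `|s| by rewrite normcE /= expr0n add0r sqrtr_sqr.
have q12 : 0 <= (1 / 2 : R) < 1 by apply/andP; split; lra.
have [B hB] := sub_bdd sA Af.
have start s : 2 * `|B| + 1 <= s -> A (fun x => (f x - I s)^-1).
  move=> hs; apply: (ua_inv_near (c := - (I s)^-1) q12) => // x Kx.
  have s0 : 0 < s by have := normr_ge0 B; lra.
  have I0 : I s != 0 by rewrite -normc_gt0 nI gtr0_norm.
  have -> : 1 - - (I s)^-1 * (f x - I s) = f x / I s by field.
  rewrite normcM normcV nI gtr0_norm // ler_pdivrMr //.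
  by have := hB x Kx; have := ler_norm B; lra.
have step s t : `|s - t| <= eta / 2 -> A (fun x => (f x - I s)^-1) -> A (fun x => (f x - I t)^-1).
  move=> st As.
  have nz r x : K x -> eta <= normc (f x - I r).
    by move=> /h hx; apply: le_trans hx _; rewrite -(Re_shift r); exact: Re_le_normc.
  have Ag : A (fun x => 1 + I (s - t) * (f x - I s)^-1).
    by apply: (sub_add sA); [exact: sub_const sA 1 | exact: ua_scale].
  have Ai : A (fun x => (1 + I (s - t) * (f x - I s)^-1)^-1).
    apply: (ua_inv_near1 q12 Ag) => x Kx.
    rewrite opprD addNKr normcN normcM normcV nI.
    have hx := nz s x Kx.
    by rewrite ler_pdivrMr; lra.
  apply: (ua_eq (sub_mul sA As Ai)) => x Kx.
  have hs : f x - I s != 0 by rewrite -normc_gt0; have := nz s x Kx; lra.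
  have ht : f x - I t != 0 by rewrite -normc_gt0; have := nz t x Kx; lra.
  rewrite -invfM; congr (_^-1).
  rewrite mulrDr mulr1 mulrCA mulfV // mulr1.
  have -> : I (s - t) = I s - I t by rewrite /I; apply/eqP; rewrite eq_complex /= subrr !eqxx.
  by ring.
have down k s : A (fun x => (f x - I (s + k%:R * (eta / 2)))^-1) -> A (fun x => (f x - I s)^-1).
  elim: k => [|k IH]; first by rewrite mul0r addr0.
  move=> hk; apply: IH; apply: step hk.
  by rewrite -natr1 ger0_norm; lra.
have : A (fun x => (f x - I 0)^-1).
  pose k := (Num.truncn ((2 * `|B| + 1) / (eta / 2))).+1.
  apply: (down k); rewrite add0r; apply: start.
  rewrite -ler_pdivrMr ?divr_gt0 //; apply: ltW; exact: Num.Theory.truncnS_gt.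
by move=> hI; apply: (ua_eq hI) => x _; rewrite /I (_ : Complex 0 0 = 0) // subr0.
Qed.

End Fixed.
End UniformAlgebras.

(** * Signs and inverse functions in a uniformly closed algebra *)

Section Heron.
Variable R : realType.
Local Notation C := R[i].
Implicit Types z : C.

Definition heron z : C := (z + z^-1) / 2%:R.

Lemma Re_inv z : complex.Re z^-1 = complex.Re z / normc z ^+ 2.
Proof.
rewrite normcE sqr_sqrtr; last by rewrite addr_ge0 ?sqr_ge0.
by case: z.
Qed.

Lemma Re_heron z : complex.Re (heron z) = complex.Re z * ((1 + (normc z ^+ 2)^-1) / 2).
Proof.
rewrite /heron -(rmorph_nat (real_complex R)) -fmorphV mulrC ReMr ReD Re_inv.
by set a := _^-1; set b := _^-1; ring.
Qed.

Lemma Re_heron_ge z : `|complex.Re z| / 2 <= `|complex.Re (heron z)|.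
Proof.
rewrite Re_heron normrM ler_wpM2l // ger0_norm.
  by rewrite ler_pdivlMr // mulVf // lerDl invr_ge0 sqr_ge0.
by rewrite divr_ge0 // addr_ge0 // invr_ge0 sqr_ge0.
Qed.

Lemma sg_heron z : complex.Re z != 0 -> Num.sg (complex.Re (heron z)) = Num.sg (complex.Re z).
Proof.
move=> z0; rewrite Re_heron sgrM [X in _ * X]gtr0_sg ?mulr1 //.
by rewrite divr_gt0 // ltr_wpDr // invr_ge0 sqr_ge0.
Qed.

Lemma sgr_mk_sqr (x : R) : x != 0 -> toC (Num.sg x) * toC (Num.sg x) = 1.
Proof. by move=> x0; rewrite -rmorphM -expr2 sqr_sg x0. Qed.

Lemma normc_sqrE z : normc z ^+ 2 = complex.Re z ^+ 2 + complex.Im z ^+ 2.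
Proof. by rewrite normcE sqr_sqrtr // addr_ge0 ?sqr_ge0. Qed.

(** The Cayley transform conjugates [heron] to squaring. *)
Lemma heron_cayley z (r : R) : complex.Re z != 0 -> 0 <= r -> r <= 1 ->
  let s := toC (Num.sg (complex.Re z)) in
  normc (z - s) <= r * normc (z + s) ->
  normc (heron z - s) <= r ^+ 2 * normc (heron z + s).
Proof.
move=> z0 r0 r1 s h.
have zn : z != 0 by apply: contraNneq z0 => ->.
have ss : s * s = 1 by exact: sgr_mk_sqr.
have n2 : (2%:R : C) != 0 by rewrite pnatr_eq0.
have zz : (2%:R * z) != 0 by rewrite mulf_neq0.
have e1 : heron z - s = (z - s) ^+ 2 / (2%:R * z).
  have -> : (z - s) ^+ 2 = z ^+ 2 - 2%:R * s * z + s * s by ring.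
  by rewrite ss /heron; field; rewrite zn.
have e2 : heron z + s = (z + s) ^+ 2 / (2%:R * z).
  have -> : (z + s) ^+ 2 = z ^+ 2 + 2%:R * s * z + s * s by ring.
  by rewrite ss /heron; field; rewrite zn.
have H (a b : C) : normc (a ^+ 2 / b) = normc a ^+ 2 / normc b.
  by rewrite normcM normcV normcX.
rewrite e1 e2 !H mulrA ler_wpM2r ?invr_ge0 ?normc_ge0 //.
by rewrite -exprMn lerXn2r // nnegrE ?mulr_ge0 ?normc_ge0.
Qed.

Lemma cayley_start z s (eta B : R) : s = toC (Num.sg (complex.Re z)) ->
  0 < eta -> eta <= `|complex.Re z| -> normc z <= B ->
  normc (z - s) ^+ 2 <= (1 - 4 * eta / (B + 1) ^+ 2) * normc (z + s) ^+ 2.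
Proof.
move=> es eta0 hz hB.
have z0 : complex.Re z != 0 by rewrite -normr_gt0; lra.
have B1 : 0 < B + 1 by have := normc_ge0 z; lra.
have E : normc (z - s) ^+ 2 = normc (z + s) ^+ 2 - 4 * `|complex.Re z|.
  rewrite es !normc_sqrE !ReD !ImD ReN ImN /= oppr0 addr0.
  by rewrite [`|_|]normrEsg; ring.
have h1 : normc (z + s) <= B + 1.
  apply: le_trans (normcD _ _) _; apply: lerD => //.
  by rewrite es normcR normr_sg z0.
have h2 : normc (z + s) ^+ 2 <= (B + 1) ^+ 2 by rewrite lerXn2r ?nnegrE ?normc_ge0 // ltW.
have B2 : 0 < (B + 1) ^+ 2 by rewrite exprn_gt0.
rewrite E mulrBl mul1r lerD2l lerN2 mulrAC ler_pdivrMr //.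
rewrite -[4 * _ * (B + 1) ^+ 2]mulrA -[4 * eta * _]mulrA ler_pM2l //.
by apply: ler_pM; rewrite ?sqr_ge0 // ltW.
Qed.

End Heron.

Section AlgebraSign.
Variables (R : realType) (T : topologicalType).
Local Notation C := R[i].
Variables (K : set T) (A : set (T -> C)).
Hypothesis ua : uniform_algebra K A.
Let sA := ua_sub ua.
Implicit Types (f g : T -> C).

(** Heron's iteration converges to the sign of the real part on both sides of the
    imaginary axis, geometrically and uniformly away from it. *)
Lemma ua_sign f (eta : R) : 0 < eta -> A f ->
  (forall x, K x -> eta <= `|complex.Re (f x)|) ->
  A (fun x => toC (Num.sg (complex.Re (f x)))).
Proof.
move=> eta0 Af h; have [B0 hB0] := sub_bdd sA Af; pose B := `|B0|.
have hB x : K x -> normc (f x) <= B by move=> /hB0 /le_trans; apply; exact: ler_norm.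
pose rho := 1 - 4 * eta / (B + 1) ^+ 2.
have B1 : 0 < B + 1 by rewrite ltr_wpDl // normr_ge0.
have rho1 : rho < 1.
  by rewrite /rho gtrBl divr_gt0 ?exprn_gt0 // mulr_gt0.
(* A square root of [rho] is avoided by [rho <= ((1 + rho) / 2) ^ 2]. *)
pose r := Num.max 0 ((1 + rho) / 2).
have r0 : 0 <= r by rewrite /r le_max lexx.
have r1 : r < 1 by rewrite /r gt_max ltr01 /=; lra.
have rr : rho <= r ^+ 2.
  have [h0|h0] := leP rho 0; first by apply: le_trans h0 _; exact: sqr_ge0.
  have -> : r = (1 + rho) / 2 by rewrite /r max_r //; lra.
  by have := sqr_ge0 (1 - rho); lra.
pose u n x := iter n (@heron R) (f x).
pose s x : C := toC (Num.sg (complex.Re (f x))).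
have Re0 x : K x -> complex.Re (f x) != 0 by move=> /h hx; rewrite -normr_gt0; lra.
have inv n : exists2 e : R, 0 < e &
    A (u n) /\ forall x, K x -> [/\ e <= `|complex.Re (u n x)|,
      Num.sg (complex.Re (u n x)) = Num.sg (complex.Re (f x)) &
      normc (u n x - s x) <= r ^+ n.+1 * normc (u n x + s x)].
  elim: n => [|n [e e0 [Au IH]]].
    exists eta => //; split => // x Kx; split => //; first exact: h.
    rewrite expr1 -(ler_pXn2r (n := 2)) ?nnegrE ?mulr_ge0 ?normc_ge0 // exprMn.
    apply: le_trans (cayley_start erefl eta0 (h x Kx) (hB x Kx)) _.
    by rewrite ler_wpM2r // sqr_ge0.
  exists (e / 2); first by rewrite divr_gt0.
  split.
    have Ai := ua_inv_strip ua e0 Au (fun x Kx => let: And3 a _ _ := IH x Kx in a).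
    have := ua_scale ua (2%:R^-1) (sub_add sA Au Ai) => hc.
    by apply: (ua_eq ua hc) => x _; rewrite /u iterS mulrC.
  move=> x Kx; have [h1 h2 h3] := IH x Kx.
  have ux0 : complex.Re (u n x) != 0 by rewrite -normr_gt0; lra.
  split.
  - by apply: le_trans (Re_heron_ge _); rewrite ler_wpM2r // invr_ge0.
  - by rewrite /u iterS sg_heron.
  - have r2 : 0 <= r ^+ n.+1 by rewrite exprn_ge0.
    have r3 : r ^+ n.+1 <= 1 by rewrite exprn_ile1 // ltW.
    rewrite /s -h2 in h3 *; have := heron_cayley ux0 r2 r3 h3 => /le_trans; apply.
    rewrite ler_wpM2r ?normc_ge0 // -exprM ler_wiXn2l //; first exact: ltW.
    by rewrite muln2 -addnn addSn ltnS leq_addl.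
apply: (@ua_geometric R T K A ua s u (2 / (1 - r)) r).
- by rewrite r0.
- by move=> n; have [e _ []] := inv n.
- move=> n x Kx; have [e _ [_ /(_ x Kx)[_ _ hv]]] := inv n.
  have hs : normc (s x) = 1 by rewrite normcR normr_sg Re0.
  have h1 : normc (u n x + s x) <= normc (u n x - s x) + 2.
    have -> : u n x + s x = (u n x - s x) + 2%:R * s x by ring.
    by apply: le_trans (normcD _ _) _; rewrite [normc (_ * s x)]normcM hs normc_nat mulr1.
  have t0 : 0 <= r ^+ n by rewrite exprn_ge0.
  have t1 : r ^+ n <= 1 by rewrite exprn_ile1 // ltW.
  have hd : 0 < 1 - r by lra.
  rewrite normcBC -[leRHS]mulrAC ler_pdivlMr //.
  have n0 := normc_ge0 (u n x - s x).
  move: hv h1 n0; rewrite exprS; set a := normc (_ - _); set b := normc (_ + _).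
  set t := r ^+ n in t0 t1 *; move=> hv h1 n0.
  have p1 : r * t <= r by rewrite ler_piMr.
  have rt0 : 0 <= r * t by rewrite mulr_ge0.
  have p2 : r * t * b <= r * t * (a + 2) by rewrite ler_wpM2l.
  have p3 : r * t * a <= r * a by rewrite ler_wpM2r.
  have p4 : r * t <= t by rewrite ler_piMl // ltW.
  by lra.
Qed.

(** Newton's method: the function [xi] is the fixed point of a contraction of the
    algebra. *)
Lemma ua_cauchy_inverse (T0 : C) (xi : T -> C) : normc T0 = 100 ->
  (forall x, K x -> normc (xi x) <= 1) ->
  A (fun x => cauchy_transform (xi x - T0)) -> A xi.
Proof.
move=> hT hxi Ag.
have Acomp u : A u -> (forall x, K x -> normc (u x) <= 2) -> A (fun x => cauchy_transform (u x - T0)).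
  move=> Au hu; apply: (@ua_geometric R T K A ua _ (fun n x => potential n (u x - T0)) 3 3^-1).
  - exact: third_rate.
  - move=> n; rewrite /potential /mean; apply: (ua_scale ua); apply: (ua_bigsum ua) => v.
    have q12 : 0 <= (1 / 2 : R) < 1 by apply/andP; split; lra.
    apply: (@ua_inv_near R T K A ua (- (T0 + center R v)^-1) _ (1 / 2) q12).
      apply: (ua_sub_fun ua); last exact: sub_const sA _.
      by apply: (ua_sub_fun ua) => //; exact: sub_const sA _.
    move=> x Kx; have hv := center_le1 R v; have hx := hu x Kx.
    have h99 : 99 <= normc (T0 + center R v).
      by have := normc_le_dist T0 (- center R v); rewrite normcN opprK; lra.
    have n0 : T0 + center R v != 0 by rewrite -normc_gt0; lra.
    have -> : 1 - - (T0 + center R v)^-1 * (u x - T0 - center R v) = u x / (T0 + center R v).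
      by field.
    by rewrite normcM normcV ler_pdivrMr; lra.
  - by move=> n x Kx; rewrite normcBC; apply: cauchy_lim; apply: far_translate => //; exact: hu.
pose g x := cauchy_transform (xi x - T0).
pose step (u : T -> C) x := u x + T0 ^+ 2 * (cauchy_transform (u x - T0) - g x).
pose u n := iter n step (fun=> 0).
have q12 : 0 <= (2^-1 : R) < 1 by apply/andP; split; lra.
have inv n : A (u n) /\ forall x, K x -> normc (u n x - xi x) <= 2^-1 ^+ n.
  elim: n => [|n [Au IH]].
    split; first exact: sub_const sA 0.
    by move=> x Kx; rewrite sub0r normcN expr0; exact: hxi.
  have hu x : K x -> normc (u n x) <= 2.
    move=> Kx; have h1 := IH x Kx; have h2 := hxi x Kx.
    have h3 : (2^-1 : R) ^+ n <= 1 by rewrite exprn_ile1 //; lra.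
    have := normc_le_dist (u n x) (xi x); move: h1 h3; set t := _ ^+ n; lra.
  split.
    apply: (sub_add sA) => //; apply: (ua_scale ua); apply: (ua_sub_fun ua) => //.
    exact: Acomp.
  move=> x Kx; have h2 : normc (xi x) <= 2 by have := hxi x Kx; lra.
  have := cauchy_contract hT (hu x Kx) h2.
  have -> : u n.+1 x = u n x + T0 ^+ 2 * (cauchy_transform (u n x - T0) - g x) by [].
  rewrite -/(g x) addrAC => h; apply: le_trans h _.
  by rewrite exprS mulrC ler_wpM2l ?invr_ge0 //; exact: IH.
apply: (@ua_geometric R T K A ua xi u 1 2^-1 q12) => [n|n x Kx]; first by have [] := inv n.
by rewrite mul1r normcBC; have [_] := inv n; exact.
Qed.

(** The digits of the real part are read off one at a time: once the first
    [n] are known, the next is the sign of the remainder. *)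
Lemma ua_Re_cantor_point (alpha : T -> nat -> digit) :
  A (fun x => cantor_point R (alpha x)) -> A (fun x => toC (complex.Re (cantor_point R (alpha x)))).
Proof.
move=> Axi; pose c n x : R := complex.Re (center R (mkseq (alpha x) n)).
have mk3 n : (3%:R^-1 ^+ n : C) = toC (3^-1 ^+ n).
  by rewrite rmorphXn fmorphV rmorph_nat.
have cS n x : c n.+1 x = c n x + 3^-1 ^+ n.+1 * sgnb R (alpha x n).1.
  by rewrite /c mkseqS center_rcons ReD size_mkseq mk3 ReMr.
have rem n x : complex.Re (cantor_point R (alpha x)) - c n x = 3^-1 ^+ n * complex.Re (cantor_point R (shift n (alpha x))).
  by rewrite (cantor_point_split R n) ReD mk3 ReMr /c addrC addKr.
have t0 n : 0 < (3^-1 : R) ^+ n by rewrite exprn_gt0 // invr_gt0.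
have Ac n : A (fun x => toC (c n x)).
  elim: n => [|n IH]; first exact: sub_const sA 0.
  pose f x := cantor_point R (alpha x) - toC (c n x).
  have Ref x : complex.Re (f x) = 3^-1 ^+ n * complex.Re (cantor_point R (shift n (alpha x))).
    by rewrite -rem /f ReD ReN.
  have Af : A f by exact: (ua_sub_fun ua Axi IH).
  have sg1 x := cantor_point_sgn_Re R (shift n (alpha x)); rewrite /shift addn0 in sg1.
  have eta0 : 0 < 3^-1 ^+ n / 6 :> R by rewrite divr_gt0.
  have hf x : K x -> 3^-1 ^+ n / 6 <= `|complex.Re (f x)|.
    move=> _; rewrite Ref normrM (ger0_norm (ltW (t0 n))) ler_pM2l // -[6^-1]mul1r.
    apply: le_trans (sg1 x) _; rewrite -[leRHS]mul1r -(sgnb_norm R (alpha x n).1) -normrM.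
    exact: ler_norm.
  have := ua_scale ua (toC (3^-1 ^+ n.+1)) (ua_sign eta0 Af hf) => hs.
  apply: (ua_eq ua (sub_add sA IH hs)) => x _.
  rewrite cS rmorphD rmorphM /=; congr (_ + _ * toC _).
  rewrite Ref sgrM gtr0_sg // mul1r; have := sg1 x.
  by rewrite /sgnb; case: ifP => _ h; [rewrite gtr0_sg | rewrite ltr0_sg]; lra.
apply: (@ua_geometric R T K A ua _ (fun n x => toC (c n x)) 1 3^-1 (third_rate R) Ac) => n x Kx.
rewrite mul1r -rmorphB normcR rem normrM (ger0_norm (ltW (t0 n))) ler_piMr ?(ltW (t0 n)) //.
by have [h _] := cantor_point_box R (shift n (alpha x)); lra.
Qed.

End AlgebraSign.

(** * Stone-Weierstrass and localization *)

Lemma compact_finite_cover (T : ptopologicalType) (K : set T) (P : T -> T -> Prop) :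
  compact K -> (forall x, K x -> \forall y \near x, K y -> P x y) ->
  exists s : seq T, (forall x, x \in s -> K x) /\
    forall y, K y -> exists2 x, x \in s & P x y.
Proof.
rewrite compact_cover => cK hP.
have [|x Kx|D' sD cD] := cK T K (fun x => interior [set y | K y -> P x y]).
- by move=> *; exact: open_interior.
- by exists x => //; exact: hP.
exists (finmap.enum_fset D'); split=> [x xD|y Ky]; first by have /set_mem := sD x xD.
have [x xD /interior_subset h] := cD y Ky.
by exists x => //; exact: h.
Qed.

Section StoneWeierstrass.
Variables (R : realType) (T : ptopologicalType).
Local Notation C := R[i].
Variables (K : set T) (A : set (T -> C)).
Hypothesis ua : uniform_algebra K A.
Let sA := ua_sub ua.
Implicit Types (h g : T -> R).
Local Notation real_mem h := (A (fun x => toC (h x))).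

(** This polynomial recursion is a square root of [u ^ 2], hence an absolute value: the
    error [e] satisfies [e' <= e - e ^ 2 / 2]. *)
Lemma sqrt_iteration (u : R) (n : nat) : 0 <= u <= 1 ->
  let y := iter n (fun y => y + (u ^+ 2 - y ^+ 2) / 2) 0 in
  [/\ 0 <= y, y <= u & (u - y) * n.+1%:R <= 2].
Proof.
move=> /andP[u0 u1]; elim: n => [|n] /=; first by split; lra.
set y := iter _ _ _ => -[y0 yu hn].
set e := u - y in hn; have e0 : 0 <= e by rewrite subr_ge0.
have e1 : e <= 1 by rewrite /e; lra.
have ey : y = u - e by rewrite /e; ring.
have uE : e <= u by rewrite /e; lra.
have E : u - (y + (u ^+ 2 - y ^+ 2) / 2) = e * (1 - u + e / 2) by rewrite ey; field.
have h1 : 0 <= 1 - u + e / 2 by lra.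
have E0 : 0 <= e * (1 - u + e / 2) by rewrite mulr_ge0.
split.
- have : e * (1 - u + e / 2) <= e by rewrite ler_piMr //; lra.
  by move: E; lra.
- by move: E E0; lra.
- rewrite E -[n.+2%:R]natr1; set m := n.+1%:R in hn *.
  have m0 : 0 <= m by [].
  have em0 : 0 <= e * m by rewrite mulr_ge0.
  have h2 : e * (1 - u + e / 2) <= e * (1 - e / 2) by rewrite ler_wpM2l //; lra.
  have h3 : e * (1 - u + e / 2) * (m + 1) <= e * (1 - e / 2) * (m + 1).
    by rewrite ler_wpM2r //; lra.
    apply: le_trans h3 _.
  have h4 : 0 <= (2 - e * m) * (1 - e) by rewrite mulr_ge0 //; lra.
  have h5 : 0 <= e * e by rewrite mulr_ge0.
  have -> : e * (1 - e / 2) * (m + 1) = e * m + e * (1 - (e * m) / 2) - e * e / 2 by field.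
  by lra.
Qed.

Lemma real_mem_lin (a b : R) h g : real_mem h -> real_mem g -> real_mem (fun x => a * h x + b * g x).
Proof.
move=> Ah Ag; have := sub_add sA (ua_scale ua (toC a) Ah) (ua_scale ua (toC b) Ag).
by move=> H; apply: (ua_eq ua H) => x _; rewrite rmorphD !rmorphM.
Qed.

Lemma real_mem_abs h : real_mem h -> real_mem (fun x => `|h x|).
Proof.
move=> Ah; have [B0 hB0] := sub_bdd sA Ah; pose B := `|B0| + 1.
have B1 : 0 < B by rewrite ltr_pwDr.
have hB x : K x -> `|h x| <= B.
  move=> /hB0; rewrite normcR => /le_trans; apply.
  by apply: le_trans (ler_norm _) _; rewrite lerDl.
have Ap : real_mem (fun x => h x / B).
  have := ua_scale ua (toC B^-1) Ah => H; apply: (ua_eq ua H) => x _.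
  by rewrite -rmorphM mulrC.
pose y n x := iter n (fun y => y + ((`|h x| / B) ^+ 2 - y ^+ 2) / 2) 0.
have Ay n : real_mem (y n).
  elim: n => [|n IH]; first exact: sub_const sA 0.
  have A2 := sub_mul sA Ap Ap; have Ay2 := sub_mul sA IH IH.
  have H := sub_add sA IH (ua_scale ua (toC 2^-1) (ua_sub_fun ua A2 Ay2)).
  apply: (ua_eq ua H) => x _; rewrite -!rmorphM -rmorphB -rmorphM -rmorphD; congr (toC _).
  have e2 : (`|h x| / B) ^+ 2 = (h x / B) ^+ 2.
    by rewrite !expr_div_n real_normK ?num_real.
  have -> : y n.+1 x = y n x + ((`|h x| / B) ^+ 2 - y n x ^+ 2) / 2 by [].
  by rewrite e2; ring.
have Au : real_mem (fun x => `|h x| / B).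
  apply: (ua_closed ua) => e e0; pose n := Num.truncn (2 / e).
  have hn : 2 / e < n.+1%:R by exact: Num.Theory.truncnS_gt.
  exists (fun x => toC (y n x)) => // x Kx; rewrite -rmorphB normcR.
  have hu : 0 <= `|h x| / B <= 1.
    rewrite divr_ge0 //= ?(ltW B1) // ler_pdivrMr // mul1r; exact: hB.
  have [y0 yu hy] := sqrt_iteration n hu.
  rewrite ger0_norm; last by rewrite subr_ge0.
  have n0 : 0 < n.+1%:R :> R by [].
  rewrite -(ler_pM2r n0); apply: le_trans hy _.
  by rewrite ltW // -ltr_pdivrMl // mulrC.
have := ua_scale ua (toC B) Au => H; apply: (ua_eq ua H) => x _.
by rewrite -rmorphM mulrC divfK // gt_eqF.
Qed.

Lemma real_mem_max h g : real_mem h -> real_mem g -> real_mem (fun x => Num.max (h x) (g x)).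
Proof.
move=> Ah Ag; have Ad := real_mem_abs (real_mem_lin 1 (-1) Ah Ag).
have H := real_mem_lin 1 (1 / 2) (real_mem_lin (1 / 2) (1 / 2) Ah Ag) Ad.
apply: (ua_eq ua H) => x _; congr (toC _).
rewrite !mul1r mulN1r; case: (leP (h x) (g x)) => hg.
  by rewrite ler0_norm; lra.
by rewrite gtr0_norm; lra.
Qed.

Lemma real_mem_opp h : real_mem h -> real_mem (fun x => - h x).
Proof. by move=> /(ua_opp ua) H; apply: (ua_eq ua H) => x _; rewrite rmorphN. Qed.

Lemma real_mem_seqmax (I : eqType) (x0 : I) (s : seq I) (G : I -> T -> R) :
  (forall i, i \in x0 :: s -> real_mem (G i)) ->
  exists2 h, real_mem h & forall z, (forall i, i \in x0 :: s -> G i z <= h z) /\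
    exists2 i, i \in x0 :: s & h z = G i z.
Proof.
elim: s x0 => [|x1 s IH] x0 hG.
  exists (G x0) => [|z]; first by apply: hG; rewrite mem_head.
  by split=> [i|]; [rewrite inE => /eqP -> | exists x0; rewrite ?mem_head].
have [|h Ah hh] := IH x1; first by move=> i hi; apply: hG; rewrite inE hi orbT.
exists (fun x => Num.max (G x0 x) (h x)) => [|z].
  by apply: real_mem_max => //; apply: hG; rewrite mem_head.
have [h1 [j js hj]] := hh z; split.
  move=> i; rewrite inE => /orP[/eqP ->|/h1 hi]; rewrite le_max ?lexx // hi orbT //.
case: (leP (G x0 z) (h z)) => _; last by exists x0; rewrite ?mem_head.
by exists j => //; rewrite inE js orbT.
Qed.

Definition real_cont (f : T -> R) := cont_at_points K (fun x => toC (f x)).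

Lemma real_contP f x (e : R) : real_cont f -> K x -> 0 < e ->
  \forall y \near x, K y -> `|f y - f x| < e.
Proof.
by move=> cf Kx e0; apply: filterS (cf x Kx e e0) => y hy /hy; rewrite -rmorphB normcR.
Qed.

(** The usual two-step argument: maxima of functions through [f x] and [f y] are above
    [f - e], and minima of such maxima are also below [f + e]. *)
Theorem stone_weierstrass f : compact K -> real_cont f ->
  (forall x y, K x -> K y -> exists h, [/\ real_mem h, h x = f x & h y = f y]) ->
  real_mem f.
Proof.
move=> cK cf two; apply: (ua_closed ua) => e e0.
have cont_mem h : real_mem h -> real_cont h by move=> Ah; exact: sub_cont sA _ Ah.
have e2 : 0 < e / 2 by rewrite divr_gt0.
have lower x : K x -> exists h, [/\ real_mem h, h x = f x & forall z, K z -> f z - e < h z].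
  move=> Kx; have [H hH] : exists H : T -> T -> R, forall y, K y ->
      [/\ real_mem (H y), H y x = f x & H y y = f y].
    have : forall y, exists h, K y -> [/\ real_mem h, h x = f x & h y = f y].
      move=> y; have [Ky|nKy] := pselect (K y); last by exists f.
      by have [h hh] := two x y Kx Ky; exists h.
    by move=> /choice[H hH]; exists H.
  have [|s [sK hs]] := compact_finite_cover (P := fun y z => f z - e < H y z) cK.
    move=> y Ky; have [Ah _ hy] := hH y Ky.
    apply: filterS2 (real_contP cf Ky e2) (real_contP (cont_mem _ Ah) Ky e2) => z h1 h2 Kz.
    have := h1 Kz; have := h2 Kz; rewrite hy !ltr_norml => /andP[? ?] /andP[? ?]; lra.
  case: s sK hs => [|x0 s] sK hs; first by have [] := hs x Kx.
  have [|h Ah hh] := @real_mem_seqmax _ x0 s H.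
    by move=> i /sK Ki; have [] := hH i Ki.
  exists h; split => //.
    by have [_ [j /sK Kj ->]] := hh x; have [] := hH j Kj.
  move=> z Kz; have [j js hj] := hs z Kz; have [/(_ j js) h1 _] := hh z.
  exact: lt_le_trans h1.
have [H hH] : exists H : T -> T -> R, forall x, K x ->
    [/\ real_mem (H x), H x x = f x & forall z, K z -> f z - e < H x z].
  have : forall x, exists h, K x -> [/\ real_mem h, h x = f x & forall z, K z -> f z - e < h z].
    move=> x; have [Kx|nKx] := pselect (K x); last by exists f.
    by have [h hh] := lower x Kx; exists h.
  by move=> /choice[H hH]; exists H.
have [|s [sK hs]] := compact_finite_cover (P := fun x z => H x z < f z + e) cK.
  move=> x Kx; have [Ah hx _] := hH x Kx.
  apply: filterS2 (real_contP cf Kx e2) (real_contP (cont_mem _ Ah) Kx e2) => z h1 h2 Kz.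
  have := h1 Kz; have := h2 Kz; rewrite hx !ltr_norml => /andP[? ?] /andP[? ?]; lra.
case: s sK hs => [|x0 s] sK hs.
  exists (fun=> 0); first exact: sub_const sA 0.
  by move=> x Kx; have [] := hs x Kx.
have [|h Ah hh] := @real_mem_seqmax _ x0 s (fun x z => - H x z).
  by move=> i /sK Ki; apply: real_mem_opp; have [] := hH i Ki.
exists (fun x => toC (- h x)); first exact: real_mem_opp.
move=> z Kz; rewrite -rmorphB normcR ler_norml opprK.
have [h1 [j /sK Kj hj]] := hh z; have [_ _ /(_ z Kz) lo] := hH j Kj.
have [i si hi] := hs z Kz; have := h1 i si; rewrite hj in h1 *.
by lra.
Qed.

Lemma cont_Re f : cont_at_points K f -> real_cont (fun x => complex.Re (f x)).
Proof.
move=> cf x Kx e e0; apply: filterS (cf x Kx e e0) => y hy /hy; apply: le_lt_trans.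
by rewrite -rmorphB normcR -ReN -ReD; exact: Re_le_normc.
Qed.

Lemma cont_Im f : cont_at_points K f -> real_cont (fun x => complex.Im (f x)).
Proof.
move=> cf x Kx e e0; apply: filterS (cf x Kx e e0) => y hy /hy; apply: le_lt_trans.
by rewrite -rmorphB normcR -ImN -ImD; exact: Im_le_normc.
Qed.

Lemma ua_ReIm f : real_mem (fun x => complex.Re (f x)) -> real_mem (fun x => complex.Im (f x)) -> A f.
Proof.
move=> Ar Ai; have H := sub_add sA Ar (ua_scale ua (Complex 0 1) Ai).
apply: (ua_eq ua H) => x _.
by case: (f x) => a b; apply/eqP; rewrite eq_complex /= !(mul0r,mulr0,mul1r,subr0,addr0,add0r) !eqxx.
Qed.

Theorem complex_stone_weierstrass : compact K ->
  (forall x y, K x -> K y -> x <> y -> exists2 h, real_mem h & h x <> h y) ->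
  forall f, cont_at_points K f -> A f.
Proof.
move=> cK sep f cf.
have two g x y : K x -> K y -> exists h, [/\ real_mem h, h x = g x & h y = g y].
  move=> Kx Ky; have [<-|xy] := pselect (x = y).
    by exists (fun=> g x); split => //; exact: sub_const sA _.
  have [h Ah /eqP hxy] := sep x y Kx Ky xy; rewrite -subr_eq0 in hxy.
  pose a := (g x - g y) / (h x - h y).
  exists (fun z => a * h z + (g y - a * h y) * 1); split; first 1 last.
  - by rewrite /a; field.
  - by rewrite mulr1 addrC subrK.
  - by apply: real_mem_lin => //; exact: sub_const sA 1.
apply: ua_ReIm; first by apply: (stone_weierstrass cK (cont_Re cf)) => *; exact: (two (fun x => complex.Re (f x))).
by apply: (stone_weierstrass cK (cont_Im cf)) => *; exact: (two (fun x => complex.Im (f x))).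
Qed.

(** Pairs of points of [K0] are interpolated by constants, the others by means of the
    separating functions. *)
Lemma vanishing_mem (K0 : set T) : compact K ->
  (forall x y, K x -> K y -> x <> y -> ~ (K0 x /\ K0 y) ->
     exists2 h, real_mem h & h x <> h y) ->
  forall g, real_cont g -> (forall x, K0 x -> g x = 0) -> real_mem g.
Proof.
move=> cK sep g cg g0; apply: (stone_weierstrass cK cg) => x y Kx Ky.
have [<-|xy] := pselect (x = y).
  by exists (fun=> g x); split => //; exact: sub_const sA _.
have [[x0 y0]|n0] := pselect (K0 x /\ K0 y).
  by exists (fun=> 0); rewrite !g0 //; split => //; exact: sub_const sA 0.
have [h Ah /eqP hxy] := sep x y Kx Ky xy n0; rewrite -subr_eq0 in hxy.
pose a := (g x - g y) / (h x - h y).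
exists (fun z => a * h z + (g y - a * h y) * 1); split; first 1 last.
- by rewrite /a; field.
- by rewrite mulr1 addrC subrK.
- by apply: real_mem_lin => //; exact: sub_const sA 1.
Qed.

End StoneWeierstrass.

Section Gluing.
Variables (R : realType) (T : ptopologicalType).
Local Notation C := R[i].
Variables (K K0 : set T) (A : set (T -> C)).
Hypotheses (ua : uniform_algebra K A) (K0K : K0 `<=` K).
Let sA := ua_sub ua.

Lemma subalgebra_restrict : subalgebra K0 A.
Proof.
split.
- exact: sub_const sA.
- exact: sub_add sA.
- exact: sub_mul sA.
- by move=> f /(sub_bdd sA)[B hB]; exists B => x /K0K; exact: hB.
- move=> f Af x /K0K Kx e e0; apply: filterS (sub_cont sA Af Kx e0) => y hy /K0K; exact: hy.
Qed.

(** Soft thresholding: it turns a function which is small on [K0] into a nearby one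
    which vanishes there. *)
Definition soft (e t : R) : R := t - Num.max (- e) (Num.min t e).

Lemma softP e t : 0 <= e -> [\/ t <= - e /\ soft e t = t + e,
  - e <= t <= e /\ soft e t = 0 | e <= t /\ soft e t = t - e].
Proof.
move=> e0; rewrite /soft; have [h1|/ltW h1] := leP t e.
  have [h2|/ltW h2] := leP (- e) t; first by constructor 2; rewrite ?h2 ?h1 subrr.
  by constructor 1; rewrite h2 opprK.
by constructor 3; rewrite max_r //; lra.
Qed.

Lemma soft_lip e s t : 0 <= e -> `|soft e s - soft e t| <= `|s - t|.
Proof.
move=> e0; wlog st : s t / s <= t.
  by move=> H; have [/H//|/ltW/H] := leP s t; rewrite distrC [leRHS]distrC.
have -> : `|s - t| = t - s by rewrite ler0_norm; lra.
rewrite ler_norml.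
case: (softP s e0) => -[h1 ->]; case: (softP t e0) => -[h2 ->];
  by apply/andP; split; lra.
Qed.

Lemma soft_dist e t : 0 <= e -> `|t - soft e t| <= e.
Proof.
by move=> e0; rewrite ler_norml; case: (softP t e0) => -[h1 ->]; apply/andP; split; lra.
Qed.

Lemma soft_eq0 e t : `|t| <= e -> soft e t = 0.
Proof.
rewrite ler_norml => /andP[h1 h2]; rewrite /soft.
by rewrite min_l // max_r // subrr.
Qed.

Lemma real_cont_soft e (h : T -> R) : 0 <= e -> real_cont K h ->
  real_cont K (fun x => soft e (h x)).
Proof.
move=> e0 ch x Kx d d0; apply: filterS (real_contP ch Kx d0) => y hy Ky.
by rewrite -rmorphB normcR; apply: le_lt_trans (hy Ky); exact: soft_lip.
Qed.

(** A case of Bishop's localization.  An element of [A] close to [f] on [K0] leaves a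
    difference which is small on [K0]; after thresholding it vanishes on [K0], where the
    real Stone-Weierstrass theorem applies to it. *)
Theorem algebra_localization : compact K ->
  (forall x y, K x -> K y -> x <> y -> ~ (K0 x /\ K0 y) ->
     exists2 h : T -> R, A (fun x => toC (h x)) & h x <> h y) ->
  (forall f, cont_at_points K0 f -> uniform_closure K0 A f) ->
  forall f, cont_at_points K f -> A f.
Proof.
move=> cK sep dense f cf; apply: (ua_closed ua) => e e0.
have e4 : 0 < e / 4 by rewrite divr_gt0.
have cf0 : cont_at_points K0 f.
  by move=> x /K0K Kx d d0; apply: filterS (cf x Kx d d0) => y hy /K0K; exact: hy.
have [p Ap hp] := dense f cf0 _ e4.
have cg : cont_at_points K (fun x => f x - p x).
  move=> x Kx d d0; have d2 : 0 < d / 2 by rewrite divr_gt0.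
  apply: filterS2 (cf x Kx _ d2) (sub_cont sA Ap Kx d2) => y h1 h2 Ky.
  have -> : f y - p y - (f x - p x) = (f y - f x) - (p y - p x) by ring.
  apply: le_lt_trans (normcD _ _) _; rewrite normcN.
  by have := h1 Ky; have := h2 Ky; lra.
have small x : K0 x -> normc (f x - p x) <= e / 4 by exact: hp.
have Ar := @vanishing_mem R T K A ua K0 cK sep (fun x => soft (e / 4) (complex.Re (f x - p x)))
   (real_cont_soft (ltW e4) (cont_Re cg)).
have Ai := @vanishing_mem R T K A ua K0 cK sep (fun x => soft (e / 4) (complex.Im (f x - p x)))
   (real_cont_soft (ltW e4) (cont_Im cg)).
pose g x : C := Complex (soft (e / 4) (complex.Re (f x - p x))) (soft (e / 4) (complex.Im (f x - p x))).
have Ag : A g.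
  apply: (ua_ReIm ua).
    by apply: Ar => x K0x; apply: soft_eq0; apply: le_trans (Re_le_normc _) (small x K0x).
  by apply: Ai => x K0x; apply: soft_eq0; apply: le_trans (Im_le_normc _) (small x K0x).
exists (fun x => p x + g x); first exact: (sub_add sA).
move=> x Kx; rewrite opprD addrA; apply: le_trans (normc_le_ReIm _) _.
rewrite ReD ReN ImD ImN /=.
have h1 := soft_dist (complex.Re (f x - p x)) (ltW e4).
have h2 := soft_dist (complex.Im (f x - p x)) (ltW e4).
lra.
Qed.

End Gluing.

(** * Density of polynomials and polynomial convexity *)

Section ComplexTopology.
Variable R : realType.
Local Notation C := R[i].

Lemma nbhs_complexP (z : C) (S : set C) :
  nbhs z S <-> exists2 e : R, 0 < e & forall y, normc (y - z) < e -> S y.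
Proof.
split=> [/nbhs_ballP[e /= e0 he]|[e e0 he]].
  have [e1 e2] : complex.Im e = 0 /\ 0 < complex.Re e.
    by move: e0; rewrite ltcE /= => /andP[/eqP -> ->].
  exists (complex.Re e) => // y hy; apply: he; rewrite /ball /= normc_norm normcBC ltcE /=.
  by rewrite e1 eqxx.
apply/nbhs_ballP; exists (toC e); first by rewrite /= ltcR.
move=> y; rewrite /ball /= normc_norm ltcR normcBC => hy; exact: he.
Qed.

Lemma cvg_complexP (T : Type) (F : set_system T) (FF : Filter F) (f : T -> C) (l : C) :
  f @ F --> l <-> forall e : R, 0 < e -> \forall x \near F, normc (f x - l) < e.
Proof.
split=> [h e e0|h S /nbhs_complexP[e e0 he]].
  have : nbhs l [set y | normc (y - l) < e] by apply/nbhs_complexP; exists e.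
  by move=> /h.
by rewrite nbhs_simpl; apply: filterS (h e e0) => x; exact: he.
Qed.

Lemma within_continuousP (T : topologicalType) (X : set T) (f : T -> C) :
  {within X, continuous f} <-> cont_at_points X f.
Proof.
rewrite subspace_continuousP; split=> h x Xx.
  by move=> e e0; have /cvg_complexP /(_ e e0) := h x Xx; rewrite near_withinE.
by apply/cvg_complexP => e e0; rewrite near_withinE; exact: h.
Qed.

Lemma nbhs_rowP M (z : 'rV[C]_M) (S : set 'rV[C]_M) : nbhs z S <->
  exists2 e : R, 0 < e & forall y : 'rV[C]_M, (forall i, normc (y ord0 i - z ord0 i) < e) -> S y.
Proof.
split=> [/nbhs_ballP[e /= e0 he]|[e e0 he]].
  have [e1 e2] : complex.Im e = 0 /\ 0 < complex.Re e.
    by move: e0; rewrite ltcE /= => /andP[/eqP -> ->].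
  exists (complex.Re e) => // y hy; apply: he; split=> // i j.
  rewrite ord1 /ball /= normc_norm normcBC ltcE /=.
  by rewrite e1 eqxx hy.
apply/nbhs_ballP; exists (toC e); first by rewrite /= ltcR.
move=> y [_ hy]; apply: he => i; have := hy ord0 i.
by rewrite /ball /= normc_norm ltcR normcBC.
Qed.

Lemma row_within_continuous (T : topologicalType) (X : set T) M (f : T -> 'rV[C]_M) :
  (forall i, cont_at_points X (fun x => f x ord0 i)) -> {within X, continuous f}.
Proof.
move=> h; rewrite subspace_continuousP => x Xx S /nbhs_rowP[e e0 he].
suff : \forall y \near x, X y -> S (f y) by [].
have : \forall y \near x, forall i, X y -> normc (f y ord0 i - f x ord0 i) < e.
  by apply: filter_forall => i; exact: h.
by apply: filterS => y hy Xy; apply: he => i; exact: hy.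
Qed.

Lemma comp_cont_at_points (T : topologicalType) (K : set T) M (f : T -> 'rV[C]_M) (g : 'rV[C]_M -> C) :
  (forall i, cont_at_points K (fun x => f x ord0 i)) ->
  {within f @` K, continuous g} -> cont_at_points K (g \o f).
Proof.
move=> hf /within_continuousP hg x Kx e e0.
have : (f @` K) (f x) by exists x.
move=> /hg /(_ e e0) /nbhs_rowP[d d0 hd].
have : \forall y \near x, forall i, K y -> normc (f y ord0 i - f x ord0 i) < d.
  by apply: filter_forall => i; exact: hf.
apply: filterS => y hy Ky; apply: hd; last by exists y.
by move=> i; exact: hy.
Qed.

End ComplexTopology.

Section PointwiseContinuity.
Variables (R : realType) (T : topologicalType) (K : set T).
Local Notation C := R[i].
Implicit Types f g : T -> C.

Lemma cont_cst (c : C) : cont_at_points K (fun=> c).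
Proof. by move=> x Kx e e0; apply: filterE => y _; rewrite subrr normc0. Qed.

Lemma cont_add f g : cont_at_points K f -> cont_at_points K g ->
  cont_at_points K (fun x => f x + g x).
Proof.
move=> cf cg x Kx e e0; have e2 : 0 < e / 2 by rewrite divr_gt0.
apply: filterS2 (cf x Kx _ e2) (cg x Kx _ e2) => y h1 h2 Ky.
have -> : f y + g y - (f x + g x) = (f y - f x) + (g y - g x) by ring.
by apply: le_lt_trans (normcD _ _) _; have := h1 Ky; have := h2 Ky; lra.
Qed.

Lemma cont_mul f g : cont_at_points K f -> cont_at_points K g ->
  cont_at_points K (fun x => f x * g x).
Proof.
move=> cf cg x Kx e e0; set B := normc (f x) + normc (g x) + 1.
have f0 := normc_ge0 (f x); have g0 := normc_ge0 (g x).
have B0 : 0 < B by rewrite /B; lra.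
have d0 : 0 < Num.min 1 (e / (2 * B)) by rewrite lt_min ltr01 divr_gt0 // mulr_gt0.
apply: filterS2 (cf x Kx _ d0) (cg x Kx _ d0) => y h1 h2 Ky.
have := h1 Ky; have := h2 Ky; rewrite !lt_min => /andP[a1 a2] /andP[b1 b2].
have -> : f y * g y - f x * g x = f y * (g y - g x) + (f y - f x) * g x by ring.
apply: le_lt_trans (normcD _ _) _; rewrite !normcM.
have hy : normc (f y) <= B.
  by have := normc_le_dist (f y) (f x); rewrite /B; lra.
have gB : normc (g x) <= B by rewrite /B; lra.
rewrite ltr_pdivlMr ?mulr_gt0 // in a2; rewrite ltr_pdivlMr ?mulr_gt0 // in b2.
have p1 := ler_wpM2r (normc_ge0 (g y - g x)) hy.
have p2 := ler_wpM2l (normc_ge0 (f y - f x)) gB.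
by lra.
Qed.

Lemma cont_inv f : cont_at_points K f -> (forall x, K x -> f x != 0) ->
  cont_at_points K (fun x => (f x)^-1).
Proof.
move=> cf nz x Kx e e0; set m := normc (f x).
have m0 : 0 < m by rewrite normc_gt0 nz.
have d0 : 0 < Num.min (m / 2) (e * (m * m / 2)).
  by rewrite lt_min !divr_gt0 ?mulr_gt0 // divr_gt0 // mulr_gt0.
apply: filterS (cf x Kx _ d0) => y h Ky; have := h Ky; rewrite lt_min => /andP[h1 h2].
have hy : m / 2 <= normc (f y) by have := normc_le_dist (f x) (f y); rewrite normcBC -/m; lra.
have m2 : 0 < m / 2 by lra.
apply: le_lt_trans (invB_le m2 m0 hy (lexx _) (lexx _)) _.
by rewrite ltr_pdivrMr ?mulr_gt0 // [m / 2 * m]mulrAC.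
Qed.

Lemma cont_conj f : cont_at_points K f -> cont_at_points K (fun x => conjc (f x)).
Proof.
move=> cf x Kx e e0; apply: filterS (cf x Kx e e0) => y hy /hy.
by rewrite -rmorphB /=; case: (f y - f x) => a b; rewrite /= sqrrN.
Qed.

Lemma cont_bigsum (I : Type) (s : seq I) (F : I -> T -> C) :
  (forall i, cont_at_points K (F i)) -> cont_at_points K (fun x => \sum_(i <- s) F i x).
Proof.
move=> hF; elim: s => [|i s IH].
  by under eq_fun do rewrite big_nil; exact: cont_cst.
by under eq_fun do rewrite big_cons; exact: cont_add.
Qed.
End PointwiseContinuity.

Lemma cont_bounded (R : realType) (T : ptopologicalType) (K : set T) (f : T -> R[i]) :
  compact K -> cont_at_points K f -> exists B : R, forall x, K x -> normc (f x) <= B.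
Proof.
move=> cK cf.
have [|s [_ hs]] := compact_finite_cover (P := fun x y => normc (f y - f x) < 1) cK.
  by move=> x Kx; exact: cf.
exists (\sum_(x <- s) normc (f x) + 1) => y Ky; have [x xs hx] := hs y Ky.
have : normc (f x) <= \sum_(x <- s) normc (f x).
  rewrite (perm_big _ (perm_to_rem xs)) big_cons lerDl.
  by apply: sumr_ge0 => *; exact: normc_ge0.
by have := normc_le_dist (f y) (f x); lra.
Qed.

Section PolynomialAlgebra.
Variables (R : realType) (T : ptopologicalType) (M : nat).
Local Notation C := R[i].
Variables (K : set T) (pi : T -> 'rV[C]_M).
Hypotheses (cK : compact K) (cpi : forall i, cont_at_points K (fun x => pi x ord0 i)).

Definition poly_functions : set (T -> C) :=
  [set f | exists p, forall x, f x = peval p (pi x)].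

Lemma poly_functions_subalgebra : subalgebra K poly_functions.
Proof.
have cont f : poly_functions f -> cont_at_points K f.
  move=> [p hp]; rewrite (_ : f = fun x => peval p (pi x)); last exact/funext.
  move: p {f hp}.
  apply: (@peval_ind _ _ (fun f => cont_at_points K (fun x => f (pi x)))) => [c|i|f g|f g].
  - exact: cont_cst.
  - exact: cpi.
  - exact: cont_add.
  - exact: cont_mul.
split=> //.
- by move=> c; have [p hp] := @peval_const R M c; exists p => x; rewrite hp.
- move=> f g [p hp] [q hq]; have [s hs] := peval_add p q.
  by exists s => x; rewrite hs hp hq.
- move=> f g [p hp] [q hq]; have [s hs] := peval_mul p q.
  by exists s => x; rewrite hs hp hq.
- by move=> f /cont; exact: cont_bounded.
Qed.

Definition poly_closure := uniform_closure K poly_functions.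

Lemma poly_closure_algebra : uniform_algebra K poly_closure.
Proof. exact: uniform_closure_algebra poly_functions_subalgebra. Qed.

Lemma poly_closure_coord i : poly_closure (fun x => pi x ord0 i).
Proof.
apply: uniform_closure_sub; have [p hp] := @peval_coord R M i.
by exists p => x; rewrite hp.
Qed.

Hypothesis dense : forall f, cont_at_points K f -> poly_closure f.

Lemma poly_algebra_full : poly_algebra (pi @` K) = cont_algebra (pi @` K).
Proof.
apply/seteqP; split=> [f [] //|f cf]; split => // U.
rewrite uniform_nbhs => -[E [entE EU]].
have [e e0 he] : exists2 e : R, 0 < e & forall x y : C, normc (x - y) < e -> E (x, y).
  move: entE; rewrite -entourage_ballE => -[e /= e0 he].
  have [e1 e2] : complex.Im e = 0 /\ 0 < complex.Re e.
    by move: e0; rewrite ltcE /= => /andP[/eqP -> ->].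
  exists (complex.Re e) => // x y hxy; apply: he; rewrite /ball /= normc_norm ltcE /=.
  by rewrite e1 eqxx.
have e2 : 0 < e / 2 by rewrite divr_gt0.
have [g [p hp] hg] := dense (comp_cont_at_points cpi cf) e2.
exists (peval p); split; first by exists p.
apply: EU => _ [x Kx <-]; apply: he; rewrite -hp.
by apply: le_lt_trans (hg x Kx) _; lra.
Qed.

(** If [z] is not in the set, the functions [x_i - z_i] have no common zero on it, so
    [1 = sum (x_i - z_i) g_i] with continuous [g_i]; replacing the [g_i] by polynomials
    close to them gives a polynomial of value [-1] at [z] and small on the set. *)
Lemma polynomially_convex_full : K !=set0 -> polynomially_convex (pi @` K).
Proof.
move=> [x0 Kx0]; apply/seteqP; split=> z; last first.
  move=> [x Kx <-] p; have [|B hB] := sub_bdd poly_functions_subalgebra (f := fun x => peval p (pi x)).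
    by exists p.
  apply: ub_le_sup; last by exists (pi x) => //; exists x.
  by exists B => _ [_ [y Ky <-] <-]; exact: hB.
move=> hz; apply: contrapT => nz.
pose S x := \sum_(i < M) (pi x ord0 i - z ord0 i) * conjc (pi x ord0 i - z ord0 i).
have cd i : cont_at_points K (fun x => pi x ord0 i - z ord0 i).
  by apply: cont_add => //; exact: cont_cst.
have S0 x : K x -> S x != 0.
  move=> Kx; apply/eqP => /eqP; rewrite psumr_eq0; last by move=> i _; exact: mulcJ_ge0.
  move=> /allP h; apply: nz; exists x => //; apply/rowP => i.
  have := h i (mem_index_enum _); rewrite /= mulf_eq0 conjc_eq0 orbb subr_eq0.
  by rewrite (ord1 ord0) => /eqP.
pose g i x := conjc (pi x ord0 i - z ord0 i) * (S x)^-1.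
have cg i : cont_at_points K (g i).
  apply: cont_mul; first exact: cont_conj.
  apply: cont_inv => //; apply: cont_bigsum => j; apply: cont_mul => //; exact: cont_conj.
have bd i : exists B : R, forall x, K x -> normc (pi x ord0 i - z ord0 i) <= B.
  exact: cont_bounded (cd i).
have [B hB] := choice bd.
pose BB := \sum_(i < M) `|B i| + 1.
have BB0 : 0 < BB by rewrite ltr_wpDl // sumr_ge0.
have e0 : 0 < 1 / (2 * BB) by rewrite divr_gt0 // mulr_gt0.
have qs i : exists q, forall x, K x -> normc (g i x - peval q (pi x)) <= 1 / (2 * BB).
  have [h [q hq] hh] := dense (cg i) e0.
  by exists q => x Kx; rewrite -hq; exact: hh.
have [q hq] := choice qs.
have [Q hQ] : exists Q : mpoly.mpoly M C, forall y, peval Q y =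
    \sum_(i <- index_enum 'I_M) (y ord0 i - z ord0 i) * peval (q i) y - 1.
  have [m1 hm1] := @peval_const R M (-1).
  suff [Q hQ] : exists Q : mpoly.mpoly M C, forall y, peval Q y =
      \sum_(i <- index_enum 'I_M) (y ord0 i - z ord0 i) * peval (q i) y.
    by have [s hs] := peval_add Q m1; exists s => y; rewrite hs hQ hm1.
  elim: (index_enum _) => [|i s [Q hQ]].
    by have [p hp] := @peval_const R M 0; exists p => y; rewrite hp big_nil.
  have [xi hxi] := @peval_coord R M i; have [c hc] := @peval_const R M (- z ord0 i).
  have [d hd] := peval_add xi c; have [t ht] := peval_mul d (q i).
  have [r hr] := peval_add t Q.
  by exists r => y; rewrite hr ht hd hxi hc hQ big_cons.
have := hz Q; rewrite hQ big1 ?sub0r ?normcN ?normc1; last first.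
  by move=> i _; rewrite subrr mul0r.
apply/negP; rewrite -ltNge; apply: (@le_lt_trans _ _ (1 / 2)); last by lra.
apply: ge_sup; first by exists (normc (peval Q (pi x0))), (pi x0) => //; exists x0.
move=> _ [_ [x Kx <-] <-]; rewrite hQ.
have -> : 1 = \sum_(i <- index_enum 'I_M) (pi x ord0 i - z ord0 i) * g i x :> C.
  rewrite /g -[LHS](mulfV (S0 x Kx)) /S mulr_suml; apply: eq_bigr => i _.
  by rewrite mulrA.
rewrite -sumrB; apply: le_trans (normc_sum _ _ _) _.
apply: (@le_trans _ _ (\sum_(i <- index_enum 'I_M) `|B i| * (1 / (2 * BB)))).
  apply: ler_sum => i _; rewrite -mulrBr normcM; apply: ler_pM; rewrite ?normc_ge0 //.
    exact: le_trans (hB i x Kx) (ler_norm _).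
  by rewrite normcBC; exact: hq.
rewrite -mulr_suml mulrA mulr1 ler_pdivrMr ?mulr_gt0 //.
by rewrite /BB; lra.
Qed.

End PolynomialAlgebra.

(** * Cantor sets with addresses *)

Section CantorScheme.
Variables (R : realType) (T : normedModType R).
Implicit Types (S Z : set T) (x y : T) (u v : seq digit).

Lemma dist_continuous x : continuous (fun y : T => `|y - x|).
Proof.
move=> y; apply: (@continuous_comp _ _ _ (fun y : T => y - x) Num.norm); last exact: norm_continuous.
by apply: continuousB; [exact: cvg_id | exact: cvg_cst].
Qed.

Lemma closed_dist_le x (e : R) : closed [set y : T | `|y - x| <= e].
Proof.
apply: (@preimage_closed _ _ (fun y : T => `|y - x|) [set z | z <= e]); last exact: closed_le.
by move=> y _; exact: dist_continuous.
Qed.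

Lemma closed_dist_ge x (e : R) : closed [set y : T | e <= `|y - x|].
Proof.
apply: (@preimage_closed _ _ (fun y : T => `|y - x|) [set z | e <= z]); last exact: closed_ge.
by move=> y _; exact: dist_continuous.
Qed.

Lemma near_dist_lt x (e : R) : 0 < e -> \forall y \near x, `|y - x| < e.
Proof.
by move=> e0; apply/nbhs_ballP; exists e => //= y; rewrite -ball_normE /= distrC.
Qed.

Lemma countable_cover (I : Type) (D : set I) (F : I -> set T) S : countable D ->
  (forall i, D i -> countable (F i)) -> S `<=` \bigcup_(i in D) F i -> countable S.
Proof.
by move=> cD cF SF; apply: sub_countable (bigcup_countable cD cF); exact: subset_card_le.
Qed.

Lemma sub_uncountable S Z : S `<=` Z -> ~ countable S -> ~ countable Z.
Proof. by move=> SZ nS cZ; apply: nS; apply: sub_countable cZ; exact: subset_card_le. Qed.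

Definition condensation S x := S x /\
  forall e : R, 0 < e -> ~ countable (S `&` [set y | `|y - x| <= e]).

(** Otherwise finitely many neighbourhoods with countable trace cover [S]. *)
Lemma condensation_exists S : compact S -> ~ countable S -> exists x, condensation S x.
Proof.
move=> cS nS; apply: contrapT => hn; apply: nS.
have h x : exists e : R, S x -> 0 < e /\ countable (S `&` [set y | `|y - x| <= e]).
  have [Sx|nSx] := pselect (S x); last by exists 0.
  apply: contrapT => hx; apply: hn; exists x; split => // e e0 ce.
  by apply: hx; exists e.
have [e he] := choice h.
have [|s [sS hs]] := @compact_finite_cover T S (fun x y => `|y - x| < e x) cS.
  by move=> x /he[e0 _]; apply: filterS (near_dist_lt x e0).
apply: (@countable_cover _ [set` s] (fun x => S `&` [set y | `|y - x| <= e x])).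
- by apply: finite_set_countable; exact: finite_seq.
- by move=> x /sS /he[].
- by move=> y Sy; have [x xs hx] := hs y Sy; exists x => //; split => //; exact: ltW.
Qed.

(** If [x] were the only one, the parts of [S] at distance at least [1 / n] from [x]
    would all be countable. *)
Lemma two_condensation S : compact S -> ~ countable S ->
  exists x y, [/\ condensation S x, condensation S y & x != y].
Proof.
move=> cS nS; have [x hx] := condensation_exists cS nS.
pose F (n : nat) := S `&` [set y | n.+1%:R^-1 <= `|y - x|].
have cF n : compact (F n) by apply: compact_closedI => //; exact: closed_dist_ge.
have [n nF] : exists n, ~ countable (F n).
  apply: contrapT => hn; apply: nS.
  apply: (@countable_cover _ setT (fun n : nat => [set x] `|` F n)) => //.
    move=> n _; apply: (@countable_cover _ [set: bool] (fun b : bool => if b then [set x] else F n)) => //.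
      case=> _; first exact: (countable1 x).
      by apply: contrapT => h; apply: hn; exists n.
    by move=> y [hy|hy]; [exists true | exists false].
  move=> y Sy; have [->|yx] := eqVneq y x; first by exists 0%N => //; left.
  have d0 : 0 < `|y - x| by rewrite normr_gt0 subr_eq0.
  exists (Num.truncn `|y - x|^-1) => //; right; split => //=.
  rewrite -[leRHS]invrK lef_pV2 ?posrE ?invr_gt0 //.
  by apply: ltW; exact: Num.Theory.truncnS_gt.
have [y [Fy hy]] := condensation_exists (cF n) nF.
exists x, y; split => //.
  split; first by case: Fy.
  by move=> e /hy; apply: sub_uncountable => z [[Sz _] hz].
apply/eqP => xy; case: Fy => _ /=.
by rewrite xy subrr normr0 leNgt invr_gt0 ltr0n.
Qed.

Definition uncountable_compact S := compact S /\ ~ countable S.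

Lemma split_two S (e : R) : 0 < e -> uncountable_compact S -> exists F : bool -> set T,
  [/\ forall b, uncountable_compact (F b), forall b, F b `<=` S, F true `&` F false = set0 &
      forall b x y, F b x -> F b y -> `|x - y| <= e].
Proof.
move=> e0 [cS nS]; have [x [y [[Sx hx] [Sy hy] xy]]] := two_condensation cS nS.
have d0 : 0 < `|x - y| by rewrite normr_gt0 subr_eq0.
pose r := Num.min (e / 2) (`|x - y| / 3).
have r0 : 0 < r by rewrite lt_min !divr_gt0.
have r1 : r <= e / 2 by rewrite ge_min lexx.
have r2 : r <= `|x - y| / 3 by rewrite ge_min lexx orbT.
exists (fun b : bool => S `&` [set z | `|z - (if b then x else y)| <= r]); split.
- by move=> b; split; [apply: compact_closedI => //; exact: closed_dist_le | case: b; [exact: hx | exact: hy]].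
- by move=> b z [].
- rewrite -subset0 => z [[_ /= h1] [_ /= h2]].
  by have := ler_distD z x y; rewrite distrC in h1; lra.
- move=> b z w [_ /= h1] [_ /= h2].
  have := ler_distD (if b then x else y) z w.
  by rewrite [`|(if b then x else y) - w|]distrC; lra.
Qed.

Lemma split_four S (e : R) : 0 < e -> uncountable_compact S -> exists F : digit -> set T,
  [/\ forall i, uncountable_compact (F i), forall i, F i `<=` S,
      forall i j x, F i x -> F j x -> i = j &
      forall i x y, F i x -> F i y -> `|x - y| <= e].
Proof.
move=> e0 pS; have [F [pF FS F0 _]] := split_two e0 pS.
have [G hG] : exists G : bool -> bool -> set T, forall b,
  [/\ forall c, uncountable_compact (G b c), forall c, G b c `<=` F b, G b true `&` G b false = set0 &
      forall c x y, G b c x -> G b c y -> `|x - y| <= e].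
  have /choice[G hG] : forall b, exists G : bool -> set T,
    [/\ forall c, uncountable_compact (G c), forall c, G c `<=` F b, G true `&` G false = set0 &
      forall c x y, G c x -> G c y -> `|x - y| <= e].
    by move=> b; exact: split_two.
  by exists G.
have disj (A B : set T) x : A `&` B = set0 -> A x -> B x -> False.
  by move=> AB Ax Bx; have : (A `&` B) x by []; rewrite AB.
exists (fun i => G i.1 i.2); split.
- by move=> i; have [h _ _ _] := hG i.1.
- by move=> i x; have [_ h _ _] := hG i.1; move=> /h /FS.
- move=> [a b] [c d] x /= h1 h2.
  have ac : a = c.
    have [_ s1 _ _] := hG a; have [_ s2 _ _] := hG c.
    have := s1 _ _ h1; have := s2 _ _ h2; case: (a) (c) => [] [] // k1 k2.
      by case: (disj _ _ _ F0 k2 k1).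
    by case: (disj _ _ _ F0 k1 k2).
  rewrite ac in h1 *; have [_ _ s3 _] := hG c.
  case: b d h1 h2 => [] [] // k1 k2.
    by case: (disj _ _ _ s3 k1 k2).
  by case: (disj _ _ _ s3 k2 k1).
- by move=> i; have [_ _ _ h] := hG i.1; exact: h.
Qed.

(** A word is stored with its last letter first, so that [u] extends [behead u]. *)
Record cantor_scheme Z (cell : seq digit -> set T) : Prop := CantorScheme {
  cs_root : cell [::] `<=` Z;
  cs_piece : forall u, uncountable_compact (cell u);
  cs_sub : forall i u, cell (i :: u) `<=` cell u;
  cs_disj : forall i j u x, cell (i :: u) x -> cell (j :: u) x -> i = j;
  cs_diam : forall i u x y, cell (i :: u) x -> cell (i :: u) y -> `|x - y| <= (size u).+1%:R^-1 }.

Lemma cantor_scheme_exists Z : uncountable_compact Z -> exists cell, cantor_scheme Z cell.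
Proof.
move=> pZ.
have H (p : nat * set T) : exists F : digit -> set T, uncountable_compact p.2 ->
  [/\ forall i, uncountable_compact (F i), forall i, F i `<=` p.2,
      forall i j x, F i x -> F j x -> i = j &
      forall i x y, F i x -> F i y -> `|x - y| <= p.1.+1%:R^-1].
  have [pp|np] := pselect (uncountable_compact p.2); last by exists (fun=> set0).
  have e0 : 0 < p.1.+1%:R^-1 :> R by rewrite invr_gt0.
  by have [F hF] := split_four e0 pp; exists F.
have [f hf] := choice H.
pose cell := fix cell (u : seq digit) := if u is i :: v then f (size v, cell v) i else Z.
have pc u : uncountable_compact (cell u).
  by elim: u => [//|i u IH]; have [h _ _ _] := hf (size u, cell u) IH; exact: h.
exists cell; split => //.
- by move=> i u; have [_ h _ _] := hf (size u, cell u) (pc u); exact: h.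
- by move=> i j u x; have [_ _ h _] := hf (size u, cell u) (pc u); exact: h.
- by move=> i u x y; have [_ _ _ h] := hf (size u, cell u) (pc u); exact: h.
Qed.

Definition rprefix (a : nat -> digit) n := rev (mkseq a n).

Lemma rprefixS a n : rprefix a n.+1 = a n :: rprefix a n.
Proof. by rewrite /rprefix mkseqS rev_rcons. Qed.

Lemma size_rprefix a n : size (rprefix a n) = n.
Proof. by rewrite size_rev size_mkseq. Qed.

Lemma rprefix_inj a b n : rprefix a n = rprefix b n -> mkseq a n = mkseq b n.
Proof. exact: (can_inj revK). Qed.

Section Address.
Variables (Z : set T) (cell : seq digit -> set T).
Hypothesis cs : cantor_scheme Z cell.

Definition cantor_set : set T := [set x | exists a, forall n, cell (rprefix a n) x].

(** Disjointness makes addresses unique, so membership at every level by possibly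
    unrelated words is membership along a single address. *)
Lemma cell_unique u v x : size u = size v -> cell u x -> cell v x -> u = v.
Proof.
elim: u v => [|i u IH] [|j v] //= [suv] hu hv.
have uv := IH v suv (cs_sub cs hu) (cs_sub cs hv); rewrite uv in hu *.
by rewrite (cs_disj cs hu hv).
Qed.

Lemma address_ex x : exists a, cantor_set x -> forall n, cell (rprefix a n) x.
Proof.
have [[a ha]|h] := pselect (cantor_set x); first by exists a.
by exists (fun=> (true, true)).
Qed.

Definition address x : nat -> digit := sval (cid (address_ex x)).

Lemma addressP x n : cantor_set x -> cell (rprefix (address x) n) x.
Proof. by move=> /(svalP (cid (address_ex x))). Qed.

Lemma cantor_set_sub : cantor_set `<=` Z.
Proof. by move=> x [a /(_ 0%N) h]; exact: cs_root cs _ h. Qed.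

Lemma address_inj x y : cantor_set x -> cantor_set y -> address x = address y -> x = y.
Proof.
move=> Cx Cy e; apply/eqP; rewrite -subr_eq0 -normr_eq0 eq_le normr_ge0 andbT.
rewrite leNgt; apply/negP => d0.
pose n := Num.truncn `|x - y|^-1.
have hx := addressP n.+1 Cx; have hy := addressP n.+1 Cy.
rewrite -e !rprefixS in hx hy; have := cs_diam cs hx hy; rewrite size_rprefix.
rewrite leNgt => /negP; apply; rewrite -[ltRHS]invrK ltf_pV2 ?posrE ?invr_gt0 //.
exact: Num.Theory.truncnS_gt.
Qed.

Lemma cell_closed u : closed (cell u).
Proof. by apply: compact_closed; [exact: norm_hausdorff | case: (cs_piece cs u)]. Qed.

Lemma cells_closed (s : seq (seq digit)) : closed (\bigcup_(v in [set` s]) cell v).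
Proof.
by apply: closed_bigcup; [exact: finite_seq | move=> v _; exact: cell_closed].
Qed.

Lemma cantor_setE :
  cantor_set = \bigcap_(n in [set: nat]) \bigcup_(v in [set` words n]) cell v.
Proof.
apply/seteqP; split=> x.
  move=> [a ha] n _; exists (rprefix a n) => //=.
  by rewrite -{2}(size_rprefix a n) words_mem.
move=> hx.
have /choice[v hv] : forall n, exists v, size v = n /\ cell v x.
  by move=> n; have [v /= /size_words sv cv] := hx n I; exists v.
exists (fun n => head (true, true) (v n.+1)) => n.
suff -> : rprefix (fun n => head (true, true) (v n.+1)) n = v n by have [] := hv n.
elim: n => [|n IH]; first by have [/size0nil -> _] := hv 0%N.
rewrite rprefixS IH; have [s1 c1] := hv n.+1; have [s0 c0] := hv n.
case: (v n.+1) s1 c1 => [//|i u] /= [su] cu; congr (_ :: _).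
by apply: cell_unique (cs_sub cs cu); rewrite // s0 su.
Qed.

Lemma cantor_set_compact : compact cantor_set.
Proof.
have -> : cantor_set = cell [::] `&` cantor_set.
  apply/seteqP; split=> [x Cx|x [] //]; split => //.
  by case: Cx => b /(_ 0%N).
apply: compact_closedI; first by case: (cs_piece cs [::]).
by rewrite cantor_setE; apply: closed_bigI => n _; exact: cells_closed.
Qed.

Lemma address_locally_constant x n : cantor_set x ->
  \forall y \near x, cantor_set y -> mkseq (address y) n = mkseq (address x) n.
Proof.
move=> Cx; set s := [seq v <- words n | v != rprefix (address x) n].
have nb : nbhs x (~` (\bigcup_(v in [set` s]) cell v)).
  apply: open_nbhs_nbhs; split; first by apply: closed_openC; exact: cells_closed.
  move=> [v /=]; rewrite mem_filter => /andP[vx /size_words sv] cv.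
  move: vx; rewrite (cell_unique _ cv (addressP n Cx)) ?eqxx //.
  by rewrite sv size_rprefix.
apply: filterS nb => y hy Cy; apply: rprefix_inj; apply: contrapT => ne; apply: hy.
exists (rprefix (address y) n); last exact: addressP.
have := words_mem (rprefix (address y) n); rewrite size_rprefix => yw.
by rewrite /= mem_filter yw andbT; exact/eqP.
Qed.

Lemma address_surjective u : exists2 x, cantor_set x & mkseq (address x) (size u) = u.
Proof.
pose a n := nth (true, true) u n.
have au : mkseq a (size u) = u by exact: mkseq_nth.
have mono n m : (n <= m)%N -> cell (rprefix a m) `<=` cell (rprefix a n).
  move=> /subnKC <-; elim: (m - n)%N => [|k IH]; first by rewrite addn0.
  by rewrite addnS rprefixS => x /(cs_sub cs) /IH.
pose F := filter_from setT (fun n => cell (rprefix a n)).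
have PF : ProperFilter F.
  apply: filter_from_proper.
    apply: filter_fromT_filter; first by exists 0%N.
    move=> i j; exists (maxn i j) => x hx; split.
      exact: mono (leq_maxl i j) _ hx.
    exact: mono (leq_maxr i j) _ hx.
  move=> n _; have [_ nc] := cs_piece cs (rprefix a n).
  apply/set0P/negP => /eqP e0; apply: nc; rewrite e0; exact: countable0.
have [c0 _] := cs_piece cs [::].
have [|x [_ clx]] := c0 F PF; first by exists 0%N.
have hx n : cell (rprefix a n) x.
  have : closure (cell (rprefix a n)) x.
    by move=> B Bx; apply: clx => //; exists n.
  by rewrite -(closure_id (cell (rprefix a n))).1 //; exact: cell_closed.
have Cx : cantor_set x by exists a.
exists x => //; rewrite -[RHS]au; apply: rprefix_inj.
by apply: cell_unique (addressP _ Cx) (hx _); rewrite !size_rprefix.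
Qed.

End Address.
(** Being relatively open in a compact set, the difference is a countable union of
    compact sets, one of which is uncountable. *)
Lemma perfect_piece_in (J V : set T) : compact J -> closed V -> ~ countable (J `\` V) ->
  exists2 Z, uncountable_compact Z & Z `<=` J `\` V.
Proof.
move=> cJ clV nc.
pose F (n : nat) := J `&` \bigcap_(y in V) [set x | n.+1%:R^-1 <= `|x - y|].
have cF n : compact (F n).
  apply: compact_closedI => //; apply: closed_bigI => y _; exact: closed_dist_ge.
have [n nF] : exists n, ~ countable (F n).
  apply: contrapT => hn; apply: nc.
  apply: (@countable_cover _ setT F) => // [n _|x [Jx nVx]].
    by apply: contrapT => h; apply: hn; exists n.
  have : nbhs x (~` V) by apply: open_nbhs_nbhs; split => //; exact: closed_openC.
  move=> /nbhs_ballP[e /= e0 he]; exists (Num.truncn e^-1) => //; split => // y Vy /=.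
  rewrite leNgt; apply/negP => h; apply: (he y) => //; rewrite -ball_normE /=.
  apply: lt_trans h _; rewrite -[ltRHS]invrK ltf_pV2 ?posrE ?invr_gt0 //.
  exact: Num.Theory.truncnS_gt.
exists (F n) => // x [Jx hx]; split => // Vx; have /= := hx x Vx.
by rewrite subrr normr0 leNgt invr_gt0 ltr0n.
Qed.

(** All that is needed of a homeomorphism with the space of addresses: prefixes are
    locally constant and every finite word is a prefix. *)
Record coded_cantor (Z C : set T) (alpha : T -> nat -> digit) : Prop := CodedCantor {
  cc_compact : compact C;
  cc_sub : C `<=` Z;
  cc_inj : forall x y, C x -> C y -> alpha x = alpha y -> x = y;
  cc_cont : forall x n, C x ->
    \forall y \near x, C y -> mkseq (alpha y) n = mkseq (alpha x) n;
  cc_surj : forall u : seq digit, exists2 x, C x & mkseq (alpha x) (size u) = u }.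

Theorem coded_cantor_exists (J V : set T) : compact J -> closed V -> ~ countable (J `\` V) ->
  exists C alpha, coded_cantor (J `\` V) C alpha.
Proof.
move=> cJ clV /(perfect_piece_in cJ clV)[Z pZ ZJ].
have [cell cs] := cantor_scheme_exists pZ.
exists (cantor_set cell), (address cell); split.
- exact: cantor_set_compact cs.
- by move=> x /(cantor_set_sub cs) /ZJ.
- exact: address_inj cs.
- by move=> x n; exact: address_locally_constant cs x n.
- exact: address_surjective cs.
Qed.

End CantorScheme.

(** * Distances, extensions and compact embeddings *)

Section DistanceExtension.
Variables (R : realType) (T : normedModType R).
Local Notation C := R[i].
Implicit Types (S K : set T) (x y : T).

Definition set_dist S x : R := inf [set `|x - c| | c in S].

Lemma set_dist_lb S x c : S c -> set_dist S x <= `|x - c|.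
Proof.
move=> Sc; apply: ge_inf; last by exists c.
by exists 0 => _ [d _ <-]; exact: normr_ge0.
Qed.

Lemma set_dist_ge S x (e : R) : S !=set0 -> (forall c, S c -> e <= `|x - c|) -> e <= set_dist S x.
Proof.
by move=> [c Sc] h; apply: lb_le_inf; [exists `|x - c|; exists c | move=> _ [d Sd <-]; exact: h].
Qed.

Lemma set_dist_lip S x y : S !=set0 -> `|set_dist S x - set_dist S y| <= `|x - y|.
Proof.
move=> S0.
have h a b : set_dist S a - `|a - b| <= set_dist S b.
  apply: set_dist_ge => // c Sc; rewrite lerBlDr.
  by apply: le_trans (set_dist_lb a Sc) _; rewrite [leRHS]addrC ler_distD.
by have := h x y; have := h y x; rewrite [`|y - x|]distrC ler_norml; lra.
Qed.

Lemma set_dist_eq0 S x : closed S -> S !=set0 -> set_dist S x = 0 <-> S x.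
Proof.
move=> cS S0; split=> [d0|Sx]; last first.
  apply/eqP; rewrite eq_le; apply/andP; split.
    by have := set_dist_lb x Sx; rewrite subrr normr0.
  by apply: set_dist_ge => // c _; exact: normr_ge0.
apply: contrapT => nSx.
have /nbhs_ballP[e /= e0 he] : nbhs x (~` S).
  by apply: open_nbhs_nbhs; split => //; exact: closed_openC.
have : e <= set_dist S x.
  apply: set_dist_ge => // c Sc; rewrite leNgt; apply/negP => h.
  by apply: (he c) => //; rewrite -ball_normE.
by rewrite d0 leNgt e0.
Qed.

Lemma set_dist_cont S K : S !=set0 -> real_cont K (set_dist S).
Proof.
move=> S0 x Kx e e0; apply: filterS (near_dist_lt x e0) => y hy _.
by rewrite -rmorphB normcR; exact: le_lt_trans (set_dist_lip _ _ S0) hy.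
Qed.

Lemma coord_cont N (D : set 'rV[R]_N) (i : 'I_N) : real_cont D (fun z => z ord0 i).
Proof.
move=> z Dz e e0; have : nbhs z [set w : 'rV[R]_N | `|w ord0 i - z ord0 i| < e].
  apply/nbhs_ballP; exists e => //= w [_ /(_ ord0 i)].
  by rewrite /ball /= distrC.
by apply: filterS => w hw _; rewrite -rmorphB normcR.
Qed.

Lemma real_within_continuous S (f : T -> R) : real_cont S f -> {within S, continuous (f : T -> R^o)}.
Proof.
move=> cf; rewrite subspace_continuousP => x Sx; apply/cvgrPdist_lt => e e0.
rewrite near_withinE; apply: filterS (real_contP cf Sx e0) => y hy Sy.
by rewrite distrC; exact: hy.
Qed.

Lemma continuous_real_cont K (g : T -> R^o) : continuous g -> real_cont K g.
Proof.
move=> cg x Kx e e0; have /cvgrPdist_lt /(_ e e0) := cg x.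
by apply: filterS => y hy _; rewrite -rmorphB normcR distrC.
Qed.

Lemma tietze_complex S (f : T -> C) : compact S -> cont_at_points S f ->
  exists2 g : T -> C, (forall x, S x -> g x = f x) & cont_at_points setT g.
Proof.
move=> cS cf.
have clS : closed S by apply: compact_closed => //; exact: norm_hausdorff.
have [B0 hB0] := cont_bounded cS cf; pose B := `|B0| + 1.
have B1 : 0 < B by rewrite ltr_pwDr.
have hB x : S x -> normc (f x) <= B.
  by move=> /hB0 /le_trans; apply; apply: le_trans (ler_norm _) _; rewrite lerDl.
have ext (h : T -> R) : real_cont S h -> (forall x, S x -> `|h x| <= B) ->
    exists2 g : T -> R, (forall x, S x -> g x = h x) & real_cont setT g.
  move=> ch bh.
  have [g [g1 g2 _]] := continuous_bounded_extension (@pseudometric_normal R T) clS B1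
    (real_within_continuous ch) bh.
  exists g; last exact: continuous_real_cont.
  by move=> x Sx; rewrite g1 // inE.
have [|g g1 g2] := ext _ (cont_Re cf).
  by move=> x Sx; exact: le_trans (Re_le_normc _) (hB x Sx).
have [|h h1 h2] := ext _ (cont_Im cf).
  by move=> x Sx; exact: le_trans (Im_le_normc _) (hB x Sx).
exists (fun x => toC (g x) + Complex 0 1 * toC (h x)).
  move=> x Sx; rewrite g1 // h1 //; case: (f x) => a b; apply/eqP.
  by rewrite eq_complex /= !(mul0r,mulr0,mul1r,subr0,addr0,add0r) !eqxx.
by apply: cont_add => //; apply: cont_mul => //; exact: cont_cst.
Qed.

(** The inverse is continuous because the part of [J] outside a neighbourhood of [x] has
    a compact image, which stays at a positive distance from [f x]. *)
Lemma embedding_compact M (J : set T) (f : T -> 'rV[C]_M) : compact J ->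
  (forall i, cont_at_points J (fun x => f x ord0 i)) ->
  (forall x y, J x -> J y -> f x = f y -> x = y) -> embedding_on J f.
Proof.
move=> cJ cf inj; have wf := row_within_continuous cf; split => //.
have [g hg] : exists g : 'rV[C]_M -> T, forall x, J x -> g (f x) = x.
  have /choice[g hg] : forall w : 'rV[C]_M, exists x, (f @` J) w -> J x /\ f x = w.
    move=> w; have [[x Jx <-]|nw] := pselect ((f @` J) w); first by exists x.
    by exists 0.
  exists g => x Jx; have [] := hg (f x); first by exists x.
  by move=> Jg e; exact: inj.
exists g; split; first by move=> x; rewrite inE => /hg.
rewrite subspace_continuousP => _ [x Jx <-] S nS0.
have nS : nbhs (g (f x)) S by exact: nS0.
rewrite (hg x Jx) in nS.
pose D := J `&` ~` interior S.
have cD : compact (f @` D).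
  apply: continuous_compact; first by apply: continuous_subspaceW wf => y [].
  by apply: compact_closedI => //; apply: open_closedC; exact: open_interior.
have clD : closed (f @` D) by apply: compact_closed => //; exact: norm_hausdorff.
suff : \forall w \near f x, (f @` J) w -> S (g w) by [].
have nb : nbhs (f x) (~` (f @` D)).
  apply: open_nbhs_nbhs; split; first exact: closed_openC.
  by move=> [y [Jy nSy] /(inj _ _ Jy Jx) yx]; apply: nSy; rewrite yx.
apply: filterS nb => w hy [z Jz zw]; rewrite -zw hg //.
apply: interior_subset; apply: contrapT => nSz; apply: hy; exists z => //.
Qed.

End DistanceExtension.

(** * The rational hull of two Cantor sets *)

Lemma peval_lipschitz (R : realType) (M : nat) (p : mpoly.mpoly M R[i]) (B : R) :
  exists2 L : R, 0 <= L & forall y z : 'rV[R[i]]_M,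
    (forall i, normc (y ord0 i) <= B) -> (forall i, normc (z ord0 i) <= B) ->
    normc (peval p y) <= L /\
    forall e : R, (forall i, normc (y ord0 i - z ord0 i) <= e) -> 0 <= e ->
      normc (peval p y - peval p z) <= L * e.
Proof.
move: p; apply: (@peval_ind _ _ (fun f => exists2 L : R, 0 <= L & forall y z : 'rV[R[i]]_M,
    (forall i, normc (y ord0 i) <= B) -> (forall i, normc (z ord0 i) <= B) ->
    normc (f y) <= L /\
    forall e : R, (forall i, normc (y ord0 i - z ord0 i) <= e) -> 0 <= e ->
      normc (f y - f z) <= L * e)).
- move=> c; exists (normc c); first exact: normc_ge0.
  move=> y z _ _; split => // e _ e0; rewrite subrr normc0 mulr_ge0 ?normc_ge0 //.
- move=> i; exists (`|B| + 1) => [|y z hy hz]; first by rewrite addr_ge0.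
  split; first by apply: le_trans (hy i) _; apply: le_trans (ler_norm _) _; rewrite lerDl.
  move=> e he e0; apply: le_trans (he i) _.
  by rewrite mulrDl mul1r lerDr mulr_ge0.
- move=> f g [L L0 hL] [L' L'0 hL']; exists (L + L') => [|y z hy hz]; first exact: addr_ge0.
  have [b1 l1] := hL y z hy hz; have [b2 l2] := hL' y z hy hz; split.
    by apply: le_trans (normcD _ _) _; exact: lerD.
  move=> e he e0; rewrite opprD addrACA; apply: le_trans (normcD _ _) _.
  by rewrite mulrDl; apply: lerD; [exact: l1 | exact: l2].
- move=> f g [L L0 hL] [L' L'0 hL'].
  have LL : 0 <= L * L' by exact: mulr_ge0.
  exists (L * L' + L * L') => [|y z hy hz]; first exact: addr_ge0.
  have [b1 l1] := hL y z hy hz; have [b2 l2] := hL' y z hy hz.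
  have [b3 _] := hL' z y hz hy; split.
    rewrite normcM; apply: (@le_trans _ _ (L * L')); last by rewrite lerDl.
    by apply: ler_pM; rewrite ?normc_ge0.
  move=> e he e0.
  have -> : f y * g y - f z * g z = f y * (g y - g z) + (f y - f z) * g z by ring.
  apply: le_trans (normcD _ _) _; rewrite !normcM mulrDl; apply: lerD.
    rewrite -mulrA; apply: ler_pM; rewrite ?normc_ge0 //; exact: l2.
  rewrite mulrAC; apply: ler_pM; rewrite ?normc_ge0 //; exact: l1.
Qed.

Lemma proper_rat_ext (R : realType) (ps : seq R[i]) (G H : R[i] -> R[i]) (c : R[i]) :
  (forall z, z \notin ps -> G z = H z) -> proper_rat ps G c -> proper_rat ps H c.
Proof.
by move=> e [d [P [h1 h2 h3]]]; exists d, P; split => // z hz; rewrite -e // h3.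
Qed.

Section Hull.
Variable R : realType.
Local Notation C := R[i].
Implicit Types (i j : digit) (u v : seq digit) (z w : C) (a b : nat -> digit).
Local Notation center := (@center R).
Local Notation corner := (@corner R).
Local Notation potential := (@potential R).
Local Notation q := (4 / 5 : R).

Lemma sgnb_dist (s t : bool) : s != t -> `|sgnb R s - sgnb R t| = 2.
Proof.
case: s t => [] [] // _; rewrite /sgnb ?opprK.
  by rewrite ger0_norm; lra.
by rewrite ler0_norm; lra.
Qed.

(** The bound is the diameter of the outer discs of the annuli. *)
Lemma center_sep u v : size u = size v -> u != v ->
  3^-1 ^+ size u < normc (center u - center v).
Proof.
elim: u v => [|i u IH] [|j v] //= [suv] uv.
have t0 : 0 < (3^-1 : R) ^+ size u by rewrite exprn_gt0 // invr_gt0.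
have -> : (corner i + center u) / 3%:R - (corner j + center v) / 3%:R =
          (corner i - corner j + (center u - center v)) / 3%:R :> C.
  by rewrite -mulrBl opprD addrACA.
rewrite normcM normcV normc_nat exprS mulrC ltr_pM2r ?invr_gt0 //.
have [ij|ij] := eqVneq i j.
  rewrite ij subrr add0r; apply: IH => //.
  by apply: contraNneq uv => ->; rewrite ij.
have [hu1 hu2] := center_box R u; have [hv1 hv2] := center_box R v.
rewrite -suv in hv1 hv2; clear suv.
have far1 (s x y : R) : `|s| = 2 -> `|x| <= (1 - 3^-1 ^+ size u) / 2 ->
    `|y| <= (1 - 3^-1 ^+ size u) / 2 -> 3^-1 ^+ size u < `|s + (x - y)|.
  move=> hs hx hy; have h1 := lerB_dist s (- (x - y)); have h2 := ler_normB x y.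
  rewrite opprK normrN hs in h1; move: hx hy h1 h2 t0.
  by set t := _ ^+ _; lra.
have [e1|e1] := eqVneq i.1 j.1; last first.
  apply: lt_le_trans (Re_le_normc _); rewrite !(ReD, ReN) /=.
  by apply: far1 => //; exact: sgnb_dist.
apply: lt_le_trans (Im_le_normc _); rewrite !(ImD, ImN) /=.
apply: far1 => //; apply: sgnb_dist.
by apply: contraNneq ij => e2; move: e1 e2; case: (i) (j) => ? ? [? ?] /= -> ->.
Qed.

Lemma cauchy_le1 (T0 : C) w : normc T0 = 100 -> normc w <= 2 -> normc (cauchy_transform (w - T0)) <= 1.
Proof.
move=> hT hw; apply: (geometric_limit_le (third_rate R) (u := fun n => potential n (w - T0))).
  by move=> n; apply: cauchy_lim; exact: far_translate.
move=> n; apply: mean_le => v; rewrite normcV.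
have fw : far (1 + 1 / 2) (w - T0).
  have -> : 1 + 1 / 2 = 3 / 2 :> R by lra.
  exact: far_translate.
have h := far_center v fw.
by rewrite invf_le1 //; lra.
Qed.

Lemma boundary_le a : normc (boundary_value R a) <= 30 * 100.
Proof.
have h := boundary_near (annpt_ann R a 0).
have /andP[h1 _] := annpt_ann R a 0.
rewrite potential0 expr0 in h.
rewrite size_mkseq expr0 (_ : center (mkseq a 0) = 0) // subr0 in h1.
have h2 : normc (annpt R a 0)^-1 <= 4.
  by rewrite normcV -[4]invrK lef_pV2 ?posrE ?invr_gt0 //; lra.
by have := normc_le_dist (boundary_value R a) (annpt R a 0)^-1; rewrite normcBC; lra.
Qed.

Lemma ann_le2 u z : ann u z -> normc z <= 1.
Proof. by move=> /ann_box[h1 h2]; have := normc_le_ReIm z; lra. Qed.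

Section NearCantor.
Variables (n : nat) (a : nat -> digit) (y T0 : C).
Hypotheses (hT : normc T0 = 100) (hy : ann (mkseq a n) y).
Let qn0 : 0 <= q ^+ n. Proof. by rewrite exprn_ge0. Qed.

Lemma tame_near : normc (potential n (y - T0) - cauchy_transform (cantor_point R a - T0)) <= 10 * q ^+ n.
Proof.
have y2 : normc y <= 2 by have := ann_le2 hy; lra.
have l2 : normc (cantor_point R a) <= 2 by have := cantor_point_le1 R a; lra.
have h1 := cauchy_lim n (far_translate hT y2).
have h2 := cauchy_lip hT y2 l2; have h3 := ann_cantor_point hy.
have : (3^-1 : R) ^+ n <= q ^+ n by rewrite lerXn2r ?nnegrE; lra.
have := normc_triangle (cauchy_transform (y - T0)) (potential n (y - T0)) (cauchy_transform (cantor_point R a - T0)).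
by move: h1 h2 h3 qn0; set s := 3^-1 ^+ n; set t := q ^+ n; lra.
Qed.

Lemma wild_mul_near :
  normc (y * potential n y - cantor_point R a * boundary_value R a) <= 120 * 100 * q ^+ n.
Proof.
have -> : y * potential n y - cantor_point R a * boundary_value R a =
  y * (potential n y - boundary_value R a) + (y - cantor_point R a) * boundary_value R a by ring.
apply: le_trans (normcD _ _) _; rewrite !normcM.
have h1 := boundary_near hy; have h2 := ann_cantor_point hy; have h3 := boundary_le a.
have p1 : normc y * normc (potential n y - boundary_value R a) <= 1 * (20 * 100 * q ^+ n).
  by apply: ler_pM; rewrite ?normc_ge0 ?(ann_le2 hy).
have p2 : normc (y - cantor_point R a) * normc (boundary_value R a) <= 3 * q ^+ n * (30 * 100).
  by apply: ler_pM; rewrite ?normc_ge0.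
by move: p1 p2 qn0; set t := q ^+ n; lra.
Qed.

Lemma tame_mul_near :
  normc ((y - T0) * potential n (y - T0) - (cantor_point R a - T0) * cauchy_transform (cantor_point R a - T0))
  <= 120 * 100 * q ^+ n.
Proof.
have -> : forall s t u v : C, s * t - u * v = s * (t - v) + (s - u) * v by move=> *; ring.
have -> : y - T0 - (cantor_point R a - T0) = y - cantor_point R a by ring.
apply: le_trans (normcD _ _) _; rewrite !normcM.
have l2 : normc (cantor_point R a) <= 2 by have := cantor_point_le1 R a; lra.
have h1 := tame_near; have h2 := ann_cantor_point hy; have h3 := cauchy_le1 hT l2.
have h4 : normc (y - T0) <= 101.
  by have := normcD y (- T0); rewrite normcN hT; have := ann_le2 hy; lra.
have p1 := ler_pM (normc_ge0 _) (normc_ge0 _) h4 h1.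
have p2 := ler_pM (normc_ge0 _) (normc_ge0 _) h2 h3.
by move: p1 p2 qn0; set t := q ^+ n; lra.
Qed.

End NearCantor.

Variable N : nat.

(** The first [N + 1] coordinates of the embedding vanish on the Cantor sets. *)
Definition tail4 (x y z : C) : 'rV[C]_(N + 4) :=
  row_mx 0 (\row_(k < 4) nth 0 [:: 0; x; y; z] k).

Lemma tail4E (k : 'I_(N + 4)) :
  [\/ forall x y z, tail4 x y z ord0 k = 0, forall x y z, tail4 x y z ord0 k = x,
      forall x y z, tail4 x y z ord0 k = y | forall x y z, tail4 x y z ord0 k = z].
Proof.
rewrite /tail4; case: (split_ordP k) => [j ->|j ->].
  by constructor 1 => *; rewrite row_mxEl mxE.
case: j => [[|[|[|[|//]]]] hj].
- by constructor 1 => *; rewrite row_mxEr mxE.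
- by constructor 2 => *; rewrite row_mxEr mxE.
- by constructor 3 => *; rewrite row_mxEr mxE.
- by constructor 4 => *; rewrite row_mxEr mxE.
Qed.

(** The translation between the two Cantor squares. *)
Definition T0 : C := 100%:R.
Lemma normc_T0 : normc T0 = 100. Proof. exact: normc_nat. Qed.
Lemma normc_NT0 : normc (- T0) = 100. Proof. by rewrite normcN normc_T0. Qed.

(** The finite stages of [F]; their poles are the [poles n] below. *)
Definition curve n z := tail4 (potential n z) (z * potential n z) (potential n (z - T0)).

(** The limits of [curve n] at the first and at the second square.  On each of them one
    coordinate is tame, being the Cauchy transform of the distant square. *)
Definition point1 a := tail4 (boundary_value R a) (cantor_point R a * boundary_value R a) (cauchy_transform (cantor_point R a - T0)).
Definition point2 a := tail4 (cauchy_transform (cantor_point R a - - T0))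
  ((cantor_point R a - - T0) * cauchy_transform (cantor_point R a - - T0)) (boundary_value R a).

Definition poles n := [seq center u | u <- words n] ++ [seq center u + T0 | u <- words n].

Lemma proper_rat_mean (ps : seq C) n (F : seq digit -> C -> C) (c : seq digit -> C) :
  (forall v, v \in words n -> proper_rat ps (F v) (c v)) ->
  proper_rat ps (fun z => mean n (fun v => F v z)) (mean n c).
Proof.
move=> h; rewrite /mean; apply: proper_ratM; first exact: proper_rat_const.
elim: (words n) h => [|v s IH] h.
  by rewrite big_nil; under eq_fun do rewrite big_nil; exact: proper_rat_const.
rewrite big_cons; under eq_fun do rewrite big_cons.
by apply: proper_ratD; [apply: h; rewrite mem_head | apply: IH => w ws; apply: h; rewrite inE ws orbT].
Qed.

(** In the second coordinate [z / (z - c) = 1 + c / (z - c)] contributes [1] at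
    infinity. *)
Lemma curve_proper n k :
  proper_rat (poles n) (fun z => curve n z ord0 k) (tail4 0 1 0 ord0 k).
Proof.
have in1 v : v \in words n -> center v \in poles n.
  by move=> hv; rewrite mem_cat map_f.
have in2 v : v \in words n -> center v + T0 \in poles n.
  by move=> hv; rewrite mem_cat (map_f (fun u => center u + T0)) ?orbT.
have P1 : proper_rat (poles n) (fun z => potential n z) 0.
  rewrite -(mean_const n 0); apply: proper_rat_mean => v hv.
  by apply: proper_rat_pole; exact: in1.
rewrite /curve; case: (tail4E k) => e; rewrite e; under eq_fun do rewrite e.
- exact: proper_rat_const.
- exact: P1.
- rewrite -(mean_const n 1).
  apply: (@proper_rat_ext R _ (fun z => mean n (fun v => 1 + center v * (z - center v)^-1))).
    move=> z hz; rewrite /potential meanZ /mean; congr (_ * _).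
    rewrite big_seq [RHS]big_seq; apply: eq_bigr => v hv.
    have n0 : z - center v != 0.
      by rewrite subr_eq0; apply: contraNneq hz => ->; exact: in1.
    by field.
  apply: proper_rat_mean => v hv; rewrite -[X in proper_rat _ _ X]addr0.
  apply: proper_ratD; first exact: proper_rat_const.
  rewrite -(mulr0 (center v)); apply: proper_ratM; first exact: proper_rat_const.
  by apply: proper_rat_pole; exact: in1.
- rewrite -(mean_const n 0); apply: proper_rat_mean => v hv.
  apply: (@proper_rat_ext R _ (fun z => (z - (center v + T0))^-1)).
    by move=> z _; congr (_^-1); ring.
  by apply: proper_rat_pole; exact: in2.
Qed.

Lemma poles_sep n x y : x \in poles n -> y \in poles n ->
  x = y \/ 4 * (3^-1 ^+ n / 4) < normc (x - y).
Proof.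
have -> : 4 * (3^-1 ^+ n / 4) = 3^-1 ^+ n :> R by field.
have same u v : u \in words n -> v \in words n -> center u = center v \/
    3^-1 ^+ n < normc (center u - center v).
  move=> hu hv; have [->|uv] := eqVneq u v; [by left|right].
  have := center_sep _ uv; rewrite (size_words hu) (size_words hv); exact.
have cross u v : 3^-1 ^+ n < normc (center u - center v - T0).
  have h1 : (3^-1 : R) ^+ n <= 1 by rewrite exprn_ile1 //; lra.
  have := normc_le_dist (- T0) (center u - center v - T0); rewrite normc_NT0.
  have -> : - T0 - (center u - center v - T0) = - (center u - center v) by ring.
  rewrite normcN; have := normcD (center u) (- center v); rewrite normcN.
  by have := center_le1 R u; have := center_le1 R v; move: h1; set t := _ ^+ n; lra.
rewrite !mem_cat => /orP[] /mapP[u hu ->] /orP[] /mapP[v hv ->].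
- exact: same.
- by right; rewrite opprD addrA.
- right; rewrite normcBC opprD addrA; exact: cross.
- have -> : center u + T0 - (center v + T0) = center u - center v by ring.
  by have [->|h] := same u v hu hv; [left|right].
Qed.

Lemma poles_uniq n : uniq (poles n).
Proof.
have inj u v : u \in words n -> v \in words n -> center u = center v -> u = v.
  move=> hu hv e; apply/eqP; apply: contraT => uv.
  have := center_sep _ uv; rewrite (size_words hu) (size_words hv) e subrr normc0 => /(_ erefl).
  by rewrite ltNge exprn_ge0 // invr_ge0.
rewrite cat_uniq !map_inj_in_uniq ?uniq_words //= ?andbT.
- apply/hasPn => x /mapP[u hu ->]; apply/negP => /mapP[v hv e].
  have h1 := center_le1 R u; have h2 := center_le1 R v.
  have eT : T0 = center v - center u by rewrite -e addrC addKr.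
  have := normcD (center v) (- center u); rewrite -eT normcN normc_T0 => h3.
  by clear e eT; lra.
- by move=> u v hu hv /addIr; exact: inj.
Qed.

Lemma curve_near1 n a z k : ann (mkseq a n) z ->
  normc (curve n z ord0 k - point1 a ord0 k) <= 120 * 100 * q ^+ n.
Proof.
move=> hz; have t0 : 0 <= q ^+ n by rewrite exprn_ge0.
rewrite /curve /point1; case: (tail4E k) => e; rewrite !e.
- by rewrite subrr normc0 mulr_ge0.
- by have := boundary_near hz; move: t0; set t := q ^+ n; lra.
- exact: wild_mul_near.
- by have := tame_near normc_T0 hz; move: t0; set t := q ^+ n; lra.
Qed.

Lemma curve_near2 n a y k : ann (mkseq a n) y ->
  normc (curve n (y + T0) ord0 k - point2 a ord0 k) <= 120 * 100 * q ^+ n.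
Proof.
move=> hy; have t0 : 0 <= q ^+ n by rewrite exprn_ge0.
have e1 : y + T0 = y - - T0 by rewrite opprK.
rewrite /curve /point2 addrK e1; case: (tail4E k) => e; rewrite !e.
- by rewrite subrr normc0 mulr_ge0.
- by have := tame_near normc_NT0 hy; move: t0; set t := q ^+ n; lra.
- exact: tame_mul_near normc_NT0 hy.
- by have := boundary_near hy; move: t0; set t := q ^+ n; lra.
Qed.

Lemma point_bounded a k : normc (point1 a ord0 k) <= 40 * 100 /\ normc (point2 a ord0 k) <= 40 * 100.
Proof.
have l1 := cantor_point_le1 R a; have l2 : normc (cantor_point R a) <= 2 by lra.
have b1 := boundary_le a; have c1 := cauchy_le1 normc_T0 l2; have c2 := cauchy_le1 normc_NT0 l2.
have m1 : normc (cantor_point R a * boundary_value R a) <= 1 * (30 * 100).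
  by rewrite normcM; apply: ler_pM; rewrite ?normc_ge0.
have m2 : normc ((cantor_point R a - - T0) * cauchy_transform (cantor_point R a - - T0)) <= 101 * 1.
  rewrite normcM; apply: ler_pM; rewrite ?normc_ge0 //.
  by have := normcD (cantor_point R a) (- - T0); rewrite opprK normc_T0; lra.
rewrite /point1 /point2; case: (tail4E k) => e; rewrite !e ?normc0; split; lra.
Qed.

(** If [p] vanished at [tail4 0 1 0], the value of every [curve n] at infinity, then
    around some pole [p o curve n] would differ from its value at a point [y] of [X]
    by a quarter of [|p y|], although [curve n] is within [O (q ^ n)] of [y] there. *)
Theorem curve_hull (X : set 'rV[C]_(N + 4)) (p : mpoly.mpoly (N + 4) C) (delta : R) :
  (forall u, exists2 a, mkseq a (size u) = u & X (point1 a)) ->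
  (forall u, exists2 a, mkseq a (size u) = u & X (point2 a)) ->
  0 < delta -> (forall y, X y -> delta <= normc (peval p y)) ->
  peval p (tail4 0 1 0) <> 0.
Proof.
move=> X1 X2 d0 hX p0.
pose B : R := 200 * 100.
have [L L0 hL] := peval_lipschitz p B.
have key n x y : X y -> normc (peval p y) / 4 < normc (peval p x - peval p y) ->
    (forall k, normc (y ord0 k) <= 40 * 100) ->
    (forall k, normc (x ord0 k - y ord0 k) <= 120 * 100 * q ^+ n) ->
    delta <= 4 * L * (120 * 100) * q ^+ n.
  move=> Xy hosc by_ xy.
  have t0 : 0 <= q ^+ n by rewrite exprn_ge0.
  have t1 : q ^+ n <= 1 by rewrite exprn_ile1 //; lra.
  have bx k : normc (x ord0 k) <= B.
    have := normc_le_dist (x ord0 k) (y ord0 k); have := by_ k; have := xy k.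
    by rewrite /B; move: t1; set t := q ^+ n; lra.
  have by' k : normc (y ord0 k) <= B by have := by_ k; rewrite /B; lra.
  have [_ /(_ _ xy)] := hL x y bx by'.
  have e0 : 0 <= 120 * 100 * q ^+ n by rewrite mulr_ge0.
  move=> /(_ e0); have := hX y Xy; move: hosc.
  by set t := q ^+ n; lra.
have small n : delta <= 4 * L * (120 * 100) * q ^+ n.
  have G0 : proper_rat (poles n) (fun z => peval p (curve n z)) 0.
    rewrite -p0; apply: proper_rat_peval => k; exact: curve_proper.
  have r0 : 0 < (3^-1 : R) ^+ n / 4 by rewrite divr_gt0 // exprn_gt0 // invr_gt0.
  have sz : (0 < size (poles n))%N.
    rewrite size_cat !size_map addn_gt0.
    have := words_mem (nseq n (true, true)); rewrite size_nseq.
    by case: (words n).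
  have [c cin hc] := proper_rat_oscillation G0 r0 sz (poles_uniq n) (@poles_sep n).
  have nz y : X y -> peval p y != 0.
    by move=> /hX h; rewrite -normc_gt0; lra.
  move: cin; rewrite mem_cat => /orP[] /mapP[u hu cE].
    have su := size_words hu; have [a au Xa] := X1 u; rewrite su in au.
    have [z hz osc] := hc _ (nz _ Xa).
    apply: (key n (curve n z) (point1 a)) => //.
      by move=> k; have [] := point_bounded a k.
    by move=> k; apply: curve_near1; rewrite /ann au su -cE.
  have su := size_words hu; have [a au Xa] := X2 u; rewrite su in au.
  have [z hz osc] := hc _ (nz _ Xa).
  apply: (key n (curve n z) (point2 a)) => //.
    by move=> k; have [] := point_bounded a k.
  move=> k; rewrite -[z](subrK T0); apply: curve_near2; rewrite /ann au su.
  by have -> : z - T0 - center u = z - c by rewrite cE; ring.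
have : delta <= 0.
  apply: (@le_geometric R _ _ (4 * L * (120 * 100)) q).
    by apply/andP; split; lra.
  by move=> n; rewrite add0r; exact: small.
by lra.
Qed.

End Hull.

(** * The embedding *)

Section CodedFunctions.
Variables (R : realType) (T : normedModType R).
Local Notation C := R[i].
Variables (Z C0 : set T) (alpha : T -> nat -> digit).
Hypothesis cc : coded_cantor Z C0 alpha.

(** Nearby points of the Cantor set share many digits. *)
Lemma coded_cont (F : (nat -> digit) -> C) (B q : R) : 0 <= q < 1 ->
  (forall a b n, mkseq a n = mkseq b n -> normc (F a - F b) <= B * q ^+ n) ->
  cont_at_points C0 (fun x => F (alpha x)).
Proof.
move=> hq hF x Cx e e0.
have B1 : 0 < `|B| + 1 by rewrite ltr_pwDr.
have [n hn] := expr_lt_eps hq (divr_gt0 e0 B1).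
apply: filterS (cc_cont cc n Cx) => y hy Cy.
apply: le_lt_trans (hF _ _ _ (hy Cy)) _.
have q0 : 0 <= q ^+ n by rewrite exprn_ge0 //; case/andP: hq.
rewrite ltr_pdivlMr // in hn; have := ler_wpM2r q0 (ler_norm B).
by move: hn q0; set t := q ^+ n; lra.
Qed.

Lemma cantor_point_coded_cont : cont_at_points C0 (fun x => cantor_point R (alpha x)).
Proof.
apply: (coded_cont (B := 4) (third_rate R)) => a b n ab.
have h1 := cantor_point_prefix R a n; have h2 := cantor_point_prefix R b n; rewrite -ab in h2.
apply: le_trans (normc_triangle (center R (mkseq a n)) _ _) _.
by rewrite normcBC; move: h1 h2; set t := _ ^+ n; lra.
Qed.

Lemma boundary_coded_cont : cont_at_points C0 (fun x => boundary_value R (alpha x)).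
Proof.
apply: (coded_cont (B := 40 * 100) (q := 4 / 5)); first by apply/andP; split; lra.
move=> a b n ab; have ha := annpt_ann R a n.
have h1 := boundary_near ha; rewrite ab in ha; have h2 := boundary_near ha.
apply: le_trans (normc_triangle (potential n (annpt R a n)) _ _) _.
by rewrite normcBC; move: h1 h2; set t := _ ^+ n; lra.
Qed.

Lemma cauchy_coded_cont (T0 : C) : normc T0 = 100 ->
  cont_at_points C0 (fun x => cauchy_transform (cantor_point R (alpha x) - T0)).
Proof.
move=> hT; have l2 a : normc (cantor_point R a) <= 2 by have := cantor_point_le1 R a; lra.
move=> x Cx e e0; apply: filterS (cantor_point_coded_cont Cx e0) => y hy /hy.
by apply: le_lt_trans; exact: cauchy_lip.
Qed.

End CodedFunctions.

Section Density.
Variables (R : realType) (T : normedModType R) (M : nat).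
Local Notation C := R[i].
Variables (K Z C0 : set T) (alpha : T -> nat -> digit) (pi : T -> 'rV[C]_M) (T0 : C) (k : 'I_M).
Hypotheses (cK : compact K) (C0K : C0 `<=` K) (cc : coded_cantor Z C0 alpha).
Hypothesis cpi : forall i, cont_at_points K (fun x => pi x ord0 i).
Hypotheses (hT : normc T0 = 100)
  (tame : forall x, C0 x -> pi x ord0 k = cauchy_transform (cantor_point R (alpha x) - T0)).
Hypothesis sep : forall x y, K x -> K y -> x <> y -> ~ (C0 x /\ C0 y) ->
  exists2 h : T -> R, poly_closure K pi (fun x => toC (h x)) & h x <> h y.

(** The tame coordinate generates, on the Cantor set, the point of the Cantor square,
    hence its conjugate, hence everything; the real coordinates do the rest. *)
Theorem poly_closure_full f : cont_at_points K f -> poly_closure K pi f.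
Proof.
have ua := poly_closure_algebra cK cpi.
apply: (algebra_localization ua C0K cK sep).
have ua0 := uniform_closure_algebra (subalgebra_restrict ua C0K).
set A0 := uniform_closure C0 _ in ua0 *.
have Axi : A0 (fun x => cantor_point R (alpha x)).
  apply: (ua_cauchy_inverse ua0 hT); first by move=> x _; exact: cantor_point_le1.
  have Ak : A0 (fun x => pi x ord0 k).
    by apply: uniform_closure_sub; exact: poly_closure_coord.
  by apply: (ua_eq ua0 Ak).
have Are := ua_Re_cantor_point ua0 Axi.
have Aim : A0 (fun x => toC (complex.Im (cantor_point R (alpha x)))).
  have H := ua_scale ua0 (Complex 0 (-1)) (ua_sub_fun ua0 Axi Are).
  apply: (ua_eq ua0 H) => x _; case: (cantor_point R (alpha x)) => a b; apply/eqP.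
  by rewrite eq_complex /= subrr !(mul0r,mulr0,mulN1r,subr0,addr0,add0r,oppr0,sub0r,opprK) !eqxx.
apply: (complex_stone_weierstrass ua0 (cc_compact cc)) => x y Cx Cy xy.
have ne : cantor_point R (alpha x) <> cantor_point R (alpha y).
  by move=> /cantor_point_inj /(cc_inj cc Cx Cy).
have [e|nr] := pselect (complex.Re (cantor_point R (alpha x)) = complex.Re (cantor_point R (alpha y))).
  exists (fun x => complex.Im (cantor_point R (alpha x))) => // e'; apply: ne.
  by move: e e'; case: (cantor_point R (alpha x)) (cantor_point R (alpha y)) => [? ?] [? ?] /= -> ->.
by exists (fun x => complex.Re (cantor_point R (alpha x))).
Qed.

End Density.

Section Embedding.
Variables (R : realType) (N : nat).
Local Notation C := R[i].
Local Notation T := 'rV[R]_N.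

(** Off the zero set of [d] the first [N + 1] coordinates determine the point. *)
Definition cone_map (d : T -> R) (g1 g2 g3 : T -> C) (x : T) : 'rV[C]_(N + 4) :=
  row_mx (\row_(i < N) toC (d x * x ord0 i))
         (\row_(k < 4) nth 0 [:: toC (d x); g1 x; g2 x; g3 x] k).

Definition idx (k : nat) (hk : (k < 4)%N) : 'I_(N + 4) := rshift N (Ordinal hk).

Variables (d : T -> R) (g1 g2 g3 : T -> C).
Local Notation pi := (cone_map d g1 g2 g3).

Lemma cone_mapl x i : pi x ord0 (lshift 4 i) = toC (d x * x ord0 i).
Proof. by rewrite row_mxEl mxE. Qed.

Lemma cone_mapr x k (hk : (k < 4)%N) :
  pi x ord0 (idx hk) = nth 0 [:: toC (d x); g1 x; g2 x; g3 x] k.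
Proof. by rewrite row_mxEr mxE. Qed.

Lemma cone_map_zero x : d x = 0 -> pi x = tail4 N (g1 x) (g2 x) (g3 x).
Proof.
move=> dx; rewrite /cone_map /tail4 dx; congr row_mx.
by apply/rowP => i; rewrite !mxE mul0r.
Qed.

Lemma cone_map_cont (K : set T) : real_cont K d ->
  cont_at_points K g1 -> cont_at_points K g2 -> cont_at_points K g3 ->
  forall i, cont_at_points K (fun x => pi x ord0 i).
Proof.
move=> cd c1 c2 c3 i; case: (split_ordP i) => [j ->|[k hk] ->].
  under eq_fun do rewrite cone_mapl rmorphM.
  by apply: cont_mul => //; exact: coord_cont.
under eq_fun do rewrite (cone_mapr _ hk).
by case: k hk => [|[|[|[|//]]]] hk.
Qed.

Lemma cone_map_sep x y : d x <> 0 -> pi x = pi y -> x = y.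
Proof.
move=> /eqP dx0 e.
have h0 : (0 < 4)%N by [].
have ed : d x = d y.
  have := congr1 (fun z : 'rV[C]_(N + 4) => z ord0 (idx h0)) e.
  by rewrite !cone_mapr /= => /complexI.
apply/rowP => i; have := congr1 (fun z : 'rV[C]_(N + 4) => z ord0 (lshift 4 i)) e.
by rewrite !cone_mapl -ed => /complexI /(mulfI dx0).
Qed.

Lemma tail4_inj (a b c a' b' c' : C) : tail4 N a b c = tail4 N a' b' c' ->
  [/\ a = a', b = b' & c = c'].
Proof.
move=> e; have h (k : 'I_4) := congr1 (fun z : 'rV[C]_(N + 4) => z ord0 (rshift N k)) e.
have := h (Ordinal (isT : (1 < 4)%N)); have := h (Ordinal (isT : (2 < 4)%N)).
by have := h (Ordinal (isT : (3 < 4)%N)); rewrite !row_mxEr !mxE /= => -> -> ->.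
Qed.

Lemma cone_map_separates (K C0 : set T) : (forall x, K x -> d x = 0 -> C0 x) ->
  forall x y, K x -> K y -> x <> y -> ~ (C0 x /\ C0 y) ->
  exists2 h : T -> R, poly_closure K pi (fun x => toC (h x)) & h x <> h y.
Proof.
move=> h0 x y Kx Ky xy nC; have h04 : (0 < 4)%N by [].
have [e|ne] := pselect (d x = d y); last first.
  exists d => //; have := poly_closure_coord K pi (idx h04).
  by under eq_fun do rewrite cone_mapr.
have dx : d x != 0.
  by apply/eqP => dx; apply: nC; split; apply: h0 => //; rewrite -e.
have [i ni] : exists i, x ord0 i <> y ord0 i.
  apply: contrapT => hn; apply: xy; apply/rowP => i; apply: contrapT => h.
  by apply: hn; exists i.
exists (fun z => d z * z ord0 i); last by rewrite -e => /(mulfI dx).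
have := poly_closure_coord K pi (lshift 4 i).
by under eq_fun do rewrite cone_mapl.
Qed.

End Embedding.

Lemma cont_at_points_sub (R : realType) (T : topologicalType) (K S : set T) (f : T -> R[i]) :
  K `<=` S -> cont_at_points S f -> cont_at_points K f.
Proof.
move=> KS cf x /KS Sx e e0; apply: filterS (cf x Sx e e0) => y hy /KS; exact: hy.
Qed.

(** Disjoint closed sets do not interact. *)
Lemma cont_union (R : realType) (T : topologicalType) (A B : set T) (f g : T -> R[i]) :
  closed A -> closed B -> A `&` B = set0 -> cont_at_points A f -> cont_at_points B g ->
  cont_at_points (A `|` B) (fun x => if `[< A x >] then f x else g x).
Proof.
move=> clA clB AB cf cg x; have disj y : A y -> B y -> False.
  by move=> Ay By; have : (A `&` B) y by []; rewrite AB.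
move=> [Ax|Bx] e e0.
  have nb : nbhs x (~` B).
    by apply: open_nbhs_nbhs; split; [exact: closed_openC | exact: disj Ax].
  apply: filterS2 nb (cf x Ax e e0) => y nBy hy [Ay|//].
  by rewrite (asboolT Ay) (asboolT Ax); exact: hy.
have nAx : ~ A x by move=> Ax; exact: disj Ax Bx.
have nb : nbhs x (~` A) by apply: open_nbhs_nbhs; split => //; exact: closed_openC.
apply: filterS2 nb (cg x Bx e e0) => y nAy hy [//|By].
by rewrite (asboolF nAy) (asboolF nAx); exact: hy.
Qed.

Unset Implicit Arguments.
Set Strict Implicit.
Set Printing Implicit Defensive.

Theorem corollary3p14 (R : realType) (N : nat) (J K1 K2 : set 'rV[R]_N)
    (J_compact : compact J)
    (K1_closed : closed (K1 : set (subspace J)))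
    (K2_closed : closed (K2 : set (subspace J)))
    (K_union : K1 `|` K2 = J)
    (JK1_uncountable : ~ countable (J `\` K1))
    (JK2_uncountable : ~ countable (J `\` K2)) :
  exists pi : 'rV[R]_N -> 'rV[R[i]]_(N + 4),
    [/\ embedding_on J pi,
        nontrivial_rational_hull (pi @` J),
        polynomially_convex (pi @` K1) /\ polynomially_convex (pi @` K2) &
        poly_algebra (pi @` K1) = cont_algebra (pi @` K1) /\
        poly_algebra (pi @` K2) = cont_algebra (pi @` K2)].
Proof.
have K1J : K1 `<=` J by rewrite -K_union => x; left.
have K2J : K2 `<=` J by rewrite -K_union => x; right.
have relclosed (K : set 'rV[R]_N) : K `<=` J -> closed (K : set (subspace J)) ->
    exists2 V, closed V & K = J `&` V.
  move=> KJ /closed_subspaceP[V clV VJ]; exists V => //.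
  by rewrite setIC VJ; apply/esym/setIidPl.
have [V1 clV1 K1V] := relclosed _ K1J K1_closed.
have [V2 clV2 K2V] := relclosed _ K2J K2_closed.
have cK1 : compact K1 by rewrite K1V; exact: compact_closedI.
have cK2 : compact K2 by rewrite K2V; exact: compact_closedI.
have JV (V : set 'rV[R]_N) : J `\` (J `&` V) = J `\` V.
  by apply/seteqP; split=> x [Jx nx]; split => // Vx; apply: nx => //; case: Vx.
have nc1 : ~ countable (J `\` V1) by rewrite -JV -K1V.
have nc2 : ~ countable (J `\` V2) by rewrite -JV -K2V.
have [C2 [a2 cc2]] := coded_cantor_exists J_compact clV1 nc1.
have [C1 [a1 cc1]] := coded_cantor_exists J_compact clV2 nc2.
have C1J : C1 `<=` J by move=> x /(cc_sub cc1)[].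
have C2J : C2 `<=` J by move=> x /(cc_sub cc2)[].
have C1K2 x : C1 x -> ~ K2 x by move=> /(cc_sub cc1)[_ nV]; rewrite K2V => -[].
have C2K1 x : C2 x -> ~ K1 x by move=> /(cc_sub cc2)[_ nV]; rewrite K1V => -[].
have C1K1 : C1 `<=` K1.
  by move=> x Cx; have := C1J x Cx; rewrite -K_union => -[//|/(C1K2 x Cx)].
have C2K2 : C2 `<=` K2.
  by move=> x Cx; have := C2J x Cx; rewrite -K_union => -[/(C2K1 x Cx)|].
have C12 : C1 `&` C2 = set0.
  by rewrite -subset0 => x [Cx Dx]; apply: (C1K2 x Cx); exact: C2K2.
have haus := @norm_hausdorff R 'rV[R]_N.
have clC1 : closed C1 := compact_closed haus (cc_compact cc1).
have clC2 : closed C2 := compact_closed haus (cc_compact cc2).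
pose S := C1 `|` C2.
have cS : compact S by apply: compactU; [exact: cc_compact cc1 | exact: cc_compact cc2].
have clS : closed S := compact_closed haus cS.
have [x1 Cx1 _] := cc_surj cc1 [::]; have [x2 Cx2 _] := cc_surj cc2 [::].
have S0 : S !=set0 by exists x1; left.
pose t := T0 R.
have extend (f g : 'rV[R]_N -> R[i]) : cont_at_points C1 f -> cont_at_points C2 g ->
    exists h : 'rV[R]_N -> R[i], [/\ forall x, C1 x -> h x = f x,
      forall x, C2 x -> h x = g x & cont_at_points setT h].
  move=> cf cg; have [h hh ch] := tietze_complex cS (cont_union clC1 clC2 C12 cf cg).
  exists h; split => // x Cx.
    by rewrite hh; [rewrite asboolT | left].
  have nC : ~ C1 x by move=> /C1K2; apply; exact: C2K2.
  by rewrite hh; [rewrite asboolF | right].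
have cl1 := cantor_point_coded_cont (R := R) cc1; have cl2 := cantor_point_coded_cont (R := R) cc2.
have cb1 := boundary_coded_cont (R := R) cc1; have cb2 := boundary_coded_cont (R := R) cc2.
have cc1' := cauchy_coded_cont cc1 (normc_T0 R).
have cc2' := cauchy_coded_cont cc2 (normc_NT0 R).
have [g1 [g11 g12 cg1]] := extend _ _ cb1 cc2'.
have [g2 [g21 g22 cg2]] := extend _ _ (cont_mul cl1 cb1)
  (cont_mul (cont_add cl2 (cont_cst (- - t))) cc2').
have [g3 [g31 g32 cg3]] := extend _ _ cc1' cb2.
pose d := set_dist S; pose pi := cone_map d g1 g2 g3.
have d0 x : d x = 0 <-> S x := set_dist_eq0 x clS S0.
have pi1 x : C1 x -> pi x = point1 R N (a1 x).
  by move=> Cx; rewrite /pi cone_map_zero ?g11 ?g21 ?g31 //; apply/d0; left.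
have pi2 x : C2 x -> pi x = point2 R N (a2 x).
  by move=> Cx; rewrite /pi cone_map_zero ?g12 ?g22 ?g32 //; apply/d0; right.
have cpi (K : set 'rV[R]_N) i : cont_at_points K (fun x => pi x ord0 i).
  by apply: cone_map_cont; [exact: set_dist_cont | | | ]; apply: (@cont_at_points_sub _ _ _ setT).
have inj x y : J x -> J y -> pi x = pi y -> x = y.
  move=> Jx Jy e.
  have [dx|/contrapT dx] := pselect (d x <> 0); first exact: (cone_map_sep dx e).
  have [dy|/contrapT dy] := pselect (d y <> 0).
    by apply/esym; exact: (cone_map_sep dy (esym e)).
  have l2 a : normc (cantor_point R a) <= 2 by have := cantor_point_le1 R a; lra.
  (* A common value would give [z * h z = z' * h z'] with [h z = h z' <> 0], but the
     points [z] and [z'] of the two squares differ. *)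
  have cross a b : point1 R N a <> point2 R N b.
    move=> /tail4_inj[e1 e2 _]; rewrite e1 in e2.
    have nz := cauchy_neq0 (normc_NT0 R) (l2 b).
    move: e2 => /(mulIf nz) e2; have := cantor_point_le1 R a.
    rewrite e2 opprK; have := normc_le_dist (T0 R) (cantor_point R b + T0 R).
    have -> : T0 R - (cantor_point R b + T0 R) = - cantor_point R b by ring.
    by rewrite normcN normc_T0; have := cantor_point_le1 R b; lra.
  case/d0: dx => Cx; case/d0: dy => Cy; move: e.
  - rewrite pi1 // pi1 // => /tail4_inj[_ _ /(cauchy_inj (normc_T0 R) (l2 _) (l2 _))].
    by move=> /cantor_point_inj /(cc_inj cc1 Cx Cy).
  - by rewrite pi1 // pi2 // => /cross.
  - by rewrite pi2 // pi1 // => /esym /cross.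
  - rewrite pi2 // pi2 // => /tail4_inj[/(cauchy_inj (normc_NT0 R) (l2 _) (l2 _)) + _ _].
    by move=> /cantor_point_inj /(cc_inj cc2 Cx Cy).
have dense1 f : cont_at_points K1 f -> poly_closure K1 pi f.
  apply: (poly_closure_full cK1 C1K1 cc1 (cpi K1) (normc_T0 R)
    (k := idx N (isT : (3 < 4)%N))).
    by move=> x Cx; rewrite cone_mapr /= g31.
  apply: cone_map_separates => x Kx /d0 [//|/C2K1] //.
have dense2 f : cont_at_points K2 f -> poly_closure K2 pi f.
  apply: (poly_closure_full cK2 C2K2 cc2 (cpi K2) (normc_NT0 R)
    (k := idx N (isT : (1 < 4)%N))).
    by move=> x Cx; rewrite cone_mapr /= g12.
  apply: cone_map_separates => x Kx /d0 [/C1K2|] //.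
exists pi; split.
- exact: embedding_compact.
- exists (tail4 N 0 1 0); split; last first.
    move=> [x Jx e].
    have dx : d x = 0.
      have := congr1 (fun z : 'rV[R[i]]_(N + 4) => z ord0 (idx N (isT : (0 < 4)%N))) e.
      by rewrite cone_mapr row_mxEr mxE /= => /complexI.
    have l2 a : normc (cantor_point R a) <= 2 by have := cantor_point_le1 R a; lra.
    case/d0: dx => Cx; move: e.
      rewrite pi1 // => /tail4_inj[_ _ /eqP].
      by rewrite (negbTE (cauchy_neq0 (normc_T0 R) (l2 _))).
    rewrite pi2 // => /tail4_inj[/eqP + _ _].
    by rewrite (negbTE (cauchy_neq0 (normc_NT0 R) (l2 _))).
  move=> p; set c := peval p _; apply: contrapT => nc.
  have [m hm] := @peval_const R (N + 4) (- c); have [q hq] := peval_add p m.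
  have nz x : S x -> peval q (pi x) != 0.
    move=> Sx; rewrite hq hm subr_eq0; apply/eqP => e; apply: nc.
    by exists (pi x) => //; exists x => //; case: Sx => [/C1J|/C2J].
  have cq : cont_at_points S (fun x => peval q (pi x)).
    by apply: (sub_cont (poly_functions_subalgebra cS (cpi S))); exists q.
  have [B hB] := cont_bounded cS (cont_inv cq nz).
  have B1 : 0 < `|B| + 1 by rewrite ltr_pwDr.
  apply: (@curve_hull R N (pi @` S) q (`|B| + 1)^-1); first 1 last.
  + move=> u; have [x Cx xu] := cc_surj cc2 u; exists (a2 x) => //.
    by exists x; [right | rewrite pi2].
  + by rewrite invr_gt0.
  + move=> _ [x Sx <-]; have := hB x Sx; rewrite normcV => h.
    rewrite -[leRHS]invrK lef_pV2 ?posrE ?invr_gt0 ?normc_gt0 ?nz //.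
    by apply: le_trans h _; apply: le_trans (ler_norm _) _; rewrite lerDl.
  + by rewrite hq hm subrr.
  + move=> u; have [x Cx xu] := cc_surj cc1 u; exists (a1 x) => //.
    by exists x; [left | rewrite pi1].
- split; apply: polynomially_convex_full => //.
  + by exists x1; exact: C1K1.
  + by exists x2; exact: C2K2.
- by split; apply: poly_algebra_full.
Qed.
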